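(* Let $1<a<2$, $p>0$, $j\in\mathbb{Z}$, let $K\geq 2$ be an even integer, let $\epsilon,\kappa\in\,]0;1[$, $M>0$, and let $k\geq1$ be an integer such that $a^{-k}<2-a$. Define $J\in[j+K-1;j+K]$ by $$a^J=\frac{2}{a+1}a^{j+K}+\frac{a-1}{a+1}a^j,$$ and define $$c=1-\frac{a-1}{1-a^{-k}}\in\,]0;1[,\qquad d_M=c-4\,\frac{e^{-\pi M/(K+2)}}{1-e^{-\pi M/(K+2)}} .$$ Let $f^{(1)},f^{(2)}\in L^2(\mathbb{R})$ be non-zero functions with $\hat f^{(1)}(\omega)=\hat f^{(2)}(\omega)=0$ for a.e. $\omega<0$. Assume that $\kappa\geq\epsilon^{2(1-c)}$ and that, for all $x\in[-Ma^{j+K};Ma^{j+K}]$ and $l=j+1,\dots,j+K$, $$\left||f^{(1)}\star\psi_l(x)|^2-|f^{(2)}\star\psi_l(x)|^2\right|\leq\epsilon N_l^2,$$ $$|f^{(1)}\star\psi_l(x)|^2,\ |f^{(2)}\star\psi_l(x)|^2\geq\kappa N_l^2 .$$ Then, for any $x\in\left[-\frac{Ma^{j+K}}{2};\frac{Ma^{j+K}}{2}\right]$, as soon as $d_M<1$, $$\frac{1}{N_JN_j}\left|\overline{f^{(1)}\star\psi_J(x)}\,\big(f^{(1)}\star\psi_j(x)\big)-\overline{f^{(2)}\star\psi_J(x)}\,\big(f^{(2)}\star\psi_j(x)\big)\right|\leq\frac{C_K}{\kappa^{K/4}}\,\epsilon^{d_M},$$ where $$C_K=\frac{6}{1-\sqrt{\kappa}}\prod_{s=0}^{K/2-1}\left(a^{p(k-1)}\frac{N_{n_s-1-k}}{N_{n_s-2}}\right),\qquad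 n_s=j+K-2s .$$
   Context: Fourier transform: $\hat f(\omega)=\int_{\mathbb{R}}f(x)e^{-i\omega x}dx$, extended to $L^2$. For every real number $l$ (not necessarily an integer), $\psi_l$ is the Cauchy wavelet of order $p$ given by $\hat\psi_l(\omega)=\hat\psi(a^l\omega)$ with $\hat\psi(\omega)=\omega^pe^{-\omega}1_{\omega>0}$; the function $f\star\psi_l$ (continuous and bounded) has Fourier transform $\hat f\hat\psi_l$; and $N_l=\sup_{x\in\mathbb{R},\,s=1,2}|f^{(s)}\star\psi_l(x)|$. *)

(* Defs.v *)
From HB Require Import structures.
From mathcomp Require Import all_boot all_order all_algebra.
From mathcomp Require Import all_classical all_reals all_analysis.
From mathcomp Require Import complex.

Set Implicit Arguments.
Unset Strict Implicit.
Unset Printing Implicit Defensive.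

Import Order.TTheory GRing.Theory Num.Theory.
Import numFieldNormedType.Exports.
Import ComplexField.Normc.

Local Open Scope classical_set_scope.
Local Open Scope ring_scope.
Local Open Scope complex_scope.

Section ComplexAnalysis.
Context {R : realType}.
Local Notation mu := (@lebesgue_measure R).

Definition cintegral (h : R -> R[i]) : R[i] :=
  (\int[mu]_x complex.Re (h x)) +i* (\int[mu]_x complex.Im (h x)).

Definition cLfun (q : \bar R) (f : R -> R[i]) : Prop :=
  (@complex.Re R \o f \in Lfun mu q) /\ (@complex.Im R \o f \in Lfun mu q).

(* exp (i t) *)
Definition cexpi (t : R) : R[i] := cos t +i* sin t.

Definition fourier (f : R -> R[i]) (w : R) : R[i] :=
  cintegral (fun x => f x * cexpi (- (w * x))).

Definition inverse_fourier (g : R -> R[i]) (x : R) : R[i] :=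
  ((pi *+ 2)^-1)%:C * cintegral (fun w => g w * cexpi (w * x)).

Definition L2_cvg (g : (R -> R[i])^nat) (f : R -> R[i]) : Prop :=
  'N[mu]_2%:E[(fun x => (normc (g n x - f x))%:E)]%E @[n --> \oo] --> 0%E.

(* The extension of [fourier] to L^2 by density of L^1 /\ L^2, as a relation:
   [F] is a representative, unique up to null sets, of the transform of [f]. *)
Definition is_L2_fourier (f F : R -> R[i]) : Prop :=
  [/\ cLfun 2%:E f, cLfun 2%:E F &
      exists g : (R -> R[i])^nat,
        [/\ forall n, cLfun 1%:E (g n) /\ cLfun 2%:E (g n),
            L2_cvg g f & L2_cvg (fun n => fourier (g n)) F]].

Definition convolution (f g : R -> R[i]) (x : R) : R[i] :=
  cintegral (fun y => f y * g (x - y)).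

End ComplexAnalysis.

Section CauchyWavelets.
Context {R : realType}.
Implicit Types (a p l : R) (f : R -> R[i]).

Definition cauchy_hat p (w : R) : R :=
  if 0 < w then w `^ p * expR (- w) else 0.

(* For p > 0 the function w |-> cauchy_hat p (a `^ l * w) is integrable and
   square integrable, so the wavelet with this Fourier transform is given by the
   inverse Fourier integral. *)
Definition cauchy_wavelet a p l : R -> R[i] :=
  inverse_fourier (fun w => (cauchy_hat p (a `^ l * w))%:C).

Definition wavelet_transform a p f l : R -> R[i] :=
  convolution f (cauchy_wavelet a p l).

Definition wavelet_sup a p (f1 f2 : R -> R[i]) l : R :=
  sup (range (fun x => normc (wavelet_transform a p f1 l x)) `|`
       range (fun x => normc (wavelet_transform a p f2 l x))).

Definition c_exponent a (k : nat) : R := 1 - (a - 1) / (1 - a ^- k).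

Definition d_exponent a (k K : nat) (M : R) : R :=
  let q := expR (- (pi * M / (K + 2)%:R)) in
  c_exponent a k - 4 * (q / (1 - q)).

Definition C_constant a p (f1 f2 : R -> R[i]) (j : int) (K k : nat)
    (kappa : R) : R :=
  let N := wavelet_sup a p f1 f2 in
  let n (s : nat) : R := j%:~R + K%:R - 2 * s%:R in
  6 / (1 - Num.sqrt kappa) *
  \prod_(s < K./2) (a `^ (p * (k%:R - 1)) * (N (n s - 1 - k%:R) / N (n s - 2))).

End CauchyWavelets.

(* Main.v *)
Require Import Defs.
From mathcomp Require Import all_boot all_order all_algebra.
From mathcomp Require Import all_classical all_reals all_analysis.
From mathcomp Require Import measurable_realfun complex zify ring lra.

Set Implicit Arguments.
Unset Strict Implicit.
Unset Printing Implicit Defensive.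

Import Order.TTheory GRing.Theory Num.Theory.
Import numFieldNormedType.Exports.
Import ComplexField.Normc.

Local Open Scope classical_set_scope.
Local Open Scope ring_scope.
Local Open Scope complex_scope.
Local Notation Re := complex.Re.
Local Notation Im := complex.Im.

(** Since [cauchy_hat] vanishes on the negative axis, Fourier inversion turns the
    wavelet transform at scale [l] into a dilated Laplace transform,
      W_l f (x) = a^(l p) T(x + i a^l),
      T(z) = (2 pi)^-1 int_0^oo w^p F(w) e^(i w z) dw,
    and [T] is holomorphic on the upper half-plane, bounded on each half-plane
    Im z >= y > 0 ([wavelet_transformE], [analytic_ext_halfplane]).  So the
    scales are horizontal lines, the hypotheses compare |T1| and |T2| on some of
    these lines, and the conclusion is about
      D(u, v)(x) = conj(T1(x + i u)) T1(x + i v) - conj(T2(x + i u)) T2(x + i v)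
    for the two heights u = a^J and v = a^j.

    For a fixed sum u + v, the map x + i y |-> D(u - y, v + y)(x) is holomorphic,
    because conj(T(conj z)) is.  It is bounded by 2 S(u) S(v), where S(y) is the
    supremum of |T1| and |T2| on the line of height y ([cross_diff_bound]); this
    is the three-lines theorem.  The maximum principle against explicit
    harmonic majorants, in the form of the two-constants theorem
    ([two_constants]), then carries smallness from lines to the inside:

    - [one_line_estimate]: if D(y, y) is of size e^-b on the window |x - x0| <= d,
      then D(y + t, y - t) is of size e^(-b (1 - t/w)) at x0 for t <= w < y, up to a
      loss in the exponent which decays exponentially in d;
    - [two_line_estimate]: if D is of size e^-b on both edges of a strip, it is of
      nearly this size in between, again with an exponentially small loss.

    The diagonal D(y, y) = |T1|^2 - |T2|^2 is small at y = a^l by hypothesis, so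
    the first estimate controls D at two heights symmetric around a^l.  Two such
    relations can be composed: from D(P, n), D(n, v) and D(n, n) one gets D(P, v),
    at the price of dividing by |T(x + i n)|, which is bounded below by
    sqrt(kappa) S(n) ([cross_combination]).  Starting from heights around a^(j+K-1),
    every round of the chain goes down by two scales: compose with the next
    odd scale, then use the second estimate to shift the pair of heights so that
    the lower one is exactly a^(j+K-2s) ([chain_bound]).  The upper heights form a
    slowly decreasing sequence which ends at a^J after K/2 rounds; this is where
    the value of J comes from.

    The exponent starts at c, which the one-line estimate gives for the reflection of
    one scale in the next.  It loses 4 q^2 in the one-line estimates and a sum of
    terms bounded by 4 q in the shifts, where q = e^(-pi M/(K+2)); together at most
    4 q/(1 - q).  In every round the constant e becomes (e + 3)/sqrt(kappa), times
    the quotient of the suprema at the heights a^(n_s - 1 - k), a lower bound for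
    the reflected height, and a^(n_s - 2), where n_s = j + K - 2 s. *)

(** * The modulus of a complex number *)
Section Modulus.
Context {R : realType}.
Implicit Types (z w : R[i]) (x y r : R).

Lemma normc_ge0 z : 0 <= normc z.
Proof. by case: z => a b; exact: sqrtr_ge0. Qed.

Lemma sqr_normc_ReIm z : normc z ^+ 2 = Re z ^+ 2 + Im z ^+ 2.
Proof. by case: z => a b /=; rewrite sqr_sqrtr// addr_ge0 ?sqr_ge0. Qed.

Lemma normcR r : normc r%:C = `|r|.
Proof. by rewrite /= expr0n /= addr0 sqrtr_sqr. Qed.

Lemma normc_conj z : normc z^* = normc z.
Proof. by case: z => a b /=; rewrite sqrrN. Qed.

Lemma normcX z n : normc (z ^+ n) = normc z ^+ n.
Proof. by elim: n => [|n IH]; rewrite ?expr0 ?normc1// !exprS normcM IH. Qed.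

Lemma ler_Re_normc z : `|Re z| <= normc z.
Proof.
case: z => a b /=; rewrite -sqrtr_sqr ler_wsqrtr//.
by rewrite lerDl sqr_ge0.
Qed.

Lemma ler_Im_normc z : `|Im z| <= normc z.
Proof.
case: z => a b /=; rewrite -sqrtr_sqr ler_wsqrtr//.
by rewrite lerDr sqr_ge0.
Qed.

Lemma ler_normc_ReIm z : normc z <= `|Re z| + `|Im z|.
Proof.
case: z => a b /=; rewrite -[leRHS]ger0_norm ?addr_ge0// -sqrtr_sqr ler_wsqrtr//.
rewrite sqrrD !real_normK ?num_real// -addrA lerD2l lerDr.
by rewrite mulrn_wge0// mulr_ge0.
Qed.

Lemma ler_normcD z w : normc (z + w) <= normc z + normc w.
Proof. exact: le_normcD. Qed.

Lemma ler_normcB z w : normc (z - w) <= normc z + normc w.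
Proof. by rewrite -(normcN w) ler_normcD. Qed.

Lemma normc_distC z w : normc (z - w) = normc (w - z).
Proof. by rewrite -normcN opprB. Qed.

End Modulus.

(** * Second order jets of complex functions *)
Section Jets.
Context {R : realType}.
Implicit Types (e f g h : R[i] -> R[i]) (z w A B : R[i]).

Definition bigO (k : nat) e : Prop :=
  exists C r : R, [/\ 0 <= C, 0 < r, r <= 1 &
    forall w, normc w <= r -> normc (e w) <= C * normc w ^+ k].

Lemma bigO_ext k e f : e =1 f -> bigO k e -> bigO k f.
Proof. by move=> /funext ->. Qed.

Lemma bigO_intro k e (C r : R) : 0 < r ->
  (forall w, normc w <= r -> normc (e w) <= C * normc w ^+ k) -> bigO k e.
Proof.
move=> r0 H; exists `|C|, (Num.min r 1); split => //.
- by rewrite lt_min r0 ltr01.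
- by rewrite ge_min lexx orbT.
move=> w; rewrite le_min => /andP[wr _]; apply: le_trans (H w wr) _.
by rewrite ler_wpM2r ?exprn_ge0 ?normc_ge0// ler_norm.
Qed.

Lemma bigO_le k m e : (k <= m)%N -> bigO m e -> bigO k e.
Proof.
move=> km [C [r [C0 r0 r1 H]]]; exists C, r; split => // w wr.
apply: le_trans (H w wr) _; rewrite ler_wpM2l//.
by rewrite ler_wiXn2l ?normc_ge0// (le_trans wr).
Qed.

Lemma bigO_add k e f : bigO k e -> bigO k f -> bigO k (fun w => e w + f w).
Proof.
move=> [C [r [C0 r0 r1 H]]] [D [s [D0 s0 s1 I]]].
apply: (@bigO_intro _ _ (C + D) (Num.min r s)); first by rewrite lt_min r0.
move=> w; rewrite le_min => /andP[wr ws]; rewrite mulrDl.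
by apply: le_trans (ler_normcD _ _) _; apply: lerD; [exact: H|exact: I].
Qed.

Lemma bigO_mul k m e f : bigO k e -> bigO m f ->
  bigO (k + m) (fun w => e w * f w).
Proof.
move=> [C [r [C0 r0 r1 H]]] [D [s [D0 s0 s1 I]]].
apply: (@bigO_intro _ _ (C * D) (Num.min r s)); first by rewrite lt_min r0.
move=> w; rewrite le_min => /andP[wr ws]; rewrite normcM exprD mulrACA.
by apply: ler_pM; rewrite ?normc_ge0//; [exact: H|exact: I].
Qed.

Lemma bigO_cst A : bigO 0 (fun=> A).
Proof.
by apply: (@bigO_intro _ _ (normc A) 1) => // w _; rewrite expr0 mulr1.
Qed.

Lemma bigO_id : bigO 1 id.
Proof. by apply: (@bigO_intro _ _ 1 1) => // w _; rewrite expr1 mul1r. Qed.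

Lemma bigO_scale k A e : bigO k e -> bigO k (fun w => A * e w).
Proof. by move=> H; rewrite -(add0n k); apply: bigO_mul => //; exact: bigO_cst. Qed.

Lemma bigO_comp k e u : bigO k e -> bigO 1 u -> bigO k (e \o u).
Proof.
move=> [C [r [C0 r0 r1 H]]] [D [s [D0 s0 s1 I]]].
have D1 : 0 < D + 1 by rewrite ltr_wpDl.
apply: (@bigO_intro _ _ (C * D ^+ k) (Num.min s (r / (D + 1)))).
  by rewrite lt_min s0 divr_gt0.
move=> w; rewrite le_min => /andP[ws wr] /=.
have Iw := I w ws; rewrite expr1 in Iw.
apply: le_trans (H _ _) _.
  apply: le_trans Iw _; apply: le_trans (_ : (D + 1) * normc w <= _).
    by rewrite ler_wpM2r ?normc_ge0// lerDl.
  by rewrite mulrC -ler_pdivlMr.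
rewrite -mulrA ler_wpM2l// -exprMn.
by apply: lerXn2r => //; rewrite nnegrE ?mulr_ge0 ?normc_ge0.
Qed.

(** A complex second order expansion at each point is all the holomorphy that
    the maximum principle below uses.  The remainder is of order 3 because the
    average over four points at distance [r] has to be known up to o(r^2). *)
Definition jet2 h z : Prop := exists A B,
  bigO 3 (fun w => h (z + w) - h z - A * w - B * w ^+ 2).

Lemma bigO_sqr : bigO 2 (fun w => w ^+ 2).
Proof. by have := bigO_mul bigO_id bigO_id; apply: bigO_ext => w; rewrite expr2. Qed.

Lemma jet2_incr h z : jet2 h z -> bigO 1 (fun w => h (z + w) - h z).
Proof.
move=> [A [B H]].
have HA : bigO 1 (fun w => A * w) by apply: bigO_scale; exact: bigO_id.
have HB : bigO 1 (fun w => B * w ^+ 2).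
  by apply: bigO_scale; apply: bigO_le bigO_sqr.
have H1 := bigO_add (bigO_add (@bigO_le 1 3 _ isT H) HA) HB.
by apply: bigO_ext H1 => w; ring.
Qed.

Lemma jet2_cst A z : jet2 (fun=> A) z.
Proof.
exists 0, 0; apply: (@bigO_intro _ _ 0 1) => // w _.
by rewrite subrr !mul0r !subr0 normc0.
Qed.

Lemma jet2_id z : jet2 id z.
Proof.
exists 1, 0; apply: (@bigO_intro _ _ 0 1) => // w _.
by rewrite (_ : _ - _ = 0) ?normc0 ?mul0r//=; ring.
Qed.

Lemma jet2D f g z : jet2 f z -> jet2 g z -> jet2 (fun z => f z + g z) z.
Proof.
move=> [A [B H]] [A' [B' H']]; exists (A + A'), (B + B').
by apply: bigO_ext (bigO_add H H') => w; ring.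
Qed.

Lemma jet2M f g z : jet2 f z -> jet2 g z -> jet2 (fun z => f z * g z) z.
Proof.
move=> fz gz; have gi := jet2_incr gz.
case: fz gz => [A [B H]] [A' [B' H']].
exists (A * g z + A' * f z), (B * g z + A * A' + B' * f z).
have O1 : bigO 3 (fun w => (f (z + w) - f z - A * w - B * w ^+ 2) * g (z + w)).
  apply: (@bigO_mul 3 0) => //; have := bigO_add (bigO_le (leq0n 1) gi) (bigO_cst (g z)).
  by apply: bigO_ext => w; ring.
have O2 : bigO 3 (fun w => f z * (g (z + w) - g z - A' * w - B' * w ^+ 2)).
  exact: bigO_scale.
have O3 : bigO 3 (fun w => (A * w) *
    ((g (z + w) - g z - A' * w - B' * w ^+ 2) + B' * w ^+ 2)).
  apply: (@bigO_mul 1 2); first by apply: bigO_scale; exact: bigO_id.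
  apply: bigO_add; first exact: bigO_le H'.
  by apply: bigO_scale; exact: bigO_sqr.
have O4 : bigO 3 (fun w => (B * w ^+ 2) * (g (z + w) - g z)).
  by apply: (@bigO_mul 2 1) => //; apply: bigO_scale; exact: bigO_sqr.
apply: bigO_ext (bigO_add (bigO_add O1 O2) (bigO_add O3 O4)) => w; ring.
Qed.

Lemma jet2_shift h z A : jet2 h (z + A) -> jet2 (fun z => h (z + A)) z.
Proof.
move=> [A' [B' H]]; exists A', B'; apply: bigO_ext H => w.
by rewrite (_ : z + w + A = z + A + w)//; ring.
Qed.

(** Conjugating the expansion at conj z for the increment conj w gives one at z for
    the increment w. *)
Lemma jet2_reflect h z : jet2 h z^* -> jet2 (fun z => (h z^*)^*) z.
Proof.
move=> [A [B [C [r [C0 r0 r1 H]]]]]; exists A^*, B^*.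
apply: (@bigO_intro _ _ C r) => // w wr.
rewrite -normc_conj -[normc w]normc_conj.
have := H w^*; rewrite normc_conj => /(_ wr); congr (normc _ <= _).
by rewrite !expr2 !rmorphB !rmorphM /= !conjcK rmorphD.
Qed.

End Jets.

(** * The maximum principle on rectangles *)
Section MaximumPrinciple.
Context {R : realType}.
Implicit Types (h g k : R[i] -> R[i]) (z w : R[i]) (x y r : R).

(** The linear terms of the expansion cancel by opposite points and the quadratic
    ones because r^2 + (i r)^2 = 0: the discrete form of harmonicity. *)
Lemma jet2_mean k z : jet2 k z -> exists C r0 : R, [/\ 0 <= C, 0 < r0 &
  forall r, 0 < r -> r <= r0 ->
    - (C * r ^+ 3) <= Re (k (z + r%:C) + k (z - r%:C) + k (z + 'i * r%:C)
       + k (z - 'i * r%:C)) - 4 * Re (k z)].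
Proof.
move=> [A [B [C [r0 [C0 r0p r1 H]]]]]; exists (4 * C), r0; split => //.
  by rewrite mulr_ge0.
move=> r rp rr0.
have nr : normc r%:C = r by rewrite normcR gtr0_norm.
have ni : normc 'i%C = 1 :> R by rewrite /= expr0n/= add0r expr1n sqrtr1.
have H1 := H r%:C; have H2 := H (- r%:C).
have H3 := H ('i * r%:C); have H4 := H (- ('i * r%:C)).
rewrite !(normcN, normcM, ni, nr, mul1r) in H1 H2 H3 H4.
move: (H1 rr0) (H2 rr0) (H3 rr0) (H4 rr0).
set e1 := _ - _ - A * r%:C - _; set e2 := _ - _ - _ - B * (- r%:C) ^+ 2.
set e3 := _ - _ - A * ('i * r%:C) - _; set e4 := _ - _ - _ - B * (- ('i * r%:C)) ^+ 2.
move=> L1 L2 L3 L4.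
have E : k (z + r%:C) + k (z - r%:C) + k (z + 'i * r%:C)
       + k (z - 'i * r%:C) - 4%:R * k z = e1 + e2 + e3 + e4.
  rewrite /e1 /e2 /e3 /e4.
  rewrite !sqrrN exprMn sqr_i; ring.
have -> : 4 * Re (k z) = Re (4%:R * k z).
  by rewrite !mulr_natl raddfMn.
rewrite -raddfB E.
apply: le_trans (_ : - `|Re (e1 + e2 + e3 + e4)| <= _); last by rewrite lerNl ler_normr lexx orbT.
rewrite lerN2; apply: le_trans (ler_Re_normc _) _.
have := ler_normcD (e1 + e2 + e3) e4; have := ler_normcD (e1 + e2) e3.
have := ler_normcD e1 e2; lra.
Qed.

Lemma jet2_continuous h (p : R * R) : jet2 h (p.1 +i* p.2) ->
  {for p, continuous (fun q : R * R => Re (h (q.1 +i* q.2)))} /\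
  {for p, continuous (fun q : R * R => Im (h (q.1 +i* q.2)))}.
Proof.
move=> /jet2_incr [C [r [C0 r0 r1 H]]].
have K : forall e : R, 0 < e -> \forall q \near p,
    normc (h (p.1 +i* p.2) - h (q.1 +i* q.2)) < e.
  move=> e e0.
  have s0 : 0 < Num.min r (e / (C + 1)) / 2.
    by rewrite divr_gt0// lt_min r0 divr_gt0// ltr_wpDl.
  near=> q.
  have -> : q.1 +i* q.2 = p.1 +i* p.2 + ((q.1 - p.1) +i* (q.2 - p.2)).
    by simpc; rewrite !subrKC.
  set w := _ +i* (_ - _).
  have nw : normc w < Num.min r (e / (C + 1)).
    apply: le_lt_trans (ler_normc_ReIm _) _; rewrite [ltRHS]splitr /=.
    apply: ltrD; rewrite distrC; near: q.
      have : {for p, continuous (fun q : R * R => q.1)} by exact: cvg_fst.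
      by move=> /cvgrPdist_lt; apply.
    have : {for p, continuous (fun q : R * R => q.2)} by exact: cvg_snd.
    by move=> /cvgrPdist_lt; apply.
  move: nw; rewrite lt_min => /andP[wr we].
  rewrite normc_distC; apply: le_lt_trans (H w (ltW wr)) _; rewrite expr1.
  apply: le_lt_trans (_ : (C + 1) * normc w < e).
    by rewrite ler_wpM2r ?normc_ge0// lerDl.
  by rewrite mulrC -ltr_pdivlMr// ltr_wpDl.
split; apply/cvgrPdist_lt => e e0; have := K e e0; apply: filterS => q;
  apply: le_lt_trans; rewrite -raddfB.
  exact: ler_Re_normc.
exact: ler_Im_normc.
Unshelve. all: by end_near. Qed.

Definition rectangle x0 x1 y0 y1 z : Prop := x0 <= Re z <= x1 /\ y0 <= Im z <= y1.

(** The function |h|^2 - Re g is subharmonic.  Adding d (Re z)^2 makes its mean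
    over the four points z + r, z - r, z + i r, z - i r exceed its value at z by
    about d r^2 / 2, which beats the O(r^3) of [jet2_mean]; hence its maximum on the
    compact rectangle lies on the boundary, and d is sent to 0. *)
Theorem maximum_principle h g x0 x1 y0 y1 :
  (forall z, rectangle x0 x1 y0 y1 z -> jet2 h z /\ jet2 g z) ->
  (forall z, rectangle x0 x1 y0 y1 z ->
     [\/ Re z = x0, Re z = x1, Im z = y0 | Im z = y1] ->
     normc (h z) ^+ 2 <= Re (g z)) ->
  forall z, rectangle x0 x1 y0 y1 z -> normc (h z) ^+ 2 <= Re (g z).
Proof.
move=> J B z Qz.
pose X := x0 ^+ 2 + x1 ^+ 2.
have X0 : 0 <= X by rewrite addr_ge0 ?sqr_ge0.
have Xb t : x0 <= t <= x1 -> t ^+ 2 <= X.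
  move=> /andP[t0 t1]; have [tp|tn] := leP 0 t.
    apply: le_trans (_ : x1 ^+ 2 <= _); last by rewrite lerDr sqr_ge0.
    by apply: lerXn2r => //; rewrite nnegrE// (le_trans tp).
  apply: le_trans (_ : x0 ^+ 2 <= _); last by rewrite lerDl sqr_ge0.
  rewrite -[t ^+ 2]sqrrN -[x0 ^+ 2]sqrrN; apply: lerXn2r; rewrite ?nnegrE; lra.
apply/ler_addgt0Pl => e e0.
pose d := e / (X + 1).
have d0 : 0 < d by rewrite divr_gt0// ltr_wpDl.
pose f w := normc (h w) ^+ 2 - Re (g w) + d * Re w ^+ 2.
suff S : f z <= d * X.
  have : d * X <= e.
    by rewrite /d mulrAC ler_pdivrMr ?ltr_wpDl// ler_pM2l// lerDl.
  have : 0 <= d * Re z ^+ 2 by rewrite mulr_ge0 ?sqr_ge0// ltW.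
  by move: S; rewrite /f; lra.
pose A : set (R * R) := `[x0, x1]%classic `*` `[y0, y1]%classic.
have A0 : A !=set0.
  by case: Qz => Q1 Q2; exists (Re z, Im z); split; rewrite /= in_itv.
have cA : compact A by apply: compact_setX; exact: segment_compact.
pose F (q : R * R) := f (q.1 +i* q.2).
have cF : {within A, continuous F}.
  apply: continuous_in_subspaceT => p /set_mem [].
  rewrite /= !in_itv/= => p1 p2.
  have [jh jg] := J (p.1 +i* p.2) (conj p1 p2).
  have [c1 c2] := jet2_continuous jh; have [c3 _] := jet2_continuous jg.
  have -> : F = (fun q : R * R => Re (h (q.1 +i* q.2)) * Re (h (q.1 +i* q.2)) +
     Im (h (q.1 +i* q.2)) * Im (h (q.1 +i* q.2)) - Re (g (q.1 +i* q.2))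
     + d * (q.1 * q.1)).
    by apply/funext => q; rewrite /F /f sqr_normc_ReIm !expr2.
  apply: cvgD; last first.
    by apply: cvgM; [exact: cvg_cst|apply: cvgM; exact: cvg_fst].
  by apply: cvgB => //; apply: cvgD; apply: cvgM.
have [[x y] /set_mem [/= xI yI] M] := compact_EVT_max A0 cA cF.
rewrite !in_itv/= in xI yI.
have Mw w : rectangle x0 x1 y0 y1 w -> f w <= f (x +i* y).
  move=> [w1 w2]; have := M (Re w, Im w); rewrite /F /=.
  rewrite (_ : Re w +i* Im w = w); last by case: w {w1 w2}.
  by apply; apply/mem_set; split; rewrite /= in_itv.
have Q0 : rectangle x0 x1 y0 y1 (x +i* y) by [].
apply: le_trans (Mw z Qz) _.
have bnd : [\/ x = x0, x = x1, y = y0 | y = y1] -> f (x +i* y) <= d * X.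
  move=> b; have := B _ Q0 b; have := Xb _ xI.
  rewrite -(ler_pM2l d0) /f /=; lra.
have [xx0|xx0] := eqVneq x x0; first by apply: bnd; constructor 1.
have [xx1|xx1] := eqVneq x x1; first by apply: bnd; constructor 2.
have [yy0|yy0] := eqVneq y y0; first by apply: bnd; constructor 3.
have [yy1|yy1] := eqVneq y y1; first by apply: bnd; constructor 4.
exfalso.
have [jh jg] := J _ Q0.
set p := x +i* y in jh jg Mw Q0.
(* Linearisation of |h|^2 at the maximum p: |h(w)|^2 - |h(p)|^2 is at least
   2 Re (conj(h(p)) (h(w) - h(p))), and the right side is the real part of a
   holomorphic function. *)
pose k w := ((2 : R)%:C * (h p)^*) * h w + (- 1 : R)%:C * g w.
have jk : jet2 k p.
  by apply: jet2D; apply: jet2M => //; exact: jet2_cst.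
have [C [r0 [C0 r0p Hk]]] := jet2_mean jk.
have fk w : f p + (Re (k w) - Re (k p)) + d * (Re w ^+ 2 - Re p ^+ 2) <= f w.
  rewrite /f /k -subr_ge0 !sqr_normc_ReIm.
  case: (h w) (h p) (g w) (g p) => [a b] [a' b'] [a1 b1] [a2 b2].
  simpc => /=.
  have := sqr_ge0 (a - a'); have := sqr_ge0 (b - b'); nra.
clearbody k.
have [/andP[xa xb] /andP[ya yb]] := (xI, yI).
pose r := Num.min (Num.min r0 (d / (C + 1)))
   (Num.min (Num.min (x - x0) (x1 - x)) (Num.min (y - y0) (y1 - y))).
have rp : 0 < r.
  have Cd : 0 < d / (C + 1) by rewrite divr_gt0// ltr_wpDl.
  have x0x : 0 < x - x0 by rewrite subr_gt0 lt_neqAle xa eq_sym xx0.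
  have xx1' : 0 < x1 - x by rewrite subr_gt0 lt_neqAle xb xx1.
  have y0y : 0 < y - y0 by rewrite subr_gt0 lt_neqAle ya eq_sym yy0.
  have yy1' : 0 < y1 - y by rewrite subr_gt0 lt_neqAle yb yy1.
  by rewrite /r !lt_min r0p Cd x0x xx1' y0y yy1'.
have := lexx r; rewrite {2}/r !le_min.
move=> /andP[/andP[rr0 rd] /andP[/andP[rx rx'] /andP[ry ry']]].
have := Hk r rp rr0; rewrite !raddfD /=.
have q1 := Mw (p + r%:C); have q2 := Mw (p - r%:C).
have q3 := Mw (p + 'i * r%:C); have q4 := Mw (p - 'i * r%:C).
have {}q1 := q1 ltac:(rewrite /rectangle /p /=; split; lra).
have {}q2 := q2 ltac:(rewrite /rectangle /p /=; split; lra).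
have {}q3 := q3 ltac:(rewrite /rectangle /p /=; split; lra).
have {}q4 := q4 ltac:(rewrite /rectangle /p /=; split; lra).
have f1 := fk (p + r%:C); have f2 := fk (p - r%:C).
have f3 := fk (p + 'i * r%:C); have f4 := fk (p - 'i * r%:C).
have Rp1 : Re (p + r%:C) = x + r by [].
have Rp2 : Re (p - r%:C) = x - r by [].
have Rp3 : Re (p + 'i * r%:C) = x by rewrite /p /=; lra.
have Rp4 : Re (p - 'i * r%:C) = x by rewrite /p /=; lra.
rewrite Rp1 in f1; rewrite Rp2 in f2; rewrite Rp3 in f3; rewrite Rp4 in f4.
have Rp0 : Re p = x by [].
rewrite Rp0 in f1 f2 f3 f4.
have : C * r ^+ 3 < 2 * (d * r ^+ 2).
  rewrite (_ : C * r ^+ 3 = C * r * r ^+ 2); last by ring.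
  rewrite mulrA ltr_pM2r ?exprn_gt0//.
  have : (C + 1) * r <= d by rewrite mulrC -ler_pdivlMr// ltr_wpDl.
  nra.
move=> Cr Hm.
have : d * ((x + r) ^+ 2 - x ^+ 2) + d * ((x - r) ^+ 2 - x ^+ 2) = 2 * (d * r ^+ 2).
  by ring.
have : d * (x ^+ 2 - x ^+ 2) = 0 by rewrite subrr mulr0.
lra.
Qed.

End MaximumPrinciple.

(** * Taylor estimates and the complex exponential *)
Section RealTaylor.
Context {R : realType}.
Implicit Types (x y t : R).

(** The mean value theorem raises the order of vanishing at 0 by one; iterating it
    gives the Taylor bounds below, with constants that are not optimal. *)
Lemma deriv_bound (f df : R -> R) (C x : R) n :
  (forall t, is_derive t 1 f (df t)) -> f 0 = 0 ->
  (forall t, `|t| <= `|x| -> `|df t| <= C * `|t| ^+ n) -> 0 <= C ->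
  `|f x| <= C * `|x| ^+ n.+1.
Proof.
move=> fd f0 Hd C0.
have cf : continuous f.
  by move=> t; apply/differentiable_continuous/derivable1_diffP; case: (fd t).
have key (c : R) : `|c| <= `|x| -> `|df c * x| <= C * `|x| ^+ n.+1.
  move=> cx; rewrite normrM exprSr mulrA ler_wpM2r//.
  by apply: le_trans (Hd c cx) _; rewrite ler_wpM2l// lerXn2r ?nnegrE.
have [x0|x0] := leP 0 x.
  have [c] := @MVT_segment R f df 0 x x0 (fun t _ => fd t) (continuous_subspaceT cf).
  rewrite in_itv/= f0 !subr0 => /andP[c0 cx] ->.
  by apply: key; rewrite !ger0_norm.
have [c] := @MVT_segment R f df x 0 (ltW x0) (fun t _ => fd t) (continuous_subspaceT cf).
rewrite in_itv/= f0 !sub0r => /andP[cx c0] /eqP; rewrite mulrN eqr_opp => /eqP ->.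
by apply: key; rewrite (ltr0_norm x0) ler0_norm// lerN2.
Qed.

Lemma abs_sin_le x : `|sin x| <= `|x|.
Proof.
rewrite -[leRHS]mul1r -[`|x| in leRHS]expr1.
apply: (@deriv_bound sin cos) => //; first exact: sin0.
by move=> t _; rewrite expr0 mulr1 ler_norml cos_geN1 cos_le1.
Qed.

Lemma cos_taylor1 x : `|cos x - 1| <= `|x| ^+ 2.
Proof.
rewrite -[leRHS]mul1r.
apply: (@deriv_bound (fun t => cos t - 1) (fun t => - sin t)) => //.
- by move=> t; apply: is_derive_eq; rewrite subr0.
- by rewrite cos0 subrr.
- by move=> t _; rewrite normrN mul1r expr1 abs_sin_le.
Qed.

Lemma sin_taylor x : `|sin x - x| <= `|x| ^+ 3.
Proof.
rewrite -[leRHS]mul1r.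
apply: (@deriv_bound (fun t => sin t - t) (fun t => cos t - 1)) => //.
- by rewrite sin0 subrr.
- by move=> t _; rewrite mul1r cos_taylor1.
Qed.

Lemma cos_taylor2 x : `|cos x - 1 + x ^+ 2 / 2| <= `|x| ^+ 4.
Proof.
rewrite -[leRHS]mul1r.
apply: (@deriv_bound (fun t => cos t - 1 + t ^+ 2 / 2) (fun t => t - sin t)) => //.
- by move=> t; apply: is_derive_eq; rewrite /GRing.scale /=; field.
- by rewrite cos0; field.
- by move=> t _; rewrite mul1r distrC sin_taylor.
Qed.

Lemma expR_taylor x : `|x| <= 1 ->
  `|expR x - 1 - x - x ^+ 2 / 2| <= expR 1 * `|x| ^+ 3.
Proof.
move=> x1.
have E0 : 0 <= expR 1 :> R by exact: expR_ge0.
have T1 t : `|t| <= 1 -> `|expR t - 1| <= expR 1 * `|t| ^+ 1.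
  move=> t1; apply: (@deriv_bound (fun t => expR t - 1) expR) => //.
  - by move=> s; apply: is_derive_eq; rewrite subr0.
  - by rewrite expR0 subrr.
  - move=> s st; rewrite expr0 mulr1 ger0_norm ?expR_ge0// ler_expR.
    by apply: le_trans (ler_norm _) _; exact: le_trans st t1.
have T2 t : `|t| <= 1 -> `|expR t - 1 - t| <= expR 1 * `|t| ^+ 2.
  move=> t1; apply: (@deriv_bound (fun t => expR t - 1 - t) (fun t => expR t - 1)) => //.
  - by move=> s; apply: is_derive_eq; rewrite subr0.
  - by rewrite expR0; ring.
  - by move=> s st; apply: T1; exact: le_trans st t1.
apply: (@deriv_bound (fun t => expR t - 1 - t - t ^+ 2 / 2) (fun t => expR t - 1 - t)) => //.
- by move=> s; apply: is_derive_eq; rewrite /GRing.scale /=; field.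
- by rewrite expR0; field.
- by move=> s st; apply: T2; exact: le_trans st x1.
Qed.

End RealTaylor.

Section ComplexExponential.
Context {R : realType}.
Implicit Types (h g k : R[i] -> R[i]) (z w : R[i]) (x y r : R).

Definition cexp z : R[i] := (expR (Re z))%:C * cexpi (Im z).

Lemma normc_cexpi x : normc (cexpi x) = 1.
Proof. by rewrite /= cos2Dsin2 sqrtr1. Qed.

Lemma normc_cexp z : normc (cexp z) = expR (Re z).
Proof. by rewrite normcM normc_cexpi normcR mulr1 ger0_norm ?expR_ge0. Qed.

Lemma cexpiD x y : cexpi (x + y) = cexpi x * cexpi y.
Proof. by rewrite /cexpi sinD cosD; simpc; congr (_ +i* _); rewrite addrC. Qed.

Lemma cexpD z w : cexp (z + w) = cexp z * cexp w.
Proof. by rewrite /cexp !raddfD /= expRD cexpiD rmorphM mulrACA. Qed.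

Lemma bigO_re : bigO 1 (fun w => (Re w)%:C).
Proof.
apply: (@bigO_intro _ _ _ 1 1) => // w _.
by rewrite mul1r expr1 normcR ler_Re_normc.
Qed.

Lemma bigO_im : bigO 1 (fun w => 'i * (Im w)%:C).
Proof.
apply: (@bigO_intro _ _ _ 1 1) => // w _.
rewrite mul1r expr1 normcM normcR /= expr0n /= add0r expr1n sqrtr1 mul1r.
exact: ler_Im_normc.
Qed.

(** The real exponential in Re w and the circle map in Im w are expanded
    separately; the product of the two quadratic polynomials is the expected one up
    to terms of order 3. *)
Lemma bigO_cexp : bigO 3 (fun w => cexp w - 1 - w - w ^+ 2 / (2 : R)%:C).
Proof.
pose X w : R[i] := (Re w)%:C; pose V w : R[i] := 'i * (Im w)%:C.
pose h := ((2 : R)%:C)^-1.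
pose PE w := 1 + X w + X w ^+ 2 * h; pose PQ w := 1 + V w + V w ^+ 2 * h.
have oX : bigO 1 X by exact: bigO_re.
have oV : bigO 1 V by exact: bigO_im.
have o1 : @bigO R 0 (fun=> 1) by exact: bigO_cst.
have oE : bigO 3 (fun w => (expR (Re w))%:C - PE w).
  apply: (@bigO_intro _ _ _ (expR 1) 1) => // w w1.
  have := expR_taylor (le_trans (ler_Re_normc w) w1).
  rewrite /PE /X /h.
  have -> : (expR (Re w))%:C - (1 + (Re w)%:C + (Re w)%:C ^+ 2 * ((2 : R)%:C)^-1)
    = (expR (Re w) - 1 - Re w - Re w ^+ 2 / 2)%:C.
    by rewrite !rmorphB rmorphM rmorphXn fmorphV /=; ring.
  rewrite normcR => /le_trans; apply; rewrite ler_wpM2l ?expR_ge0//.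
  by apply: lerXn2r; rewrite ?nnegrE ?normc_ge0 ?ler_Re_normc.
have oQ : bigO 3 (fun w => cexpi (Im w) - PQ w).
  apply: (@bigO_intro _ _ _ 2 1) => // w w1.
  set y := Im w.
  have -> : cexpi y - PQ w = (cos y - 1 + y ^+ 2 / 2) +i* (sin y - y).
    rewrite /PQ /V /h exprMn sqr_i -/y /cexpi -(fmorphV (real_complex R)) -rmorphXn.
    by simpc; congr (_ +i* _); rewrite ?expr2; field.
  apply: le_trans (ler_normc_ReIm _) _; rewrite /=.
  have yw : `|y| <= normc w by exact: ler_Im_normc.
  have y1 : `|y| <= 1 by apply: le_trans yw w1.
  have y3 : `|y| ^+ 3 <= normc w ^+ 3 by apply: lerXn2r; rewrite ?nnegrE ?normc_ge0.
  have y4 : `|y| ^+ 4 <= `|y| ^+ 3 by rewrite ler_wiXn2l.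
  have := cos_taylor2 y; have := sin_taylor y; lra.
have oPE : bigO 0 PE.
  apply: bigO_add; first apply: bigO_add => //; first exact: bigO_le oX.
  by apply: (@bigO_mul _ 0 0); [exact: (bigO_le _ (bigO_mul oX oX))|exact: bigO_cst].
have oPQ : bigO 0 PQ.
  apply: bigO_add; first apply: bigO_add => //; first exact: bigO_le oV.
  by apply: (@bigO_mul _ 0 0); [exact: (bigO_le _ (bigO_mul oV oV))|exact: bigO_cst].
have oq : bigO 0 (fun w => cexpi (Im w)).
  by apply: (@bigO_intro _ _ _ 1 1) => // w _; rewrite normc_cexpi expr0 mulr1.
have oR : bigO 3 (fun w => X w * (V w ^+ 2 * h) + (X w ^+ 2 * h) * V w
     + (X w ^+ 2 * h) * (V w ^+ 2 * h)).
  have oX2 : bigO 2 (fun w => X w ^+ 2 * h).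
    by apply: (@bigO_mul _ 2 0); [exact: (bigO_mul oX oX)|exact: bigO_cst].
  have oV2 : bigO 2 (fun w => V w ^+ 2 * h).
    by apply: (@bigO_mul _ 2 0); [exact: (bigO_mul oV oV)|exact: bigO_cst].
  apply: bigO_add; first apply: bigO_add.
  - exact: (@bigO_mul _ 1 2).
  - exact: (@bigO_mul _ 2 1).
  - by apply: (@bigO_le _ 3 4) => //; exact: (@bigO_mul _ 2 2).
have := bigO_add (bigO_add (@bigO_mul _ 3 0 _ _ oE oq) (@bigO_mul _ 0 3 _ _ oPE oQ)) oR.
apply: bigO_ext => w; rewrite /cexp /PE /PQ.
have Ew : w = X w + V w by rewrite {1}[w]complexE.
transitivity ((expR (Re w))%:C * cexpi (Im w) - 1 - (X w + V w) - (X w + V w) ^+ 2 * h);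
  last by rewrite -Ew.
have hh : h * 2%:R = 1.
  by rewrite /h -[(2%:R : R[i])](rmorph_nat (real_complex R)) mulVf// fmorph_eq0 pnatr_eq0.
have hE : 1 = h * 2%:R by rewrite hh.
have -> : (X w + V w) ^+ 2 * h = X w ^+ 2 * h + V w ^+ 2 * h + X w * V w * (h * 2%:R).
  by ring.
rewrite hh; ring.
Qed.

(** The form of the second order expansion valid for all [w], needed to
    differentiate the Laplace integral under the integral sign: away from 0 the
    exponential itself is the largest term. *)
Lemma cexp_taylor : exists2 C : R, 0 <= C & forall w,
  normc (cexp w - 1 - w - w ^+ 2 / (2 : R)%:C) <= C * normc w ^+ 3 * expR (normc w).
Proof.
have [C [r [C0 r0 r1 H]]] := bigO_cexp.
exists (C + 4 / r ^+ 3); first by rewrite addr_ge0// divr_ge0// exprn_ge0// ltW.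
move=> w; have n0 := normc_ge0 w.
have e1 : 1 <= expR (normc w) by rewrite -expR0 ler_expR.
have [wr|rw] := leP (normc w) r.
  apply: le_trans (H w wr) _; rewrite -mulrA ler_pM//.
  - by rewrite exprn_ge0.
  - by rewrite lerDl divr_ge0// exprn_ge0// ltW.
  - by rewrite ler_peMr// exprn_ge0.
have K : normc (cexp w - 1 - w - w ^+ 2 / (2 : R)%:C) <= 4 * expR (normc w).
  have E := expR_ge1Dxn 1 n0; rewrite -[2`!]/2%N in E.
  have E1 := expR_ge1Dx (normc w).
  have Ew : expR (Re w) <= expR (normc w).
    by rewrite ler_expR (le_trans (ler_norm _))// ler_Re_normc.
  have := ler_normcB (cexp w - 1 - w) (w ^+ 2 / (2 : R)%:C).
  have := ler_normcB (cexp w - 1) w; have := ler_normcB (cexp w) 1.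
  rewrite normc_cexp normc1 normcM normcV normcR normcX ger0_norm//; lra.
apply: le_trans K _; rewrite ler_wpM2r ?expR_ge0//.
rewrite mulrDl; apply: le_trans (_ : 4 / r ^+ 3 * normc w ^+ 3 <= _); last first.
  by rewrite lerDr mulr_ge0// exprn_ge0.
rewrite mulrAC ler_pdivlMr ?exprn_gt0// ler_pM2l//.
by apply: lerXn2r; rewrite ?nnegrE// ltW.
Qed.

Lemma jet2_cexp g z : jet2 g z -> jet2 (fun z => cexp (g z)) z.
Proof.
move=> gz; have gi := jet2_incr gz.
pose u w := g (z + w) - g z.
have oc := bigO_comp bigO_cexp gi.
case: gz => [A [B H]].
pose h := ((2 : R)%:C)^-1.
exists (cexp (g z) * A), (cexp (g z) * (B + A ^+ 2 * h)).
pose e w := u w - A * w - B * w ^+ 2.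
have oe : bigO 3 e by [].
have o2 : bigO 3 (fun w => (A * w) * (u w - A * w) + e w * u w + (B * w ^+ 2) * u w).
  have oAw : bigO 1 (fun w => A * w) by apply: bigO_scale; exact: bigO_id.
  have oB : bigO 2 (fun w => B * w ^+ 2) by apply: bigO_scale; exact: bigO_sqr.
  apply: bigO_add; first apply: bigO_add.
  - apply: (@bigO_mul _ 1 2) => //.
    have := bigO_add (@bigO_le _ 2 3 _ isT oe) oB.
    by apply: bigO_ext => w; rewrite /e; ring.
  - by apply: (@bigO_le _ 3 4) => //; exact: (@bigO_mul _ 3 1).
  - exact: (@bigO_mul _ 2 1).
have oh : bigO 3 (fun w => h * ((A * w) * (u w - A * w) + e w * u w + (B * w ^+ 2) * u w)).
  exact: bigO_scale.
have := bigO_scale (cexp (g z)) (bigO_add oc (bigO_add oe oh)).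
apply: bigO_ext => w /=.
have -> : g (z + w) = g z + u w by rewrite /u; ring.
rewrite (_ : g z + u w - g z = u w); last by ring.
rewrite cexpD -/h /e; ring.
Qed.

(** The maximum principle for h e^-g: a harmonic majorant Re g of log(|h| / B)
    on the boundary is one inside. *)
Lemma two_constants h g (B : R) x0 x1 y0 y1 : 0 <= B ->
  (forall z, rectangle x0 x1 y0 y1 z -> jet2 h z /\ jet2 g z) ->
  (forall z, rectangle x0 x1 y0 y1 z ->
     [\/ Re z = x0, Re z = x1, Im z = y0 | Im z = y1] ->
     normc (h z) <= B * expR (Re (g z))) ->
  forall z, rectangle x0 x1 y0 y1 z -> normc (h z) <= B * expR (Re (g z)).
Proof.
move=> B0 J Hb z Qz.
pose k w := h w * cexp ((-1 : R)%:C * g w).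
have nk w : normc (k w) = normc (h w) / expR (Re (g w)).
  rewrite normcM normc_cexp -expRN; congr (_ * expR _).
  by case: (g w) => a b /=; ring.
have kle w : (normc (k w) <= B) = (normc (h w) <= B * expR (Re (g w))).
  by rewrite nk ler_pdivrMr ?expR_gt0.
rewrite -kle -[normc _]ger0_norm ?normc_ge0// -[B]ger0_norm//.
rewrite -(ler_pXn2r (ltn0Sn 1)) ?nnegrE//.
rewrite !real_normK ?num_real//.
apply: (@maximum_principle _ k (fun=> (B ^+ 2)%:C)) Qz => w Qw.
  have [jh jg] := J w Qw; split; last exact: jet2_cst.
  apply: jet2M => //; apply: (@jet2_cexp (fun w => (-1 : R)%:C * g w)).
  by apply: jet2M => //; exact: jet2_cst.
move=> bw; have := Hb w Qw bw; rewrite -kle => kB.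
by apply: lerXn2r; rewrite ?nnegrE ?normc_ge0.
Qed.

End ComplexExponential.

(** * Bounded functions on strips and half-planes *)
Section Strips.
Context {R : realType}.
Implicit Types (h : R[i] -> R[i]) (z w : R[i]).

Lemma ler_normc_limit (n B s : R) : 0 <= n -> 0 <= B -> 0 <= s ->
  (forall d : R, 0 < d -> n ^+ 2 <= B ^+ 2 + d * s) -> n <= B.
Proof.
move=> n0 B0 s0 H; rewrite -(ler_pXn2r (ltn0Sn 1)) ?nnegrE//.
apply/ler_addgt0Pl => e e0.
have d0 : 0 < e / (s + 1) by rewrite divr_gt0// ltr_wpDl.
apply: le_trans (H _ d0) _; rewrite addrC lerD2r.
by rewrite mulrAC ler_pdivrMr ?ltr_wpDl// ler_pM2l// lerDl.
Qed.

(** Phragmen-Lindelof: the majorant B^2 + d (Y^2 + (x - x0)^2 - (y - y0)^2) exceeds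
    the a priori bound C^2 on remote vertical sides, and tends to B^2 with d. *)
Lemma strip_bound h (y0 y1 B C : R) : 0 <= B ->
  (forall z, y0 <= Im z <= y1 -> jet2 h z /\ normc (h z) <= C) ->
  (forall z, y0 <= Im z <= y1 -> Im z = y0 \/ Im z = y1 -> normc (h z) <= B) ->
  forall z, y0 <= Im z <= y1 -> normc (h z) <= B.
Proof.
move=> B0 J Hb z yz.
pose Y := y1 - y0.
apply: (@ler_normc_limit _ _ (Y ^+ 2)) => //; rewrite ?normc_ge0 ?sqr_ge0// => d d0.
(* With this half-width, d T^2 >= C^2. *)
pose T := 1 + C ^+ 2 / d.
have T1 : 1 <= T by rewrite lerDl divr_ge0 ?sqr_ge0// ltW.
pose g w := (B ^+ 2 + d * Y ^+ 2)%:C + d%:C * ((w + (- z)) * (w + (- z))).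
have gE w : Re (g w) = B ^+ 2 + d * (Y ^+ 2 + (Re w - Re z) ^+ 2 - (Im w - Im z) ^+ 2).
  by rewrite /g; case: w z {yz g} => [a b] [a' b'] /=; ring.
have sY w : y0 <= Im w <= y1 -> (Im w - Im z) ^+ 2 <= Y ^+ 2.
  by move=> yw; rewrite /Y; nra.
have -> : B ^+ 2 + d * Y ^+ 2 = Re (g z) by rewrite gE !subrr; ring.
apply: (@maximum_principle _ h g (Re z - T) (Re z + T) y0 y1).
- move=> w [_ yw]; split; first by have [] := J w yw.
  have jw : jet2 (fun w => w + - z) w by apply: jet2D; [exact: jet2_id|exact: jet2_cst].
  apply: jet2D; first exact: jet2_cst.
  by apply: jet2M; [exact: jet2_cst|apply: jet2M].
- move=> w [xw yw] bw; rewrite gE; have sw := sY w yw.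
  have [side|line] : (Re w - Re z) ^+ 2 = T ^+ 2 \/ (Im w = y0 \/ Im w = y1).
    by case: bw => [->|->|->|->]; [left; ring|left; ring|right; left|right; right].
  + have [_ hC] := J w yw.
    apply: le_trans (_ : C ^+ 2 <= _).
      by apply: lerXn2r; rewrite ?nnegrE ?normc_ge0// (le_trans _ hC)// normc_ge0.
    have : C ^+ 2 <= d * T ^+ 2.
      apply: le_trans (_ : d * T <= _); last by rewrite ler_pM2l// ler_eXnr.
      by rewrite /T mulrDr mulrCA divff ?gt_eqF// !mulr1 lerDr ltW.
    have := sqr_ge0 B; rewrite side; nra.
  + have hB := Hb w yw line.
    apply: le_trans (_ : B ^+ 2 <= _); first by apply: lerXn2r; rewrite ?nnegrE ?normc_ge0.
    rewrite lerDl; apply: mulr_ge0; first exact: ltW.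
    by rewrite subr_ge0 (le_trans sw)// lerDl sqr_ge0.
- split => //; rewrite lerBlDr !lerDl; lra.
Qed.

(** As for strips; the majorant B^2 + d y + e (x^2 - y^2) has to beat C^2 on the top
    side as well, which the linear term does as soon as e is at most d / (2 Y). *)
Lemma halfplane_bound h (y0 B C : R) : 0 <= B ->
  (forall z, y0 <= Im z -> jet2 h z /\ normc (h z) <= C) ->
  (forall z, Im z = y0 -> normc (h z) <= B) ->
  forall z, y0 <= Im z -> normc (h z) <= B.
Proof.
move=> B0 J Hb z yz.
pose s := Im z - y0; have s0 : 0 <= s by rewrite subr_ge0.
apply: (@ler_normc_limit _ _ s) => //; rewrite ?normc_ge0// => d d0.
pose Y := 1 + s + 2 * C ^+ 2 / d.
have CY : 2 * C ^+ 2 <= d * Y.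
  have -> : d * Y = d * (1 + s) + 2 * C ^+ 2 by rewrite /Y; field; rewrite gt_eqF.
  by rewrite lerDr; apply: mulr_ge0; lra.
have sY : 1 + s <= Y by rewrite /Y lerDl; apply: divr_ge0; [rewrite mulr_ge0 ?sqr_ge0|exact: ltW].
have Y0 : 0 < Y by lra.
pose e := d / (2 * Y).
have e0 : 0 < e by rewrite divr_gt0// mulr_gt0.
have eY : e * (2 * Y) = d by rewrite /e divfK// gt_eqF// mulr_gt0.
pose X := 1 + C ^+ 2 / e.
have X1 : 1 <= X by rewrite lerDl divr_ge0 ?sqr_ge0// ltW.
have CX : C ^+ 2 <= e * X ^+ 2.
  apply: le_trans (_ : e * X <= _); last by rewrite ler_pM2l// ler_eXnr.
  by rewrite /X mulrDr mulrCA divff ?gt_eqF// !mulr1 lerDr ltW.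
pose z0 := Re z +i* y0.
pose g w := (B ^+ 2)%:C + d%:C * ((- 'i) * (w + (- z0))) + e%:C * ((w + (- z0)) * (w + (- z0))).
have gE w : Re (g w) = B ^+ 2 + d * (Im w - y0) + e * ((Re w - Re z) ^+ 2 - (Im w - y0) ^+ 2).
  by rewrite /g /z0; case: w => [a b] /=; ring.
have pos t : 0 <= t <= Y -> 0 <= d * t - e * t ^+ 2.
  move=> /andP[t0 tY]; rewrite -{1}eY.
  have -> : e * (2 * Y) * t - e * t ^+ 2 = e * (t * (2 * Y - t)) by ring.
  by apply: mulr_ge0; [exact: ltW|apply: mulr_ge0 => //; lra].
apply: le_trans (_ : Re (g z) <= _); last first.
  rewrite gE subrr expr0n /= -/s; have := sqr_ge0 s; nra.
apply: (@maximum_principle _ h g (Re z - X) (Re z + X) y0 (y0 + Y)).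
- move=> w [_ /andP[yw _]]; split; first by have [] := J w yw.
  have jw : jet2 (fun w => w + - z0) w by apply: jet2D; [exact: jet2_id|exact: jet2_cst].
  apply: jet2D; first apply: jet2D; first exact: jet2_cst.
    by apply: jet2M; [exact: jet2_cst|apply: jet2M => //; exact: jet2_cst].
  by apply: jet2M; [exact: jet2_cst|apply: jet2M].
- move=> w [xw /andP[yw yw']] bw; rewrite gE.
  have {}pos := pos (Im w - y0) ltac:(apply/andP; split; lra).
  have [_ hC] := J w yw.
  have hC2 : normc (h w) ^+ 2 <= C ^+ 2.
    by apply: lerXn2r; rewrite ?nnegrE ?normc_ge0// (le_trans _ hC)// normc_ge0.
  have B2 := sqr_ge0 B; have x2 := sqr_ge0 (Re w - Re z).
  have [side|bottom|top] : [\/ (Re w - Re z) ^+ 2 = X ^+ 2, Im w = y0 | Im w = y0 + Y].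
    by case: bw => [->|->|->|->]; [constructor 1; ring|constructor 1; ring|constructor 2|constructor 3].
  + by rewrite side; nra.
  + have hB := Hb w bottom.
    apply: le_trans (_ : B ^+ 2 <= _); first by apply: lerXn2r; rewrite ?nnegrE ?normc_ge0.
    by nra.
  + rewrite top (_ : y0 + Y - y0 = Y); last by ring.
    have : e * (2 * Y) * Y = d * Y by rewrite eY.
    nra.
- split; first by apply/andP; split; lra.
  by rewrite yz /=; rewrite /s in sY; lra.
Qed.

End Strips.

(** * Elementary estimates for the sine and the hyperbolic cosine *)
Section RealEstimates.
Context {R : realType}.
Implicit Types (x y u s t : R).

Lemma sin_concave0 s u : 0 <= s <= 1 -> 0 <= u <= pi -> s * sin u <= sin (s * u).
Proof.
move=> /andP[s0 s1] /andP[u0 upi].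
have su0 : 0 <= s * u by rewrite mulr_ge0.
have suu : s * u <= u by rewrite ler_piMl.
have [c1 I1 E1] := @MVT_segment R sin cos 0 (s * u) su0
  (fun t _ => is_derive_sin t) (continuous_subspaceT (@continuous_sin R)).
have [c2 I2 E2] := @MVT_segment R sin cos (s * u) u suu
  (fun t _ => is_derive_sin t) (continuous_subspaceT (@continuous_sin R)).
rewrite !in_itv/= in I1 I2; move/andP: I1 => [a1 b1]; move/andP: I2 => [a2 b2].
have cc : cos c2 <= cos c1.
  have m1 : c1 \in `[0, pi]%R by rewrite in_itv/=; apply/andP; split; lra.
  have m2 : c2 \in `[0, pi]%R by rewrite in_itv/=; apply/andP; split; lra.
  by rewrite leNgt ltr_cos// -leNgt (le_trans b1).
rewrite sin0 !subr0 in E1.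
have : sin u = cos c2 * (u - s * u) + sin (s * u) by rewrite -E2; ring.
rewrite E1 => ->.
have : s * (1 - s) * u * cos c2 <= s * (1 - s) * u * cos c1.
  by rewrite ler_wpM2l// !mulr_ge0// subr_ge0.
nra.
Qed.

Lemma sinD_le2 x y : 0 <= y <= x -> x + y <= pi -> sin (x + y) <= 2 * sin x.
Proof.
move=> /andP[y0 yx] xy.
have [x0|x0] := leP x 0.
  have -> : x = 0 by lra.
  have -> : y = 0 by lra.
  by rewrite addr0 sin0 mulr0.
have s1 : 0 <= x / (x + y) <= 1.
  by rewrite divr_ge0 ?ler_pdivrMr/=; lra.
have := sin_concave0 s1 (_ : 0 <= x + y <= pi); rewrite divfK; last by rewrite gt_eqF; lra.
move=> /(_ ltac:(lra)).
have : 2^-1 * sin (x + y) <= x / (x + y) * sin (x + y).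
  rewrite ler_wpM2r//; first by apply: sin_ge0_pi; lra.
  by rewrite ler_pdivlMr; lra.
lra.
Qed.

(** It bounds the polynomial majorant of [two_line_estimate_polynomial] by the
    trigonometric one of [two_line_estimate]. *)
Lemma sin_ge_parabola u : 0 <= u <= pi -> u * (pi - u) / pi <= sin u.
Proof.
have pi0 : 0 < pi :> R by exact: pi_gt0.
have half (v : R) : 0 <= v <= pi / 2 -> v * (pi - v) / pi <= sin v.
  move=> /andP[v0 vpi].
  pose f (t : R) := sin t - t + t ^+ 2 / pi; pose df (t : R) := cos t - 1 + 2 * t / pi.
  have fd (t : R) : is_derive t 1 f (df t).
    by apply: is_derive_eq; rewrite /df /GRing.scale /=; ring.
  have cf : continuous f.
    by move=> t; apply/differentiable_continuous/derivable1_diffP; case: (fd t).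
  have [c] := @MVT_segment R f df 0 v v0 (fun t _ => fd t) (continuous_subspaceT cf).
  rewrite in_itv/= => /andP[c0 cv].
  have df0 : 0 <= df c.
    have := @sin_concave0 (1 - 2 * c / pi) (pi / 2).
    rewrite sin_pihalf mulr1.
    have -> : (1 - 2 * c / pi) * (pi / 2) = - (c - pi / 2).
      have : (pi : R) != 0 by rewrite gt_eqF.
      by move: (pi : R) => q q0; field.
    rewrite sinN sinBpihalf opprK /df => H.
    have : 1 - 2 * c / pi <= cos c.
      apply: H; last by lra.
      rewrite subr_ge0 ler_pdivrMr// mul1r gerBl divr_ge0 ?andbT; lra.
    lra.
  rewrite {1 2}/f sin0 expr0n /= mul0r subrr addr0 !subr0 => E.
  have : 0 <= df c * v by rewrite mulr_ge0.
  have -> : v * (pi - v) / pi = v - v ^+ 2 / pi.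
    have : (pi : R) != 0 by rewrite gt_eqF.
    by move: (pi : R) => q q0; field.
  by rewrite -E; lra.
move=> /andP[u0 upi]; have [uh|uh] := leP u (pi / 2); first by apply: half; rewrite u0.
have := half (pi - u) ltac:(lra).
have -> : sin (pi - u) = sin u by rewrite sinB cospi sinpi; ring.
by rewrite (_ : pi - (pi - u) = u) 1?[(pi - u) * u]mulrC//; ring.
Qed.

Lemma pi_le4 : pi <= 4 :> R.
Proof. by have := @pihalf_lt2 R; rewrite ltr_pdivrMr// -natrM => /ltW. Qed.

(** From e^(1/8) <= 8/7, raised to the power 12. *)
Lemma expR_3half_le5 : expR (3 / 2) <= 5 :> R.
Proof.
have e8 : expR (1 / 8) <= 8 / 7 :> R.
  have := expR_ge1Dx (- (1 / 8) : R); rewrite expRN.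
  have E0 : 0 < expR (1 / 8) :> R by exact: expR_gt0.
  have := mulfV (lt0r_neq0 E0); set q := (expR (1 / 8))^-1 => qE Hq.
  have : expR (1 / 8) * (1 + - (1 / 8)) <= expR (1 / 8) * q by rewrite ler_pM2l.
  by rewrite qE; lra.
have -> : 3 / 2 = 12%:R * (1 / 8) :> R by field.
rewrite expRM_natl; apply: le_trans (_ : (8 / 7) ^+ 12 <= _); last by lra.
by apply: lerXn2r; rewrite ?nnegrE ?expR_ge0//; lra.
Qed.

Definition cosh x : R := (expR x + expR (- x)) / 2.

Lemma coshN x : cosh (- x) = cosh x.
Proof. by rewrite /cosh opprK addrC. Qed.

Lemma cosh_gt0 x : 0 < cosh x.
Proof. by rewrite divr_gt0// addr_gt0 ?expR_gt0. Qed.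

Lemma coshV_le x : (cosh x)^-1 <= 2 * expR (- x).
Proof.
rewrite -[leLHS]mul1r ler_pdivrMr ?cosh_gt0// /cosh.
have := expRxMexpNx_1 x; have := sqr_ge0 (expR (- x)); lra.
Qed.

End RealEstimates.

(** * Propagation of smallness inside rectangles *)
Section HarmonicMajorants.
Context {R : realType}.
Implicit Types (h : R[i] -> R[i]) (z w : R[i]).

(** The real part of its product with [i] is the building block of the harmonic
    majorants below. *)
Definition csinh z : R[i] := ((2 : R)^-1)%:C * (cexp z + (-1 : R)%:C * cexp ((-1 : R)%:C * z)).

Lemma Re_i_csinh z : Re ('i * csinh z) = - (cosh (Re z) * sin (Im z)).
Proof.
case: z => x y; rewrite /csinh /cosh.
have -> : (-1 : R)%:C * (x +i* y) = (- x) +i* (- y).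
  by apply/eqP; rewrite eq_complex /=; apply/andP; split; apply/eqP; ring.
by rewrite /cexp /cexpi /= cosN sinN; field.
Qed.

Lemma jet2_csinh g z : jet2 g z -> jet2 (fun z => csinh (g z)) z.
Proof.
move=> gz; apply: jet2M; first exact: jet2_cst.
apply: jet2D; first exact: jet2_cexp.
apply: jet2M; first exact: jet2_cst.
by apply: (@jet2_cexp _ (fun z => _ * g z)); apply: jet2M => //; exact: jet2_cst.
Qed.

(** With m = pi / L, the harmonic function
      v = 1 - y/w - cosh(m (x' - x)) sin(m (w - y)) / (cosh(m d) sin(m w))
    is at most 1 on the bottom side, 0 on the top side, and nonpositive on the
    vertical sides because the sine is concave.  So -b v majorises log(|h| / B).  At
    the point (x, t) its last term is at most 4 e^(-m d): 1 / cosh gives a factor 2,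
    and so does the quotient of sines. *)
Lemma one_line_estimate h (x B b d w L t : R) :
  0 <= B -> 0 <= b -> 0 < w < L -> 0 <= t <= w -> t <= L - w -> 0 <= d ->
  (forall z, rectangle (x - d) (x + d) 0 w z -> jet2 h z /\ normc (h z) <= B) ->
  (forall z, rectangle (x - d) (x + d) 0 w z -> Im z = 0 ->
     normc (h z) <= B * expR (- b)) ->
  normc (h (x +i* t)) <= B * expR (- (b * (1 - t / w - 4 * expR (- (pi * d / L))))).
Proof.
move=> B0 b0 /andP[w0 wL] /andP[t0 tw] tL d0 J Hb.
have pi0 : 0 < pi :> R by exact: pi_gt0.
have L0 : 0 < L by lra.
pose m := pi / L; have m0 : 0 < m by rewrite divr_gt0.
have mw0 : 0 < m * w by rewrite mulr_gt0.
have mL : m * L = pi by rewrite /m divfK// gt_eqF.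
have mwpi : m * w < pi by rewrite -mL ltr_pM2l.
have sw : 0 < sin (m * w) by apply: sin_gt0_pi; rewrite mw0.
have ch := @cosh_gt0 R (m * d).
pose l := (cosh (m * d) * sin (m * w))^-1.
have l0 : 0 < l by rewrite invr_gt0 mulr_gt0.
pose v z := 1 - Im z / w - l * (cosh (m * (Re z - x)) * sin (m * (w - Im z))).
pose g z := (- b : R)%:C * ((1 : R)%:C + (w^-1)%:C * ('i * (z + (- x)%:C))
   + (- l : R)%:C * ('i * csinh (m%:C * (z + (- x +i* - w))))).
have gE z : Re (g z) = - (b * v z).
  rewrite /g /v.
  have -> : m * (w - Im z) = - Im (m%:C * (z + (- x +i* - w))) by case: z => a c /=; ring.
  have -> : m * (Re z - x) = Re (m%:C * (z + (- x +i* - w))) by case: z => a c /=; ring.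
  rewrite sinN.
  have := Re_i_csinh (m%:C * (z + (- x +i* - w))).
  case: ('i * csinh _) => [p q] /= ->; case: z => a c; simpc => /=.
  ring.
have jg z : jet2 g z.
  have jl A : jet2 (fun z => z + A) z by apply: jet2D; [exact: jet2_id|exact: jet2_cst].
  apply: jet2M; first exact: jet2_cst.
  apply: jet2D.
    apply: jet2D; first exact: jet2_cst.
    by apply: jet2M; [exact: jet2_cst|apply: jet2M => //; exact: jet2_cst].
  apply: jet2M; first exact: jet2_cst.
  apply: jet2M; first exact: jet2_cst.
  by apply: jet2_csinh; apply: jet2M => //; exact: jet2_cst.
have key : normc (h (x +i* t)) <= B * expR (Re (g (x +i* t))).
  apply: (@two_constants _ h g B (x - d) (x + d) 0 w) => //.
  - by move=> z Qz; split => //; have [] := J z Qz.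
  - move=> z Qz bz; rewrite gE.
    have [_ hB] := J z Qz.
    have [/andP[xz xz'] /andP[yz yz']] := Qz.
    have out : v z <= 0 -> normc (h z) <= B * expR (- (b * v z)).
      move=> vz; apply: le_trans hB _; rewrite ler_peMr// -expR0 ler_expR oppr_ge0.
      by rewrite mulr_ge0_le0.
    have side : Re z - x = d \/ Re z - x = - d -> v z <= 0.
      move=> xd; rewrite /v.
      have -> : cosh (m * (Re z - x)) = cosh (m * d).
        by case: xd => ->; rewrite ?mulrN ?coshN.
      have -> : l * (cosh (m * d) * sin (m * (w - Im z))) = sin (m * (w - Im z)) / sin (m * w).
        by rewrite /l; field; rewrite !gt_eqF.
      have := @sin_concave0 R ((w - Im z) / w) (m * w).
      have -> : (w - Im z) / w * (m * w) = m * (w - Im z) by field; rewrite gt_eqF.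
      have s1 : 0 <= (w - Im z) / w <= 1 by rewrite divr_ge0 ?ler_pdivrMr//; lra.
      move=> /(_ s1 ltac:(apply/andP; split; lra)).
      rewrite -ler_pdivlMr// mulrBl divff ?gt_eqF//; lra.
    case: bz => E.
    + by apply/out/side; right; rewrite E; ring.
    + by apply/out/side; left; rewrite E; ring.
    + apply: le_trans (Hb z Qz E) _; rewrite ler_wpM2l// ler_expR lerN2.
      rewrite ler_piMr// /v E mul0r !subr0 lerBlDr lerDl.
      by rewrite mulr_ge0 ?(ltW l0)// mulr_ge0 ?(ltW sw) ?(ltW (cosh_gt0 _)).
    + apply: out; rewrite /v E subrr mulr0 sin0 !mulr0 divff ?gt_eqF//; lra.
  - by split; apply/andP => /=; split; lra.
apply: le_trans key _; rewrite gE ler_wpM2l// ler_expR lerN2 ler_wpM2l//.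
rewrite /v /= subrr mulr0 lerB//.
have -> : cosh (0 : R) = 1 by rewrite /cosh oppr0 expR0; field.
rewrite mul1r /l invfM -mulrA.
(* By symmetry around pi / 2 this compares sin(m (L - w) + m t) with
   sin(m (L - w)), and t <= L - w. *)
have s2 : sin (m * (w - t)) <= 2 * sin (m * w).
  have e1 : sin (m * w) = sin (m * (L - w)).
    by rewrite mulrBr mL sinB cospi sinpi; ring.
  have e2 : sin (m * (w - t)) = sin (m * (L - w) + m * t).
    have -> : m * (L - w) + m * t = pi - m * (w - t) by rewrite -mL; ring.
    by rewrite sinB cospi sinpi; ring.
  rewrite e1 e2; apply: sinD_le2.
    by apply/andP; split; [exact: (mulr_ge0 (ltW m0))|rewrite ler_pM2l].
  apply: le_trans (_ : m * L <= _); last by rewrite mL.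
  by rewrite -mulrDr (ler_pM2l m0); lra.
have s3 : (sin (m * w))^-1 * sin (m * (w - t)) <= 2 by rewrite mulrC ler_pdivrMr.
apply: le_trans (_ : (cosh (m * d))^-1 * 2 <= _).
  by rewrite -mulrA ler_pM2l// invr_gt0.
have -> : pi * (d / L) = m * d by rewrite /m mulrA mulrAC.
have := coshV_le (m * d); lra.
Qed.

(** The polynomial (x' - x)^2 + y (W - y) is harmonic, nonnegative on the
    horizontal sides and at least r^2 on the vertical ones. *)
Lemma two_line_estimate_polynomial h (x B b W r t : R) :
  0 <= B -> 0 <= b -> 0 < r -> 0 <= t <= W ->
  (forall z, rectangle (x - r) (x + r) 0 W z -> jet2 h z /\ normc (h z) <= B) ->
  (forall z, rectangle (x - r) (x + r) 0 W z -> Im z = 0 \/ Im z = W ->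
     normc (h z) <= B * expR (- b)) ->
  normc (h (x +i* t)) <= B * expR (- (b * (1 - t * (W - t) / r ^+ 2))).
Proof.
move=> B0 b0 r0 /andP[t0 tW] J Hb.
have r2 : 0 < r ^+ 2 by rewrite exprn_gt0.
pose v z := 1 - ((Re z - x) ^+ 2 + Im z * (W - Im z)) / r ^+ 2.
pose g z := (- b : R)%:C * ((1 : R)%:C + (- (r ^+ 2)^-1 : R)%:C *
   ((z + (- x)%:C) * (z + (- x)%:C) + (- W : R)%:C * ('i * (z + (- x)%:C)))).
have gE z : Re (g z) = - (b * v z).
  by rewrite /g /v; case: z => p q /=; ring.
have jg z : jet2 g z.
  have jl A : jet2 (fun z => z + A) z by apply: jet2D; [exact: jet2_id|exact: jet2_cst].
  apply: jet2M; first exact: jet2_cst.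
  apply: jet2D; first exact: jet2_cst.
  apply: jet2M; first exact: jet2_cst.
  apply: jet2D; first exact: jet2M.
  by apply: jet2M; [exact: jet2_cst|apply: jet2M => //; exact: jet2_cst].
have key : normc (h (x +i* t)) <= B * expR (Re (g (x +i* t))).
  apply: (@two_constants _ h g B (x - r) (x + r) 0 W) => //.
  - by move=> z Qz; split => //; have [] := J z Qz.
  - move=> z Qz bz; rewrite gE.
    have [_ hB] := J z Qz.
    have [/andP[xz xz'] /andP[yz yz']] := Qz.
    have side : (Re z - x) ^+ 2 = r ^+ 2 -> normc (h z) <= B * expR (- (b * v z)).
      move=> xd; apply: le_trans hB _; rewrite ler_peMr// -expR0 ler_expR oppr_ge0.
      rewrite mulr_ge0_le0// /v xd subr_le0 ler_pdivlMr// mul1r lerDl mulr_ge0//.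
      by rewrite subr_ge0.
    have line : Im z = 0 \/ Im z = W -> normc (h z) <= B * expR (- (b * v z)).
      move=> E; apply: le_trans (Hb z Qz E) _; rewrite ler_wpM2l// ler_expR lerN2.
      rewrite ler_piMr// /v lerBlDr lerDl divr_ge0 ?(ltW r2)// addr_ge0 ?sqr_ge0//.
      by case: E => ->; rewrite ?subrr ?mulr0 ?mul0r.
    case: bz => E.
    + by apply: side; rewrite E; ring.
    + by apply: side; rewrite E; ring.
    + by apply: line; left.
    + by apply: line; right.
  - by split; apply/andP => /=; split; lra.
by move: key; rewrite gE /v /= subrr expr0n /= add0r.
Qed.

(** The loss has to be proportional to t, since the losses of all the shifts of
    the chain are added.  A majorant cosh(m x) sin(m y) is proportional to t, but it
    vanishes at the corners, where |h| <= B is all that is known.  Hence a strip of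
    width r = 3 L / (2 pi) is first given up on both sides: by
    [two_line_estimate_polynomial] the defect on the new vertical sides is at most
    y (W - y) / r^2, which the sine dominates.  The constant 72 comes from
    4 pi^2 / 9 <= 64 / 9 and 2 e^(3/2) <= 10. *)
Lemma two_line_estimate h (x B b d W L t : R) :
  0 <= B -> 0 <= b -> 0 < L -> W <= L -> 0 <= t <= W -> 3 / 2 <= pi * d / L ->
  (forall z, rectangle (x - d) (x + d) 0 W z -> jet2 h z /\ normc (h z) <= B) ->
  (forall z, rectangle (x - d) (x + d) 0 W z -> Im z = 0 \/ Im z = W ->
     normc (h z) <= B * expR (- b)) ->
  normc (h (x +i* t)) <= B * expR (- (b * (1 - 72 * (t / L) * expR (- (pi * d / L))))).
Proof.
move=> B0 b0 L0 WL /andP[t0 tW] dL J Hb.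
have pi0 : 0 < pi :> R by exact: pi_gt0.
have pi4 := @pi_le4 R.
move: (@sin_ge_parabola R) (@abs_sin_le R) (@sin_ge0_pi R) dL pi0 pi4.
move: (pi : R) => P parab sinle sin0P dL P0 P4.
pose m := P / L; have m0 : 0 < m by rewrite divr_gt0.
have mL : m * L = P by rewrite /m divfK// gt_eqF.
pose r := 3 / 2 * (L / P).
have r0 : 0 < r by rewrite mulr_gt0// divr_gt0.
have mr : m * r = 3 / 2 by rewrite /m /r; field; rewrite !gt_eqF.
have md : P * d / L = m * d by rewrite /m; ring.
have rd : r <= d by rewrite -(ler_pM2l m0) mr -md.
pose d' := d - r; have d'0 : 0 <= d' by rewrite subr_ge0.
have stage1 z : rectangle (x - d') (x + d') 0 W z ->
    normc (h z) <= B * expR (- (b * (1 - Im z * (W - Im z) / r ^+ 2))).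
  move=> [/andP[xz xz'] yz]; rewrite /d' in xz xz'.
  rewrite {1}(_ : z = Re z +i* Im z); last by case: z {xz xz' yz}.
  apply: two_line_estimate_polynomial => // w [/andP[xw xw'] yw];
    [apply: J|apply: Hb]; split => //; apply/andP; split; lra.
have ch := @cosh_gt0 R (m * d').
have r2 : 0 < r ^+ 2 by rewrite exprn_gt0.
pose l := L ^+ 2 / (P * r ^+ 2 * cosh (m * d')).
have l0 : 0 < l by rewrite divr_gt0 ?exprn_gt0// mulr_gt0// mulr_gt0.
pose v z := 1 - l * (cosh (m * (Re z - x)) * sin (m * Im z)).
pose g z := (- b : R)%:C * ((1 : R)%:C + l%:C * ('i * csinh (m%:C * (z + (- x)%:C)))).
have gE z : Re (g z) = - (b * v z).
  rewrite /g /v.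
  have -> : m * Im z = Im (m%:C * (z + (- x)%:C)) by case: z => a c /=; ring.
  have -> : m * (Re z - x) = Re (m%:C * (z + (- x)%:C)) by case: z => a c /=; ring.
  have := Re_i_csinh (m%:C * (z + (- x)%:C)).
  by case: ('i * csinh _) => [p q] /= ->; ring.
have jg z : jet2 g z.
  have jl A : jet2 (fun z => z + A) z by apply: jet2D; [exact: jet2_id|exact: jet2_cst].
  apply: jet2M; first exact: jet2_cst.
  apply: jet2D; first exact: jet2_cst.
  apply: jet2M; first exact: jet2_cst.
  apply: jet2M; first exact: jet2_cst.
  by apply: jet2_csinh; apply: jet2M => //; exact: jet2_cst.
have sub z : rectangle (x - d') (x + d') 0 W z -> rectangle (x - d) (x + d) 0 W z.
  by move=> [/andP[xz xz'] yz]; split => //; rewrite /d' in xz xz'; apply/andP; split; lra.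
have sinm y : 0 <= y <= W -> 0 <= sin (m * y).
  move=> /andP[y0 yW]; apply: sin0P; rewrite mulr_ge0 ?(ltW m0)//= -mL.
  by rewrite (ler_pM2l m0); lra.
have key : normc (h (x +i* t)) <= B * expR (Re (g (x +i* t))).
  apply: (@two_constants _ h g B (x - d') (x + d') 0 W) => //.
  - by move=> z Qz; split => //; have [] := J z (sub z Qz).
  - move=> z Qz bz; rewrite gE.
    have [/andP[xz xz'] /andP[yz yz']] := Qz.
    have side : Re z - x = d' \/ Re z - x = - d' -> normc (h z) <= B * expR (- (b * v z)).
      move=> xd; apply: le_trans (stage1 z Qz) _.
      rewrite ler_wpM2l// ler_expR lerN2 ler_wpM2l// /v lerB//.
      have -> : cosh (m * (Re z - x)) = cosh (m * d').
        by case: xd => ->; rewrite ?mulrN ?coshN.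
      have -> : l * (cosh (m * d') * sin (m * Im z)) =
          sin (m * Im z) * L ^+ 2 / P / r ^+ 2.
        by rewrite /l; field; rewrite !gt_eqF.
      rewrite ler_pM2r ?invr_gt0// ler_pdivlMr//.
      have := parab (m * Im z); rewrite -mL => Hp.
      have {}Hp : m * Im z * (m * L - m * Im z) / (m * L) <= sin (m * Im z).
        apply: Hp; rewrite mulr_ge0 ?(ltW m0)//= (ler_pM2l m0); lra.
      have E1 : m * Im z * (m * L - m * Im z) / (m * L) * L ^+ 2 = Im z * (L - Im z) * (m * L).
        by field; rewrite !gt_eqF.
      apply: le_trans (_ : Im z * (L - Im z) * (m * L) <= _).
        by apply: ler_wpM2r; [exact/ltW/mulr_gt0|apply: ler_wpM2l => //; lra].
      by rewrite -E1 ler_pM2r ?exprn_gt0.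
    have line : Im z = 0 \/ Im z = W -> normc (h z) <= B * expR (- (b * v z)).
      move=> E; apply: le_trans (Hb z (sub z Qz) E) _; rewrite ler_wpM2l// ler_expR lerN2.
      rewrite ler_piMr// /v lerBlDr lerDl mulr_ge0 ?(ltW l0)// mulr_ge0 ?(ltW (cosh_gt0 _))//.
      by apply: sinm; apply/andP.
    case: bz => E.
    + by apply: side; right; rewrite E; ring.
    + by apply: side; left; rewrite E; ring.
    + by apply: line; left.
    + by apply: line; right.
  - by split; apply/andP => /=; split; lra.
apply: le_trans key _; rewrite gE ler_wpM2l// ler_expR lerN2 ler_wpM2l//.
rewrite /v /= subrr mulr0 lerB//.
have -> : cosh (0 : R) = 1 by rewrite /cosh oppr0 expR0; field.
rewrite mul1r md.
have s1 : sin (m * t) <= m * t.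
  have mt : 0 <= m * t by rewrite mulr_ge0// ltW.
  by apply: le_trans (ler_norm _) _; apply: le_trans (sinle _) _; rewrite ger0_norm.
apply: le_trans (_ : l * (m * t) <= _); first by rewrite ler_pM2l.
have c1 : (cosh (m * d'))^-1 <= 10 * expR (- (m * d)).
  apply: le_trans (coshV_le _) _.
  have -> : - (m * d') = 3 / 2 + - (m * d) by rewrite /d' -mr; ring.
  rewrite expRD mulrA ler_pM2r ?expR_gt0//; have := @expR_3half_le5 R; lra.
have -> : l * (m * t) = 4 / 9 * P ^+ 2 * (t / L) * (cosh (m * d'))^-1.
  by rewrite /l /m /r; field; rewrite !gt_eqF.
have P2 : P ^+ 2 <= 16 by nra.
have tL : 0 <= t / L by rewrite divr_ge0// ltW.
apply: le_trans (_ : 4 / 9 * 16 * (t / L) * (10 * expR (- (m * d))) <= _).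
  apply: ler_pM; [|by rewrite invr_ge0 ltW| |exact: c1].
    by apply: mulr_ge0 => //; apply: mulr_ge0 => //; exact: sqr_ge0.
  by apply: ler_wpM2r => //; apply: ler_wpM2l.
have := expR_ge0 (- (m * d)); nra.
Qed.

End HarmonicMajorants.

(** * Cross products at two heights *)
Section CrossTerms.
Context {R : realType}.
Implicit Types (z w : R[i]) (u v x y : R).
Variables (T1 T2 : R[i] -> R[i]) (S : R -> R).

(** What the chain needs about the two analytic functions.  The supremum [S] over
    a horizontal line is characterised by its universal property, so that the
    concrete [sup] only occurs when the hypotheses are checked. *)
Definition halfplane_sup : Prop :=
  [/\ forall z, 0 < Im z -> jet2 T1 z /\ jet2 T2 z,
      forall y, 0 < y -> exists C : R, forall z, y <= Im z ->
        normc (T1 z) <= C /\ normc (T2 z) <= C,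
      forall z, 0 < Im z -> normc (T1 z) <= S (Im z) /\ normc (T2 z) <= S (Im z) &
      forall y (B : R), 0 < y ->
        (forall x, normc (T1 (x +i* y)) <= B /\ normc (T2 (x +i* y)) <= B) -> S y <= B].

(** The holomorphic function whose value at x + i y is
    conj(T(x + i (u - y))) T(x + i (v + y)): two points on a vertical line whose
    heights have the constant sum u + v. *)
Definition pair_fun (T : R[i] -> R[i]) u v z : R[i] :=
  (T (z^* + 0 +i* u))^* * T (z + 0 +i* v).

Lemma pair_funE T u v x y :
  pair_fun T u v (x +i* y) = (T (x +i* (u - y)))^* * T (x +i* (v + y)).
Proof.
rewrite /pair_fun; congr ((T _)^* * T _); apply/eqP; rewrite eq_complex /=;
  by apply/andP; split; apply/eqP; ring.
Qed.

Definition cross_diff u v x : R[i] :=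
  (T1 (x +i* u))^* * T1 (x +i* v) - (T2 (x +i* u))^* * T2 (x +i* v).

Lemma normc_cross_diffC u v x : normc (cross_diff u v x) = normc (cross_diff v u x).
Proof.
rewrite -normc_conj /cross_diff rmorphB !rmorphM /= !conjcK.
by congr (normc (_ - _)); rewrite mulrC.
Qed.

Hypothesis HS : halfplane_sup.

Lemma sup_ge0 y : 0 < y -> 0 <= S y.
Proof.
by case: HS => _ _ H _ y0; have [] := H (0 +i* y) y0; move=> /(le_trans (normc_ge0 _)).
Qed.

(** Phragmen-Lindelof on the half-plane above height [u]. *)
Lemma sup_nonincreasing u v : 0 < u -> u <= v -> S v <= S u.
Proof.
case: HS => HJ HC Hb Hl u0 uv; apply: Hl; first exact: lt_le_trans uv.
have [C HC'] := HC u u0.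
move=> x; split.
  apply: (@halfplane_bound _ T1 u (S u) C) => //; first exact: sup_ge0.
  - by move=> z uz; have [? _] := HC' z uz; have [? _] := HJ z (lt_le_trans u0 uz).
- by move=> z zu; have [] := Hb z; rewrite zu.
apply: (@halfplane_bound _ T2 u (S u) C) => //; first exact: sup_ge0.
- by move=> z uz; have [_ ?] := HC' z uz; have [_ ?] := HJ z (lt_le_trans u0 uz).
- by move=> z zu; have [] := Hb z; rewrite zu.
Qed.

Lemma jet2_pair_fun T u v z : (forall z, 0 < Im z -> jet2 T z) ->
  - v < Im z < u -> jet2 (pair_fun T u v) z.
Proof.
move=> HT /andP[vz zu]; apply: jet2M.
  apply: (@jet2_reflect _ (fun z => T (z + 0 +i* u))).
  by apply: jet2_shift; apply: HT; case: z vz zu => p q /=; rewrite addrC subr_gt0.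
by apply: jet2_shift; apply: HT; case: z vz zu => p q /=; rewrite -ltrBlDr sub0r.
Qed.

(** The modulus is bounded by S(u) S(v) on both edges of the strip, and S(v)^2 is
    an a priori bound inside because S decreases: [strip_bound] applies. *)
Lemma pair_fun_bound T u v x y :
  (forall z, 0 < Im z -> jet2 T z) ->
  (forall z, 0 < Im z -> normc (T z) <= S (Im z)) ->
  0 < v -> v <= u -> 0 <= y <= u - v ->
  normc (pair_fun T u v (x +i* y)) <= S u * S v.
Proof.
move=> HJ Hb v0 vu yuv.
have u0 : 0 < u by apply: lt_le_trans vu.
have prod s t x' : 0 < s -> 0 < t ->
    normc ((T (x' +i* s))^* * T (x' +i* t)) <= S s * S t.
  move=> s0 t0; rewrite normcM normc_conj; apply: ler_pM; rewrite ?normc_ge0//;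
    exact: (Hb (_ +i* _)).
apply: (@strip_bound _ (pair_fun T u v) 0 (u - v) (S u * S v) (S v * S v)) => //.
- by rewrite mulr_ge0// sup_ge0.
- move=> z /andP[z0 z1]; split.
    by apply: jet2_pair_fun => //; apply/andP; split; lra.
  case: z z0 z1 => p q /= z0 z1; rewrite pair_funE.
  apply: le_trans (prod _ _ _ _ _) _; [lra|lra|].
  by apply: ler_pM; rewrite ?sup_ge0 ?sup_nonincreasing//; lra.
- case=> p q /= _ [->|->]; rewrite pair_funE ?subr0 ?addr0; first exact: prod.
  by rewrite subKr subrKC [S u * S v]mulrC; exact: prod.
Qed.

Lemma cross_diffE u v x y :
  cross_diff (u - y) (v + y) x = pair_fun T1 u v (x +i* y) - pair_fun T2 u v (x +i* y).
Proof. by rewrite !pair_funE. Qed.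

Lemma cross_diff_bound u v x y : 0 < v -> v <= u -> 0 <= y <= u - v ->
  normc (cross_diff (u - y) (v + y) x) <= 2 * (S u * S v).
Proof.
case: HS => HJ _ Hb _ v0 vu yuv; rewrite cross_diffE.
apply: le_trans (ler_normcB _ _) _; rewrite mulr2n mulrDl !mul1r; apply: lerD.
  by apply: pair_fun_bound => // z z0; [have [] := HJ z z0|have [] := Hb z z0].
by apply: pair_fun_bound => // z z0; [have [] := HJ z z0|have [] := Hb z z0].
Qed.

Lemma jet2_cross_diff u v z : - v < Im z < u ->
  jet2 (fun z => pair_fun T1 u v z + (-1 : R)%:C * pair_fun T2 u v z) z.
Proof.
case: HS => HJ _ _ _ zuv; apply: jet2D.
  by apply: jet2_pair_fun => // w w0; have [] := HJ w w0.
apply: jet2M; first exact: jet2_cst.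
by apply: jet2_pair_fun => // w w0; have [] := HJ w w0.
Qed.

Lemma cross_holoE u v z :
  pair_fun T1 u v z + (-1 : R)%:C * pair_fun T2 u v z =
  cross_diff (u - Im z) (v + Im z) (Re z).
Proof.
rewrite cross_diffE; case: z => x y /=; congr (_ + _).
by rewrite rmorphN1 mulN1r.
Qed.

(** The three-lines inequality for [S], read off [pair_fun_bound] on the middle
    line of the strip, where the pair function is |T|^2. *)
Lemma sup_sqr_le (y w : R) : 0 < w < y -> S y * S y <= S (y + w) * S (y - w).
Proof.
move=> /andP[w0 wy]; have y0 : 0 < y by lra.
have S0 := sup_ge0 y0.
have P0 : 0 <= S (y + w) * S (y - w) by rewrite mulr_ge0// sup_ge0; lra.
case: HS => HJ _ Hb Hl.
have K T : (forall z, 0 < Im z -> jet2 T z) ->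
    (forall z, 0 < Im z -> normc (T z) <= S (Im z)) ->
    forall x, normc (T (x +i* y)) <= Num.sqrt (S (y + w) * S (y - w)).
  move=> HT HbT x.
  have := @pair_fun_bound T (y + w) (y - w) x w HT HbT ltac:(lra) ltac:(lra) ltac:(lra).
  rewrite pair_funE addrK subrK normcM normc_conj -expr2 => H.
  by rewrite -[leLHS]ger0_norm ?normc_ge0// -sqrtr_sqr ler_wsqrtr.
have : S y <= Num.sqrt (S (y + w) * S (y - w)).
  apply: Hl => // x; split.
    by apply: K => z z0; [have [] := HJ z z0|have [] := Hb z z0].
  by apply: K => z z0; [have [] := HJ z z0|have [] := Hb z z0].
by move=> Sq; rewrite -expr2 -[leRHS]sqr_sqrtr//; apply: lerXn2r; rewrite ?nnegrE ?sqrtr_ge0.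
Qed.

(** [one_line_estimate] applied to z |-> D(y - Im z, y + Im z), whose bottom side is
    the diagonal. *)
Lemma cross_diff_from_diagonal (y w L d t x eps b : R) :
  0 < w < y -> w < L -> 0 <= t <= w -> t <= L - w -> 0 <= d -> 0 <= b ->
  eps = expR (- b) ->
  (forall x', x - d <= x' <= x + d ->
     normc (cross_diff y y x') <= eps * S y ^+ 2) ->
  normc (cross_diff (y + t) (y - t) x) <=
    2 * (S (y + w) * S (y - w)) * expR (- (b * (1 - t / w - 4 * expR (- (pi * d / L))))).
Proof.
move=> /andP[w0 wy] wL tw tL d0 b0 -> Hx.
rewrite normc_cross_diffC.
have := @one_line_estimate R (fun z => pair_fun T1 y y z + (-1 : R)%:C * pair_fun T2 y y z)
  x (2 * (S (y + w) * S (y - w))) b d w L t.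
rewrite cross_holoE /=; apply => //.
- by rewrite !mulr_ge0// sup_ge0; lra.
- by rewrite w0.
- move=> z [_ /andP[z0 z1]]; split; first by apply: jet2_cross_diff; lra.
  rewrite cross_holoE.
  have := @cross_diff_bound (y + w) (y - w) (Re z) (w + Im z) ltac:(lra) ltac:(lra) ltac:(lra).
  rewrite (_ : y + w - (w + Im z) = y - Im z); last by ring.
  by rewrite (_ : y - w + (w + Im z) = y + Im z); last by ring.
- move=> z [xz _] z0; rewrite cross_holoE z0 subr0 addr0.
  apply: le_trans (Hx _ xz) _; rewrite mulrC ler_pM2r ?expR_gt0// expr2.
  have := @sup_sqr_le y w ltac:(lra).
  have : 0 <= S (y + w) * S (y - w) by rewrite mulr_ge0// sup_ge0; lra.
  lra.
Qed.

(** [two_line_estimate] on the strip between the pairs (P, v) and (v, P): exchanging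
    the heights only conjugates D, so that smallness holds on both edges. *)
Lemma cross_diff_transport (P v W L d t x b B : R) :
  0 < v -> v <= P -> W = P - v -> W <= L -> 0 <= t <= W -> 0 < L -> 0 <= b ->
  3 / 2 <= pi * d / L -> 2 * (S P * S v) <= B ->
  (forall x', x - d <= x' <= x + d -> normc (cross_diff P v x') <= B * expR (- b)) ->
  normc (cross_diff (P - t) (v + t) x) <=
    B * expR (- (b * (1 - 72 * (t / L) * expR (- (pi * d / L))))).
Proof.
move=> v0 vP WE WL tW L0 b0 dL HB Hx.
have P0 : 0 < P by lra.
have B0 : 0 <= B by apply: le_trans HB; rewrite !mulr_ge0// sup_ge0.
have := @two_line_estimate R (fun z => pair_fun T1 P v z + (-1 : R)%:C * pair_fun T2 P v z)
  x B b d W L t.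
rewrite cross_holoE /=; apply => //.
- move=> z [_ /andP[z0 z1]]; split; first by apply: jet2_cross_diff; lra.
  rewrite cross_holoE; apply: le_trans HB.
  by apply: cross_diff_bound => //; lra.
- move=> z [xz _] [] zE; rewrite cross_holoE zE ?subr0 ?addr0; first exact: Hx.
  by rewrite WE subKr subrKC normc_cross_diffC; exact: Hx.
Qed.

End CrossTerms.

(** * Composition of two cross products *)
Section Combination.
Context {R : realType}.

(** Multiply the difference conj(p1) c1 - conj(p2) c2 by |b1|^2 and telescope through
    conj(p1) b1 and conj(b1) c1.  Taking |b2| <= |b1|, both products keep a factor at
    most |b1|, so the division by |b1|^2 costs them a single factor 1 / sg; only the
    error |b1|^2 - |b2|^2 pays two. *)
Lemma cross_combination (p1 p2 b1 b2 c1 c2 : R[i]) (X Y V sg n P C : R) :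
  0 < sg -> 0 < n -> 0 <= P -> 0 <= C ->
  sg * n <= normc b1 -> sg * n <= normc b2 ->
  normc p1 <= P -> normc p2 <= P -> normc c1 <= C -> normc c2 <= C ->
  normc (p1^* * b1 - p2^* * b2) <= X * n ->
  normc (b1^* * c1 - b2^* * c2) <= Y * n ->
  `|normc b1 ^+ 2 - normc b2 ^+ 2| <= V * n ^+ 2 ->
  normc (p1^* * c1 - p2^* * c2) <= (X * C + P * Y + V / sg * P * C) / sg.
Proof.
move=> s0 n0 P0 C0.
wlog b21 : p1 p2 b1 b2 c1 c2 / normc b2 <= normc b1.
  move=> H; have [b21|/ltW b12] := leP (normc b2) (normc b1); first exact: H.
  move=> *; rewrite normc_distC; apply: (H p2 p1 b2 b1 c2 c1) => //.
  - by rewrite normc_distC.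
  - by rewrite normc_distC.
  - by rewrite distrC.
move=> sb1 sb2 hp1 hp2 hc1 hc2 hX hY hV.
have sn0 : 0 < sg * n by rewrite mulr_gt0.
have B0 : 0 < normc b1 by apply: lt_le_trans sb1.
have bJ (b : R[i]) : b * b^* = (normc b ^+ 2)%:C.
  case: b => x y; rewrite sqr_normc_ReIm; simpc => /=.
  by rewrite -!expr2 [y * x]mulrC addNr.
have E : (normc b1 ^+ 2)%:C * (p1^* * c1 - p2^* * c2) =
    (p1^* * b1 - p2^* * b2) * (b1^* * c1) + (p2^* * b2) * (b1^* * c1 - b2^* * c2)
    + (normc b2 ^+ 2 - normc b1 ^+ 2)%:C * (p2^* * c2).
  by rewrite rmorphB /= -!bJ; ring.
have X0 : 0 <= X by rewrite -(pmulr_lge0 _ n0) (le_trans (normc_ge0 _) hX).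
have Y0 : 0 <= Y by rewrite -(pmulr_lge0 _ n0) (le_trans (normc_ge0 _) hY).
have V0 : 0 <= V by rewrite -(pmulr_lge0 _ (exprn_gt0 2 n0)) (le_trans (normr_ge0 _) hV).
have L : normc b1 ^+ 2 * normc (p1^* * c1 - p2^* * c2) <=
    X * n * (normc b1 * C) + P * normc b1 * (Y * n) + V * n ^+ 2 * (P * C).
  have <- : normc ((normc b1 ^+ 2)%:C * (p1^* * c1 - p2^* * c2)) =
    normc b1 ^+ 2 * normc (p1^* * c1 - p2^* * c2).
    by rewrite normcM normcR ger0_norm ?sqr_ge0.
  rewrite E; apply: le_trans (ler_normcD _ _) _; apply: lerD.
    apply: le_trans (ler_normcD _ _) _; apply: lerD.
      rewrite normcM; apply: ler_pM; rewrite ?normc_ge0//.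
      by rewrite normcM normc_conj ler_pM2l.
    rewrite normcM; apply: ler_pM; rewrite ?normc_ge0//.
    by rewrite normcM normc_conj; apply: ler_pM; rewrite ?normc_ge0.
  rewrite normcM normcR distrC; apply: ler_pM; rewrite ?normc_ge0 ?normr_ge0//.
  by rewrite normcM normc_conj; apply: ler_pM; rewrite ?normc_ge0.
set N := normc (p1^* * c1 - p2^* * c2) in L *; set B := normc b1 in L B0 sb1 *.
have q1 : n / B <= sg^-1.
  by rewrite ler_pdivrMr// mulrC ler_pdivlMr// mulrC.
have q0 : 0 <= n / B by rewrite divr_ge0 ?ltW.
have -> : N = B ^+ 2 * N / B ^+ 2 by field; rewrite gt_eqF.
apply: le_trans (_ : (X * n * (B * C) + P * B * (Y * n) + V * n ^+ 2 * (P * C)) / B ^+ 2 <= _).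
  by rewrite ler_pM2r ?invr_gt0 ?exprn_gt0.
have -> : (X * n * (B * C) + P * B * (Y * n) + V * n ^+ 2 * (P * C)) / B ^+ 2
  = (X * C + P * Y) * (n / B) + V * P * C * ((n / B) * (n / B)).
  by field; rewrite gt_eqF.
have -> : (X * C + P * Y + V / sg * P * C) / sg =
  (X * C + P * Y) * sg^-1 + V * P * C * (sg^-1 * sg^-1).
  by field; rewrite gt_eqF.
apply: lerD; apply: ler_wpM2l => //.
- by rewrite addr_ge0// mulr_ge0.
- by rewrite !mulr_ge0.
- exact: ler_pM.
Qed.

End Combination.

(** * The chain of scales *)
Lemma ltn_doubleS s m : (s < m)%N -> (2 * s + 1 < 2 * m)%N.
Proof. lia. Qed.

Lemma ltn_double2 s m : (s < m)%N -> (2 * s < 2 * m)%N.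
Proof. lia. Qed.

Lemma ltn_double_pred s : (1 <= s)%N -> (2 * s = 2 * s.-1 + 2)%N.
Proof. lia. Qed.

Lemma prod_ge1 (R : realType) (f : nat -> R) m :
  (forall s, (s < m)%N -> 1 <= f s) -> 1 <= \prod_(i < m) f i.
Proof.
elim: m => [|m IH] H; first by rewrite big_ord0.
rewrite big_ord_recr /= mulr_ege1 ?H//.
by apply: IH => s sm; apply: H; exact: ltnW.
Qed.

Lemma c_exponent_itv (R : realType) (a : R) (k : nat) :
  1 < a -> 0 < a ^- k -> a ^- k < 2 - a -> 0 < c_exponent a k < 1.
Proof.
move=> a1 ak0 ak.
have d0 : 0 < 1 - a ^- k by lra.
have h1 : 0 < (a - 1) / (1 - a ^- k) by rewrite divr_gt0//; lra.
have h2 : (a - 1) / (1 - a ^- k) < 1 by rewrite ltr_pdivrMr//; lra.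
by rewrite /c_exponent; apply/andP; split; lra.
Qed.

Section Chain.
Context {R : realType}.
Variables (T1 T2 : R[i] -> R[i]) (S : R -> R).
Hypothesis HS : halfplane_sup T1 T2 S.
Variables (a L M kap eps : R) (k m : nat).
Hypotheses (a1 : 1 < a) (a2 : a < 2) (L0 : 0 < L) (M0 : 0 < M).
Hypotheses (kap0 : 0 < kap) (kap1 : kap < 1) (eps0 : 0 < eps) (eps1 : eps < 1).
Hypotheses (m1 : (1 <= m)%N) (k1 : (1 <= k)%N) (ak : a ^- k < 2 - a).

(** [Y i] is the height a^(j+K-i), [P s] the upper height of the pair reached after
    round [s] (from P 0 = a^(j+K) to P m = a^J), and [dl] the width of window
    given up in each round, so that m + 1 of them leave half of the window. *)
Let Y (i : nat) : R := L * a ^- i.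
Let P (s : nat) : R := 2 / (a + 1) * L + (a - 1) / (a + 1) * Y (2 * s).
Let dl : R := M * L / (2 * m + 2)%:R.
Let q : R := expR (- (pi * M / (2 * m + 2)%:R)).
Let c : R := c_exponent a k.
Let D := cross_diff T1 T2.
Let b : R := - ln eps.
Let sg : R := Num.sqrt kap.

Hypothesis kapc : eps `^ (2 * (1 - c)) <= kap.
Hypothesis Hdiff : forall x i, - (M * L) <= x <= M * L -> (i < 2 * m)%N ->
  [/\ `|normc (T1 (x +i* Y i)) ^+ 2 - normc (T2 (x +i* Y i)) ^+ 2| <= eps * S (Y i) ^+ 2,
      kap * S (Y i) ^+ 2 <= normc (T1 (x +i* Y i)) ^+ 2 &
      kap * S (Y i) ^+ 2 <= normc (T2 (x +i* Y i)) ^+ 2].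

Let a0 : 0 < a. Proof. exact: lt_trans ltr01 a1. Qed.
Let Y0 i : 0 < Y i. Proof. by rewrite mulr_gt0// invr_gt0 exprn_gt0. Qed.
Let YS i : Y i = a * Y i.+1.
Proof. by rewrite /Y exprS invfM [RHS]mulrCA mulVKf// gt_eqF. Qed.
Let Y_0 : Y 0 = L. Proof. by rewrite /Y expr0 invr1 mulr1. Qed.
Let YD i j : Y (i + j) = Y i * a ^- j.
Proof. by rewrite /Y exprD invfM mulrA. Qed.
Let Yle i j : (i <= j)%N -> Y j <= Y i.
Proof.
move=> ij; rewrite -(subnKC ij) YD ler_piMr ?(ltW (Y0 _))//.
by rewrite invf_le1 ?exprn_gt0// exprn_ege1// ltW.
Qed.
Let YL i : Y i <= L. Proof. by rewrite -Y_0 Yle. Qed.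
Let ak0 : 0 < a ^- k. Proof. by rewrite invr_gt0 exprn_gt0. Qed.
Ltac slra := move: a1 a2 a0 L0 M0 ak ak0; lra.
Let sg0 : 0 < sg. Proof. by rewrite sqrtr_gt0. Qed.
Let sgE : sg ^+ 2 = kap. Proof. by rewrite sqr_sqrtr// ltW. Qed.
Let sg1 : sg < 1. Proof. by rewrite -sqrtr1 ltr_sqrt. Qed.
Let b0 : 0 < b. Proof. by rewrite oppr_gt0 ln_lt0// eps0. Qed.
Let epsE : eps = expR (- b). Proof. by rewrite opprK lnK// posrE. Qed.
Let dl0 : 0 < dl. Proof. by rewrite divr_gt0 ?mulr_gt0// ltr0n addn2. Qed.
Let qE : q = expR (- (pi * dl / L)).
Proof.
rewrite /q /dl; congr (expR (- _)).
have : (2 * m + 2)%:R != 0 :> R by rewrite pnatr_eq0 addn2.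
have : L != 0 by rewrite gt_eqF.
by move: (pi : R) (2 * m + 2)%:R => p r *; field; apply/andP.
Qed.
Let q0 : 0 < q. Proof. exact: expR_gt0. Qed.

Let cE : 1 - c = (a - 1) / (1 - a ^- k).
Proof. by rewrite /c /c_exponent; ring. Qed.
Let c01 : 0 < c < 1. Proof. exact: c_exponent_itv. Qed.
Let c_le : c <= 2 - a.
Proof.
have d0 : 0 < 1 - a ^- k by slra.
have : a - 1 <= 1 - c by rewrite cE ler_pdivlMr// ler_piMr; slra.
slra.
Qed.

(** The lower bound on kappa makes the diagonal term of [cross_combination],
    eps / sqrt(kappa), no larger than the other two. *)
Let eps_sg : eps / sg <= expR (- (b * c)).
Proof.
rewrite ler_pdivrMr//.
have : expR (- (b * (1 - c))) <= sg.
  rewrite -[leLHS]ger0_norm ?expR_ge0// -sqrtr_sqr ler_wsqrtr//.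
  apply: le_trans kapc; rewrite /powR gt_eqF// -expRM_natl ler_expR /b.
  by rewrite le_eqVlt; apply/orP; left; apply/eqP; ring.
move=> /(ler_wpM2l (expR_ge0 (- (b * c)))); apply: le_trans.
by rewrite -expRD epsE ler_expR; slra.
Qed.

(** The shift of round [s]: the gap between [P s] and [P s.+1]. *)
Let t (s : nat) : R := (a - 1) ^+ 2 * Y (2 * s + 2).

Let Ye s : Y (2 * s) = a * Y (2 * s + 1). Proof. by rewrite YS addn1. Qed.
Let Yo s : Y (2 * s + 1) = a * Y (2 * s + 2). Proof. by rewrite YS addn1 addn2. Qed.

Let PS s : P s - t s = P s.+1.
Proof.
rewrite /P /t mulnS addnC; have a10 : a + 1 != 0 by rewrite gt_eqF//; slra.
by rewrite addnC Ye Yo; field.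
Qed.

(** The reflection of the height Y (2 s) in Y (2 s + 1), where the modulus is
    known; the shift by [t s] moves it to Y (2 s + 2). *)
Let v (s : nat) : R := 2 * Y (2 * s + 1) - Y (2 * s).

Let vt s : v s + t s = Y (2 * s + 2).
Proof. by rewrite /v /t Ye Yo; ring. Qed.

(** The height of the rectangle used above the diagonal; the choice of k makes it
    large enough for the reflection of Y (2 s), and yields the exponent c. *)
Let w (s : nat) : R := Y (2 * s + 1) - Y (2 * s + 1 + k).

Let wE s : w s = Y (2 * s + 1) * (1 - a ^- k).
Proof. by rewrite /w [Y (2 * s + 1 + k)]YD; ring. Qed.

Let bottom s x : (s < m)%N -> - (M * L) <= x <= M * L ->
  normc (D (Y (2 * s + 1)) (Y (2 * s + 1)) x) <= eps * S (Y (2 * s + 1)) ^+ 2.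
Proof.
move=> sm xM; have [H _ _] := Hdiff xM (ltn_doubleS sm).
apply: le_trans H; rewrite /D /cross_diff.
have bJ (z : R[i]) : z^* * z = (normc z ^+ 2)%:C.
  case: z => x' y; rewrite sqr_normc_ReIm; simpc => /=.
  by rewrite -!expr2 [y * x']mulrC subrr.
by rewrite !bJ -rmorphB normcR.
Qed.

(** The pairs symmetric around an odd scale.  The worst reflection,
    tt = (a - 1) Y (2 s + 1), costs tt / w s = 1 - c, and a window of width 2 dl costs
    4 e^(-2 pi dl / L) = 4 q^2. *)
Let diag s x tt : (s < m)%N -> 0 <= tt <= Y (2 * s) - Y (2 * s + 1) ->
  - (M * L - 2 * dl) <= x <= M * L - 2 * dl ->
  normc (D (Y (2 * s + 1) + tt) (Y (2 * s + 1) - tt) x) <=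
   2 * (S (Y (2 * s)) * S (Y (2 * s + 1 + k))) * expR (- (b * (c - 4 * q ^+ 2))).
Proof.
move=> sm /andP[t0 t1] /andP[x0 x1].
set y := Y (2 * s + 1) in t1 *; have y0 : 0 < y by exact: Y0.
have d0 : 0 < 1 - a ^- k by slra.
have ws : w s = y * (1 - a ^- k) by rewrite wE.
have w0 : 0 < w s by rewrite ws mulr_gt0.
have Ya : Y (2 * s) = a * y by rewrite YS -addn1.
have yw : w s < y by rewrite ws gtr_pMr//; slra.
have tw : (a - 1) * y <= w s by rewrite ws mulrC ler_pM2l//; slra.
have yL : Y (2 * s) <= L by exact: YL.
have wk : w s = y - Y (2 * s + 1 + k) by [].
have k0 := Y0 (2 * s + 1 + k).
have h1 : 0 < w s < y by rewrite w0.
have h2 : w s < L by apply: lt_le_trans yw (YL _).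
have h3 : 0 <= tt <= w s.
  by rewrite t0; apply: le_trans tw; rewrite mulrBl mul1r -Ya.
have h4 : tt <= L - w s.
  by apply: le_trans t1 _; rewrite wk; move: yL k0; lra.
have h5 : 0 <= 2 * dl by rewrite mulr_ge0// ltW.
have := @cross_diff_from_diagonal R T1 T2 S HS y (w s) L (2 * dl) tt x eps b
  h1 h2 h3 h4 h5 (ltW b0) epsE.
move=> /(_ _)/le_trans; apply.
  by move=> x' /andP[x'0 x'1]; apply: bottom => //; apply/andP; split; slra.
have -> : y - w s = Y (2 * s + 1 + k) by rewrite wk; ring.
apply: ler_pM; rewrite ?expR_ge0//.
- by rewrite !mulr_ge0// (sup_ge0 HS)//; slra.
- rewrite ler_pM2l// ler_wpM2r// ?(sup_ge0 HS)//.
  by apply: (sup_nonincreasing HS) => //; slra.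
rewrite ler_expR lerN2 ler_pM2l// lerB//.
  have -> : c = 1 - (a - 1) * y / w s.
    have -> : c = 1 - (a - 1) / (1 - a ^- k) by rewrite -cE; ring.
    rewrite ws; move: (1 - a ^- k) d0 => d' d0'.
    by field; rewrite !gt_eqF.
  by rewrite lerD2l lerN2 ler_pM2r ?invr_gt0//; slra.
rewrite ler_pM2l// qE -expRM_natl ler_expR.
by rewrite le_eqVlt; apply/orP; left; apply/eqP; ring.
Qed.

Let r (s : nat) : R := S (Y (2 * s + 1 + k)) / S (Y (2 * s + 2)).
(** The exponent after round [s].  The losses of the shifts are proportional to
    t s = P s - P s.+1, hence telescope. *)
Let alpha (s : nat) : R := c - 4 * q ^+ 2 - 72 * c * q * ((P 1 - P s) / L).

Let P_lower s : 2 / (a + 1) * L <= P s.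
Proof. by rewrite lerDl mulr_ge0 ?(ltW (Y0 _))// divr_ge0; slra. Qed.

Let P_noninc s : P s.+1 <= P s.
Proof. by rewrite -PS gerBl mulr_ge0 ?sqr_ge0 ?(ltW (Y0 _)). Qed.

Let P_le s s' : (s <= s')%N -> P s' <= P s.
Proof.
elim: s' => [|s' IH]; first by rewrite leqn0 => /eqP ->.
rewrite leq_eqVlt => /predU1P[->//|/IH].
by apply: le_trans; exact: P_noninc.
Qed.

Let P_1 : P 1 = 2 * Y 1 - Y 2.
Proof.
have a10 : a + 1 != 0 by rewrite gt_eqF//; slra.
have e : L = a * (a * Y 2) by rewrite -Y_0 [LHS]YS [Y 1]YS.
by rewrite /P muln1 [Y 1]YS [in LHS]e; field.
Qed.

Let P_0 : P 0 = L.
Proof.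
have a10 : a + 1 != 0 by rewrite gt_eqF//; slra.
by rewrite /P muln0 Y_0; field.
Qed.

Let P_upper s : P s <= L. Proof. by rewrite -P_0 P_le. Qed.
Let P_gt0 s : 0 < P s.
Proof. by apply: lt_le_trans (P_lower s); rewrite mulr_gt0// divr_gt0//; slra. Qed.

Let Y2_le_P s : Y 2 <= P s.
Proof.
apply: le_trans (P_lower s).
have -> : 2 / (a + 1) * L = 2 * a ^+ 2 / (a + 1) * Y 2.
  have e : L = a * (a * Y 2) by rewrite -Y_0 [LHS]YS [Y 1]YS.
  by rewrite {1}e; ring.
rewrite ler_peMl ?(ltW (Y0 _))// ler_pdivlMr; last by slra.
by move: a1; nra.
Qed.

Let Y_le_P s : Y (2 * s + 2) <= P s.
Proof. by apply: le_trans (Y2_le_P s); apply: Yle; rewrite leq_addl. Qed.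

Let alpha_mono s s' : (s <= s')%N -> alpha s' <= alpha s.
Proof.
move=> ss; rewrite /alpha lerD2l lerN2 ler_wpM2l//.
  by rewrite !mulr_ge0// ?(ltW q0)//; case/andP: c01 => /ltW.
by rewrite ler_pM2r ?invr_gt0// lerD2l lerN2 P_le.
Qed.

Let alpha_le_c s : (1 <= s)%N -> alpha s <= c - 4 * q ^+ 2.
Proof. by move=> /alpha_mono/le_trans; apply; rewrite /alpha subrr mul0r mulr0 subr0. Qed.

(** The upper heights vary by at most (a - 1) / ((a + 1) a^2) L, and c <= 2 - a, so the
    total loss of the shifts is at most 4 q because
    18 (2 - a) (a - 1) <= (a + 1) a^2. *)
Let alpha_lower s : c - 4 * q ^+ 2 - 4 * q <= alpha s.
Proof.
rewrite /alpha lerD2l lerN2.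
have a10 : 0 < a + 1 by slra.
have h1 : (P 1 - P s) / L <= (a - 1) / (a + 1) / a ^+ 2.
  have -> : (a - 1) / (a + 1) / a ^+ 2 = (P 1 - 2 / (a + 1) * L) / L.
    rewrite /P muln1 /Y; field.
    by apply/and3P; split; rewrite gt_eqF.
  by rewrite ler_pM2r ?invr_gt0// lerD2l lerN2.
have h2 : 18 * c * ((a - 1) / (a + 1) / a ^+ 2) <= 1.
  have -> : 18 * c * ((a - 1) / (a + 1) / a ^+ 2) = 18 * c * (a - 1) / ((a + 1) * a ^+ 2).
    by field; apply/andP; split; rewrite gt_eqF.
  rewrite ler_pdivrMr ?mul1r; last by rewrite mulr_gt0// exprn_gt0.
  apply: le_trans (_ : 18 * (2 - a) * (a - 1) <= _).
    by move: c_le a1; nra.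
  (* With x = a - 1 the difference is x^3 + (22 x^2 - 13 x + 2), and the
     quadratic has negative discriminant. *)
  have : 0 <= (a - 1) ^+ 3 by rewrite exprn_ge0// subr_ge0 ltW.
  have := sqr_ge0 (44 * a - 57); lra.
have c0 : 0 <= c by case/andP: c01 => /ltW.
apply: le_trans (_ : 72 * c * q * ((a - 1) / (a + 1) / a ^+ 2) <= _).
  by rewrite ler_wpM2l// !mulr_ge0// ltW.
by move: (_ / a ^+ 2) h2 q0 => z; nra.
Qed.

Section Positive.
(** The three assumptions of this part exclude the degenerate cases, in which the
    final bound follows from [cross_diff_bound]; see [chain_bound]. *)
Hypothesis Spos : forall s, (s < m)%N -> 0 < S (Y (2 * s + 2)).
Hypothesis alpha0 : 0 <= alpha m.
Hypothesis wide : 3 / 2 <= pi * dl / L.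

Let r_ge1 s : (s < m)%N -> 1 <= r s.
Proof.
move=> sm; rewrite ler_pdivlMr ?Spos// mul1r.
by apply: (sup_nonincreasing HS) => //; apply: Yle; rewrite -addnA leq_add2l add1n ltnS.
Qed.

(** Round 1: the pair (P 1, Y 2) is symmetric around Y 1. *)
Let base x : - (M * L - 2 * dl) <= x <= M * L - 2 * dl ->
  normc (D (P 1) (Y 2) x) <= 2 * r 0 * (S (P 1) * S (Y 2)) * expR (- (b * alpha 1)).
Proof.
move=> xM.
have e0 : Y 0 = a * (a * Y 2) by rewrite [LHS]YS [Y 1]YS.
have e1 : Y 1 = a * Y 2 by rewrite [LHS]YS.
have y2 := Y0 2.
have h : 0 <= Y 1 - Y 2 <= Y (2 * 0) - Y (2 * 0 + 1).
  have g0 : 0 <= (a - 1) * Y 2 by rewrite mulr_ge0 ?(ltW y2)// subr_ge0 ltW.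
  have g1 : 0 <= (a - 1) ^+ 2 * Y 2 by rewrite mulr_ge0 ?(ltW y2)// sqr_ge0.
  by rewrite muln0 add0n e0 e1; apply/andP; split; lra.
have := @diag 0 x (Y 1 - Y 2) m1 h xM; rewrite muln0 !add0n.
have -> : Y 1 + (Y 1 - Y 2) = P 1 by rewrite P_1; ring.
have -> : Y 1 - (Y 1 - Y 2) = Y 2 by ring.
move=> /le_trans; apply.
have -> : alpha 1 = c - 4 * q ^+ 2 by rewrite /alpha subrr mul0r mulr0 subr0.
rewrite ler_pM2r ?expR_gt0//.
have -> : 2 * r 0 * (S (P 1) * S (Y 2)) = 2 * (S (P 1) * S (Y (1 + k))).
  by rewrite /r muln0 !add0n; field; rewrite gt_eqF// (Spos (s := 0)).
rewrite ler_pM2l// ler_wpM2r ?(sup_ge0 HS)//.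
by apply: (sup_nonincreasing HS) => //; rewrite Y_0 P_upper.
Qed.

(** Compose the pair (P s, Y (2 s)) with its reflection (Y (2 s), v s), then shift
    the resulting pair (P s, v s) by [t s].  In the factor (e + 3), the e is inherited,
    2 comes from [diag] and 1 from the diagonal at Y (2 s). *)
Let step s x (e : R) : (1 <= s)%N -> (s < m)%N -> 0 <= e ->
  (forall x', x - dl <= x' <= x + dl ->
     normc (D (P s) (Y (2 * s)) x') <=
       e * (S (P s) * S (Y (2 * s))) * expR (- (b * alpha s))) ->
  - (M * L - s.+2%:R * dl) <= x <= M * L - s.+2%:R * dl ->
  normc (D (P s.+1) (Y (2 * s.+1)) x) <=
   (e + 3) / sg * r s * (S (P s.+1) * S (Y (2 * s.+1))) * expR (- (b * alpha s.+1)).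
Proof.
move=> s1 sm e0 IH xM.
set y := Y (2 * s + 1); set n := Y (2 * s); set yk := Y (2 * s + 1 + k).
have y0 : 0 < y by exact: Y0.
have yk0 : 0 < yk by exact: Y0.
have ny : n = a * y by exact: Ye.
have ykE : yk = y * a ^- k by exact: YD.
have Sn : 0 < S n.
  have -> : n = Y (2 * s.-1 + 2) by rewrite /n -ltn_double_pred.
  by apply: Spos; apply: leq_ltn_trans sm; exact: leq_pred.
have vE : v s = y - (n - y) by rewrite /v -/y -/n; ring.
have v_yk : yk <= v s by rewrite vE ny ykE; move: ak y0; nra.
have v0 : 0 < v s by exact: lt_le_trans v_yk.
have Sk0 : 0 <= S yk by exact: (sup_ge0 HS).
have SP0 : 0 <= S (P s) by exact: (sup_ge0 HS).
have Svk : S (v s) <= S yk by exact: (sup_nonincreasing HS).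
have alpha_s : 0 <= alpha s by apply: le_trans alpha0 _; exact/alpha_mono/ltnW.
have t0 : 0 < t s by rewrite /t mulr_gt0// exprn_gt0//; slra.
have ls : s.+2%:R = s%:R + 2 :> R by rewrite -addn2 natrD.
have sge1 : 1 <= s%:R :> R by rewrite ler1n.
have near x' : x - dl <= x' <= x + dl ->
    normc (D (P s) (v s) x') <= (e + 3) / sg * (S (P s) * S yk) * expR (- (b * alpha s)).
  move=> xx'.
  have x'M : - (M * L - 2 * dl) <= x' <= M * L - 2 * dl.
    by move: xM xx' dl0; rewrite ls => /andP[? ?] /andP[? ?] ?; apply/andP; split; nra.
  have x'L : - (M * L) <= x' <= M * L.
    by move: x'M dl0 => /andP[? ?] ?; apply/andP; split; lra.
  have [hd h1 h2] := Hdiff x'L (ltn_double2 sm); rewrite -/n in hd h1 h2.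
  have low T : kap * S n ^+ 2 <= normc (T (x' +i* n) : R[i]) ^+ 2 -> sg * S n <= normc (T (x' +i* n)).
    by rewrite -sgE -exprMn ler_pXn2r// nnegrE ?normc_ge0// mulr_ge0// ltW.
  have Hd := @diag s x' (n - y) sm ltac:(move: a1 y0; rewrite -/n -/y ny; nra) x'M.
  have [_ _ HSb _] := HS.
  have bP := HSb (x' +i* P s) (P_gt0 s); have bv := HSb (x' +i* v s) v0.
  have ea : expR (- (b * (c - 4 * q ^+ 2))) <= expR (- (b * alpha s)).
    by rewrite ler_expR lerN2 ler_pM2l// alpha_le_c.
  have := @cross_combination R (T1 (x' +i* P s)) (T2 (x' +i* P s))
    (T1 (x' +i* n)) (T2 (x' +i* n)) (T1 (x' +i* v s)) (T2 (x' +i* v s))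
    (e * S (P s) * expR (- (b * alpha s))) (2 * S yk * expR (- (b * alpha s))) eps sg (S n) (S (P s)) (S yk)
    sg0 Sn SP0 Sk0 (low _ h1) (low _ h2) bP.1 bP.2 (le_trans bv.1 Svk) (le_trans bv.2 Svk).
  move=> /(_ _ _ _)/le_trans H; apply: H => //.
  - by apply: le_trans (IH _ xx') _; rewrite -/n le_eqVlt; apply/orP; left; apply/eqP; ring.
  - have := Hd; rewrite -/y -/n -vE (_ : y + (n - y) = n) /D; last by ring.
    move=> /le_trans; apply; rewrite -/yk.
    have -> : 2 * S yk * expR (- (b * alpha s)) * S n = 2 * (S n * S yk) * expR (- (b * alpha s)) by ring.
    by rewrite ler_wpM2l// !mulr_ge0// ltW.
  have es : eps / sg <= expR (- (b * alpha s)).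
    apply: le_trans eps_sg _; rewrite ler_expR lerN2 ler_pM2l//.
    by apply: le_trans (alpha_le_c s1) _; rewrite gerBl mulr_ge0// sqr_ge0.
  have -> : (e + 3) / sg * (S (P s) * S yk) * expR (- (b * alpha s)) =
     (e * S (P s) * expR (- (b * alpha s)) * S yk +
      S (P s) * (2 * S yk * expR (- (b * alpha s))) +
      expR (- (b * alpha s)) * S (P s) * S yk) / sg by ring.
  rewrite ler_pM2r ?invr_gt0// lerD2l.
  by rewrite ler_wpM2r// ler_wpM2r.
have vP : v s <= P s by apply: le_trans (Y_le_P s); rewrite -vt lerDl ltW.
have t_le : 0 <= t s <= P s - v s.
  rewrite (ltW t0) /= lerBrDl vt; exact: Y_le_P.
have e3 : 2 <= (e + 3) / sg.
  rewrite ler_pdivlMr//; move: sg1 sg0 e0; lra.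
have := @cross_diff_transport R T1 T2 S HS (P s) (v s) (P s - v s) L dl (t s) x (b * alpha s)
  ((e + 3) / sg * (S (P s) * S yk)) v0 vP erefl _ t_le L0 _ wide _ near.
rewrite PS vt; move=> /(_ _ _ _)/le_trans H.
rewrite mulnS addnC; apply: H.
- by move: (P_upper s) v0; lra.
- by rewrite mulr_ge0 ?(ltW b0).
- apply: ler_pM => //; first by rewrite mulr_ge0 ?(sup_ge0 HS).
  by rewrite ler_wpM2l.
have SP1 : S (P s) <= S (P s.+1) by apply: (sup_nonincreasing HS).
have Sy2 : 0 < S (Y (2 * s + 2)) by exact: Spos.
have rS : r s * S (Y (2 * s + 2)) = S yk by rewrite /r divfK// gt_eqF.
have e30 : 0 <= (e + 3) / sg by apply: le_trans e3.
apply: ler_pM; rewrite ?expR_ge0//.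
- by rewrite mulr_ge0// mulr_ge0.
- have -> : (e + 3) / sg * r s * (S (P s.+1) * S (Y (2 * s + 2))) =
     (e + 3) / sg * (S (P s.+1) * S yk) by rewrite -rS; ring.
  by rewrite ler_wpM2l// ler_wpM2r.
rewrite ler_expR lerN2 -mulrA ler_pM2l// -qE.
have tL : 0 <= t s / L by rewrite divr_ge0 ?ltW.
have -> : alpha s.+1 = alpha s - 72 * c * q * (t s / L).
  by rewrite /alpha -(PS s); ring.
have ac : alpha s <= c.
  by apply: le_trans (alpha_le_c s1) _; rewrite gerBl mulr_ge0// sqr_ge0.
have : alpha s * (q * (t s / L)) <= c * (q * (t s / L)).
  by rewrite ler_wpM2r// mulr_ge0// ltW.
lra.
Qed.

(** The coefficient (1 - sg^s) / ((1 - sg) sg^s) solves f' = (f + 1) / sg with f = 0 at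
    s = 0; the factors r s >= 1 absorb the constant 3. *)
Let chain s : (1 <= s <= m)%N -> forall x,
  - (M * L - s.+1%:R * dl) <= x <= M * L - s.+1%:R * dl ->
  normc (D (P s) (Y (2 * s)) x) <=
    3 * (\prod_(i < s) r i) * ((1 - sg ^+ s) / ((1 - sg) * sg ^+ s)) *
    (S (P s) * S (Y (2 * s))) * expR (- (b * alpha s)).
Proof.
have sg1' : 0 < 1 - sg by rewrite subr_gt0.
have S0 y : 0 < y -> 0 <= S y by exact: (sup_ge0 HS).
have fac_ge0 s' : 0 <= (1 - sg ^+ s') / ((1 - sg) * sg ^+ s').
  rewrite divr_ge0 ?mulr_ge0 ?exprn_ge0 ?(ltW sg0) ?(ltW sg1')//.
  by rewrite subr_ge0 exprn_ile1 ?(ltW sg0) ?(ltW sg1).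
elim: s => [//|s IH] /andP[_ sm] x xM.
have [s0|s0] := posnP s.
  subst s; rewrite muln1; apply: le_trans (base xM) _.
  rewrite ler_pM2r ?expR_gt0// ler_wpM2r ?mulr_ge0 ?S0//.
  rewrite big_ord_recr big_ord0 /= mul1r.
  have r0 : 0 <= r 0 by rewrite (le_trans ler01)// r_ge1.
  have : 1 <= (1 - sg ^+ 1) / ((1 - sg) * sg ^+ 1).
    by rewrite ler_pdivlMr ?mulr_gt0// mul1r expr1 ler_piMr ?(ltW sg1')// ltW.
  by move: r0; nra.
set pr := \prod_(i < s) r i.
have pr1 : 1 <= pr.
  by apply: prod_ge1 => i si; apply: r_ge1; apply: ltn_trans sm.
set f := (1 - sg ^+ s) / ((1 - sg) * sg ^+ s).
have f0 : 0 <= f by exact: fac_ge0.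
have := @step s x (3 * pr * f) s0 sm.
move=> /(_ _ _ xM)/le_trans H; apply: H.
- by rewrite mulr_ge0// mulr_ge0// (le_trans ler01).
- move=> x' /andP[x'0 x'1]; apply: IH; first by rewrite s0 ltnW.
  move: xM; have -> : s.+2%:R = s.+1%:R + 1 :> R by rewrite -addn1 natrD.
  by move=> /andP[? ?]; apply/andP; split; lra.
rewrite ler_pM2r ?expR_gt0// ler_wpM2r ?mulr_ge0 ?S0//.
rewrite big_ord_recr /= -/pr.
have rs : 0 <= r s by rewrite (le_trans ler01)// r_ge1.
have -> : 3 * (pr * r s) * ((1 - sg ^+ s.+1) / ((1 - sg) * sg ^+ s.+1)) =
   (3 * pr * (f + 1)) / sg * r s.
  rewrite /f; have sn : sg ^+ s != 0 by rewrite expf_neq0// gt_eqF.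
  rewrite exprS; field; apply/and3P; split=> //; by rewrite gt_eqF.
rewrite ler_wpM2r// ler_pM2r ?invr_gt0//; move: pr1; lra.
Qed.

Lemma chain_conclusion x : - (M * L / 2) <= x <= M * L / 2 ->
  normc (D (P m) (Y (2 * m)) x) <=
    6 / (1 - sg) * (\prod_(i < m) r i) / sg ^+ m *
    (S (P m) * S (Y (2 * m))) * expR (- (b * alpha m)).
Proof.
have sg1' : 0 < 1 - sg by rewrite subr_gt0.
move=> xM; have := @chain m _ x; rewrite m1 leqnn => /(_ isT).
have -> : M * L - m.+1%:R * dl = M * L / 2.
  rewrite /dl; have -> : (2 * m + 2)%:R = 2 * m.+1%:R :> R by rewrite -natrM mulnS addnC.
  have : m.+1%:R != 0 :> R by rewrite pnatr_eq0.
  by move: (m.+1%:R) => u u0; field.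
move=> /(_ xM)/le_trans; apply.
rewrite ler_pM2r ?expR_gt0// ler_wpM2r ?mulr_ge0 ?(sup_ge0 HS)//.
have pr1 : 1 <= \prod_(i < m) r i by apply: prod_ge1; exact: r_ge1.
have -> : 3 * \prod_(i < m) r i * ((1 - sg ^+ m) / ((1 - sg) * sg ^+ m)) =
   (\prod_(i < m) r i) / (1 - sg) / sg ^+ m * (3 * (1 - sg ^+ m)).
  by field; rewrite expf_neq0 ?gt_eqF.
have -> : 6 / (1 - sg) * \prod_(i < m) r i / sg ^+ m =
   (\prod_(i < m) r i) / (1 - sg) / sg ^+ m * 6 by ring.
rewrite ler_wpM2l//.
  rewrite !divr_ge0 ?exprn_ge0 ?(ltW sg0) ?(ltW sg1')//.
  exact: le_trans pr1.
by have := exprn_ge0 m (ltW sg0); lra.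
Qed.

End Positive.

(** If d is nonpositive then eps^d >= 1 and the general bound 2 S S suffices.
    Otherwise d > 0 and c < 1 force q < 1/5, whence pi dl / L >= 3/2, the width
    which the two-line estimate needs. *)
Theorem chain_bound x : - (M * L / 2) <= x <= M * L / 2 ->
  normc (D (P m) (Y (2 * m)) x) <=
    6 / (1 - sg) * (\prod_(i < m) r i) / sg ^+ m *
    (S (P m) * S (Y (2 * m))) * eps `^ (d_exponent a k (2 * m) M).
Proof.
move=> xM.
have sg1' : 0 < 1 - sg by rewrite subr_gt0.
have S0 y : 0 < y -> 0 <= S y by exact: (sup_ge0 HS).
have pr0 : 0 <= \prod_(i < m) r i.
  apply: prodr_ge0 => i _; apply: divr_ge0; exact: (sup_ge0 HS).
have C0 : 0 <= 6 / (1 - sg) * (\prod_(i < m) r i) / sg ^+ m.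
  by rewrite divr_ge0 ?exprn_ge0 ?(ltW sg0)// mulr_ge0// divr_ge0// ltW.
have Y_m : Y (2 * m) <= P m.
  by apply: le_trans (Y2_le_P m); apply: Yle; rewrite leq_pmulr.
have Dle : normc (D (P m) (Y (2 * m)) x) <= 2 * (S (P m) * S (Y (2 * m))).
  have := @cross_diff_bound R T1 T2 S HS (P m) (Y (2 * m)) x 0 (Y0 _) Y_m.
  by rewrite subr0 addr0; apply; rewrite lexx subr_ge0.
have S2 : 0 <= S (P m) * S (Y (2 * m)) by rewrite mulr_ge0// S0.
have [Spos|] := pselect (forall s, (s < m)%N -> 0 < S (Y (2 * s + 2))); last first.
  (* A zero of S at some Y (2 s + 2) kills S at the greater height P m by
     monotonicity, and both sides of the inequality vanish. *)
  move=> nS; suff SP : S (P m) = 0.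
    by apply: le_trans Dle _; rewrite SP !(mul0r, mulr0).
  apply/eqP; rewrite eq_le S0// andbT leNgt; apply/negP => SP; apply: nS => s sm.
  apply: lt_le_trans SP _; apply: (sup_nonincreasing HS) => //.
  by apply: le_trans (Y2_le_P m); apply: Yle; rewrite leq_addl.
have r_ge1 s : (s < m)%N -> 1 <= r s.
  move=> sm; rewrite ler_pdivlMr ?Spos// mul1r.
  by apply: (sup_nonincreasing HS) => //; apply: Yle; rewrite -addnA leq_add2l add1n ltnS.
have pr1 : 1 <= \prod_(i < m) r i.
  exact: prod_ge1.
set d := d_exponent a k (2 * m) M.
have epsd : eps `^ d = expR (- (b * d)).
  by rewrite /powR gt_eqF// /b; congr expR; ring.
have dE : d = c - 4 * (q / (1 - q)) by [].
have q1 : q < 1.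
  rewrite -[ltRHS]expR0 ltr_expR oppr_lt0; apply: divr_gt0; first by rewrite mulr_gt0 ?pi_gt0.
  by rewrite addn2 ltr0n.
have [d0|d0] := leP d 0.
  apply: le_trans Dle _; rewrite [leRHS]mulrAC.
  apply: ler_wpM2r => //.
  have e1 : 1 <= eps `^ d.
    by rewrite epsd -expR0 ler_expR oppr_ge0 pmulr_rle0.
  have f1 : 6 <= 6 / (1 - sg) by rewrite ler_pdivlMr// ler_piMr// gerBl ltW.
  have f2 : 1 <= (sg ^+ m)^-1.
    by rewrite invf_ge1 ?exprn_gt0// exprn_ile1// ltW.
  have f3 : 6 <= 6 / (1 - sg) * \prod_(i < m) r i.
    by apply: (le_trans f1); rewrite ler_peMr// divr_ge0// ltW.
  have f4 : 6 <= 6 / (1 - sg) * \prod_(i < m) r i / sg ^+ m.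
    by apply: (le_trans f3); rewrite ler_peMr//; apply: (le_trans _ f3).
  have f5 : 6 <= 6 / (1 - sg) * \prod_(i < m) r i / sg ^+ m * eps `^ d.
    by apply: (le_trans f4); rewrite ler_peMr//; apply: (le_trans _ f4).
  by apply: (le_trans _ f5); rewrite ler_nat.
have q1' : 0 < 1 - q by rewrite subr_gt0.
have qq : 4 * q + 4 * q ^+ 2 <= 4 * (q / (1 - q)).
  rewrite mulrA ler_pdivlMr//; have := exprn_ge0 3 (ltW q0); lra.
have ad : d <= alpha m by apply: le_trans (alpha_lower m); rewrite dE; lra.
have q5 : q < 1 / 5.
  have : q / (1 - q) < 1 / 4.
    by have /andP[_ c1] := c01; move: d0; rewrite dE; lra.
  by rewrite ltr_pdivrMr//; lra.
have wide : 3 / 2 <= pi * dl / L.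
  rewrite leNgt; apply/negP => H.
  have : expR (- (3 / 2)) < q by rewrite qE ltr_expR ltrN2.
  have : 1 / 5 <= expR (- (3 / 2)) :> R.
    rewrite expRN div1r lef_pV2 ?posrE ?expR_gt0//; exact: expR_3half_le5.
  by move=> h1 h2; have := lt_trans (le_lt_trans h1 h2) q5; rewrite ltxx.
have := @chain_conclusion Spos (le_trans (ltW d0) ad) wide x xM.
move=> /le_trans; apply.
by rewrite epsd; apply: ler_wpM2l; [rewrite mulr_ge0|rewrite ler_expR lerN2 ler_pM2l].
Qed.

End Chain.

(** * Integrals of real and complex functions *)
Section RealIntegrals.
Context {R : realType}.
Local Notation mu := (@lebesgue_measure R).
Local Notation integ f := (mu.-integrable [set: R] (EFin \o f)).
Implicit Types (f g k : R -> R).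

Lemma integ_ext f g : f =1 g -> integ f -> integ g.
Proof. by move=> /funext ->. Qed.

Lemma integ_measurable f : integ f -> measurable_fun [set: R] f.
Proof. by move=> /measurable_int/measurable_EFinP. Qed.

Lemma integ_dom f k : measurable_fun [set: R] f -> integ k ->
  (forall x, `|f x| <= k x) -> integ f.
Proof.
move=> mf ik fk; apply: (le_integrable _ _ _ ik) => //.
  exact/measurable_EFinP.
by move=> x _ /=; rewrite lee_fin (le_trans (fk x))// ler_norm.
Qed.

Lemma integZ f (C : R) : integ f -> integ (fun x => C * f x).
Proof.
by move=> fi; have := integrableZl measurableT C fi; apply: eq_integrable.
Qed.

Lemma integD f g : integ f -> integ g -> integ (fun x => f x + g x).
Proof.
by move=> fi gi; have := integrableD measurableT fi gi; apply: eq_integrable.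
Qed.

(** The integrable majorant against which all decay is measured. *)
Definition lorentz (x : R) : R := (oneDsqr x)^-1.

Lemma lorentz_ge0 x : 0 <= lorentz x.
Proof. by rewrite invr_ge0 (le_trans _ (oneDsqr_ge1 x)). Qed.

Lemma lorentz_le1 x : lorentz x <= 1.
Proof. exact: oneDsqrV_le1. Qed.

Lemma measurable_lorentz : measurable_fun [set: R] lorentz.
Proof. by apply: continuous_measurable_fun; exact: continuous_oneDsqrV. Qed.

Lemma integ_lorentz : integ lorentz.
Proof.
apply/integrableP; split; first by apply/measurable_EFinP; exact: measurable_lorentz.
under eq_integral do rewrite /= ger0_norm ?lorentz_ge0//.
rewrite ge0_symfun_integralT.
- by rewrite -set_itvcy integral0y_oneDsqr -EFinM ltry.
- exact: lorentz_ge0.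
- exact: continuous_oneDsqrV.
- by move=> x /=; rewrite /lorentz /oneDsqr sqrrN.
Qed.

Lemma Lfun2_intro f k : measurable_fun [set: R] f -> integ k ->
  (forall x, f x ^+ 2 <= k x) -> f \in Lfun mu 2%:E.
Proof.
move=> mf ik fk.
have i2 : integ (fun x => f x ^+ 2).
  by apply: integ_dom ik _ => [|x]; [exact: measurable_funX|rewrite ger0_norm ?sqr_ge0].
rewrite inE; apply/andP; split; rewrite inE//= /finite_norm unlock.
apply: poweR_lty; case/integrableP: i2 => _; apply: le_lt_trans.
rewrite le_eqVlt; apply/orP; left; apply/eqP; apply: eq_integral => x _ /=.
by rewrite powR_mulrn// normrX.
Qed.

Lemma Lfun2_measurable f : f \in Lfun mu 2%:E -> measurable_fun [set: R] f.
Proof. by rewrite inE => /andP[/[!inE]]. Qed.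

Lemma integ_mul f g : f \in Lfun mu 2%:E -> g \in Lfun mu 2%:E -> integ (fun x => f x * g x).
Proof. by move=> f2 g2; apply/Lfun1_integrable; exact: Lfun2_mul_Lfun1. Qed.

(** Uniqueness of the Lebesgue measure, for the push-forward by a translation. *)
Lemma integral_shift f (h : R) : integ f ->
  integ (fun x => f (x + h)) /\ \int[mu]_x f (x + h) = \int[mu]_x f x.
Proof.
move=> fi.
pose phi (x : measurableTypeR R) : measurableTypeR R := x + h.
have mphi : measurable_fun [set: measurableTypeR R] phi by exact: measurable_funD.
pose nu := measure_function_pushforward__canonical__measure_function_Measure mu mphi.
have E : forall A, measurable A -> mu A = nu A.
  apply: lebesgue_measure_unique => X [[a b]] _ <- /=.
  rewrite /pushforward.
  have -> : phi @^-1` `]a, b]%classic = `]a - h, b - h]%classic.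
    by apply/seteqP; split => x /=; rewrite /phi !in_itv/= ltrBlDr lerBrDr.
  rewrite !lebesgue_measure_itv /= !lte_fin ltrD2r -!EFinB.
  by case: ifP => // _; congr (_%:E); ring.
have mf := integ_measurable fi.
have fhi : integ (fun x => f (x + h)).
  apply/integrableP; split.
    by apply/measurable_EFinP; exact: (measurableT_comp mf mphi).
  case/integrableP : fi => _; apply: le_lt_trans.
  rewrite [leRHS](eq_measure_integral nu); last by move=> A mA _; exact: E.
  rewrite ge0_integral_pushforward//.
  by apply: measurableT_comp => //; exact/measurable_EFinP.
split => //; rewrite /Rintegral; congr fine.
rewrite [RHS](eq_measure_integral nu); last by move=> A mA _; exact: E.
rewrite integral_pushforward //=.
exact/measurable_EFinP.
Qed.

End RealIntegrals.

Section ComplexIntegrals.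
Context {R : realType}.
Local Notation mu := (@lebesgue_measure R).
Local Notation integ f := (mu.-integrable [set: R] (EFin \o f)).
Implicit Types (k : R -> R).

Definition cmeasurable d (T : measurableType d) (h : T -> R[i]) : Prop :=
  measurable_fun [set: T] (fun x => Re (h x)) /\ measurable_fun [set: T] (fun x => Im (h x)).

Section Measurability.
Context d (T : measurableType d).
Implicit Types (g h : T -> R[i]).

Lemma cmeasurableM g h : cmeasurable g -> cmeasurable h -> cmeasurable (fun x => g x * h x).
Proof.
move=> [g1 g2] [h1 h2]; split.
  rewrite [X in measurable_fun _ X](_ : _ = fun x => Re (g x) * Re (h x) - Im (g x) * Im (h x)).
    by apply: measurable_funB; apply: measurable_funM.
  by apply/funext => x; case: (g x) (h x) => a b [c e].
rewrite [X in measurable_fun _ X](_ : _ = fun x => Re (g x) * Im (h x) + Im (g x) * Re (h x)).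
  by apply: measurable_funD; apply: measurable_funM.
by apply/funext => x; case: (g x) (h x) => a b [c e].
Qed.

Lemma cmeasurableD g h : cmeasurable g -> cmeasurable h -> cmeasurable (fun x => g x + h x).
Proof.
move=> [g1 g2] [h1 h2]; split.
  rewrite [X in measurable_fun _ X](_ : _ = fun x => Re (g x) + Re (h x)).
    exact: measurable_funD.
  by apply/funext => x; rewrite raddfD.
rewrite [X in measurable_fun _ X](_ : _ = fun x => Im (g x) + Im (h x)).
  exact: measurable_funD.
by apply/funext => x; rewrite raddfD.
Qed.

Lemma cmeasurable_cst (A : R[i]) : cmeasurable (fun _ : T => A).
Proof. by split; exact: measurable_cst. Qed.

Lemma cmeasurableB g h : cmeasurable g -> cmeasurable h -> cmeasurable (fun x => g x - h x).
Proof.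
move=> mg mh; have := cmeasurableD mg (cmeasurableM (cmeasurable_cst (-1)) mh).
by under eq_fun do rewrite mulN1r.
Qed.

Lemma cmeasurableR (f : T -> R) : measurable_fun [set: T] f -> cmeasurable (fun x => (f x)%:C).
Proof. by move=> mf; split => //=; exact: measurable_cst. Qed.

Lemma cmeasurable_cexpi (f : T -> R) : measurable_fun [set: T] f -> cmeasurable (fun x => cexpi (f x)).
Proof.
move=> mf; split => /=.
  by apply: measurableT_comp mf; apply: continuous_measurable_fun; exact: continuous_cos.
by apply: measurableT_comp mf; apply: continuous_measurable_fun; exact: continuous_sin.
Qed.

Lemma measurable_normc h : cmeasurable h -> measurable_fun [set: T] (fun x => normc (h x)).
Proof.
move=> [h1 h2].
rewrite [X in measurable_fun _ X](_ : _ = fun x => Num.sqrt (Re (h x) ^+ 2 + Im (h x) ^+ 2)).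
  apply: (measurableT_comp (f := @Num.sqrt R)).
    by apply: continuous_measurable_fun; exact: sqrt_continuous.
  by apply: measurable_funD; apply: measurable_funX.
by apply/funext => x; case: (h x).
Qed.

End Measurability.

Definition cintegrable (h : R -> R[i]) : Prop :=
  integ (fun x => Re (h x)) /\ integ (fun x => Im (h x)).

Lemma cintegrable_measurable h : cintegrable h -> cmeasurable h.
Proof. by case=> h1 h2; split; exact: integ_measurable. Qed.

Lemma cintegrable_dom h k : cmeasurable h -> integ k -> (forall x, normc (h x) <= k x) ->
  cintegrable h.
Proof.
move=> [h1 h2] ik hk; split; apply: integ_dom ik _ => // x; apply: le_trans (hk x).
  exact: ler_Re_normc.
exact: ler_Im_normc.
Qed.

Lemma integ_normc h : cintegrable h -> integ (fun x => normc (h x)).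
Proof.
move=> hi; have [h1 h2] := hi.
have k : integ (fun x => `|Re (h x)| + `|Im (h x)|).
  by apply: integD; exact: integrable_norm.
apply: integ_dom k _; first exact/measurable_normc/cintegrable_measurable.
by move=> x; rewrite ger0_norm ?normc_ge0// ler_normc_ReIm.
Qed.

Lemma cintegralD g h : cintegrable g -> cintegrable h ->
  cintegral (fun x => g x + h x) = cintegral g + cintegral h.
Proof.
move=> [g1 g2] [h1 h2]; rewrite /cintegral; simpc; congr (_ +i* _).
  by rewrite -RintegralD//; apply: eq_Rintegral => x _; rewrite raddfD.
by rewrite -RintegralD//; apply: eq_Rintegral => x _; rewrite raddfD.
Qed.

Lemma cintegrableD g h : cintegrable g -> cintegrable h -> cintegrable (fun x => g x + h x).
Proof.
move=> [g1 g2] [h1 h2]; split.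
  by apply: integ_ext (integD g1 h1) => x; rewrite raddfD.
by apply: integ_ext (integD g2 h2) => x; rewrite raddfD.
Qed.

Lemma cintegralZ (A : R[i]) h : cintegrable h ->
  cintegral (fun x => A * h x) = A * cintegral h.
Proof.
move=> [h1 h2]; case: A => a b; rewrite /cintegral; simpc; congr (_ +i* _).
  rewrite -!RintegralZl// -RintegralB//; [|exact: integZ..].
  by apply: eq_Rintegral => x _; case: (h x).
rewrite -!RintegralZl// -RintegralD//; [|exact: integZ..].
by apply: eq_Rintegral => x _; case: (h x) => c e /=; ring.
Qed.

Lemma cintegrableZ (A : R[i]) h : cintegrable h -> cintegrable (fun x => A * h x).
Proof.
move=> [h1 h2]; case: A => a b; split.
  apply: integ_ext (integD (integZ a h1) (integZ (- b) h2)) => x.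
  by case: (h x) => c e /=; rewrite mulNr.
by apply: integ_ext (integD (integZ a h2) (integZ b h1)) => x; case: (h x).
Qed.

Lemma cintegralB g h : cintegrable g -> cintegrable h ->
  cintegral (fun x => g x - h x) = cintegral g - cintegral h.
Proof.
move=> gi hi; rewrite -[- cintegral h]mulN1r -cintegralZ// -cintegralD//.
  by congr cintegral; apply/funext => x; rewrite mulN1r.
exact: cintegrableZ.
Qed.

Lemma cintegrableB g h : cintegrable g -> cintegrable h -> cintegrable (fun x => g x - h x).
Proof.
move=> gi hi; have := cintegrableD gi (cintegrableZ (-1) hi).
by under eq_fun do rewrite mulN1r.
Qed.

(** Real and imaginary parts are estimated separately; the resulting factor 2 is
    harmless here, since only orders of magnitude matter. *)
Lemma normc_cintegral_le h k : cintegrable h -> integ k -> (forall x, normc (h x) <= k x) ->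
  normc (cintegral h) <= 2 * \int[mu]_x k x.
Proof.
move=> [h1 h2] ik hk; apply: le_trans (ler_normc_ReIm _) _.
rewrite mulr_natl mulr2n /cintegral /=; apply: lerD.
  apply: le_trans (le_normr_Rintegral _ _) _ => //.
  apply: le_Rintegral => //; first exact: integrable_norm.
  by move=> x _; apply: le_trans (hk x); exact: ler_Re_normc.
apply: le_trans (le_normr_Rintegral _ _) _ => //.
apply: le_Rintegral => //; first exact: integrable_norm.
by move=> x _; apply: le_trans (hk x); exact: ler_Im_normc.
Qed.

End ComplexIntegrals.

(** * The Laplace transform on the upper half-plane *)
Section LaplaceTransform.
Context {R : realType}.
Local Notation mu := (@lebesgue_measure R).
Local Notation integ f := (mu.-integrable [set: R] (EFin \o f)).
Implicit Types (F : R -> R[i]) (p w x y lam : R) (z v : R[i]).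

Lemma powR_le_expR p lam : 0 <= p -> 0 < lam ->
  exists2 C : R, 0 <= C & forall w, 0 < w -> w `^ p <= C * expR (lam * w).
Proof.
move=> p0 lam0.
have [n pn] : exists n : nat, p < n%:R by exists (Num.bound p); exact: archi_boundP.
have f0 : 0 < n.+1`!%:R :> R by rewrite ltr0n fact_gt0.
have l0 : 0 <= n.+1`!%:R / lam ^+ n.+1 by rewrite divr_ge0 ?exprn_ge0 ?ltW.
exists (1 + n.+1`!%:R / lam ^+ n.+1); first by rewrite addr_ge0.
move=> w w0.
have e1 : 1 <= expR (lam * w) by rewrite -expR0 ler_expR mulr_ge0 ?ltW.
have [w1|w1] := leP w 1.
  apply: le_trans (_ : 1 * 1 <= _).
    rewrite mul1r; have := ge0_ler_powR p0 (_ : w \in Num.nneg) (_ : 1 \in Num.nneg) w1.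
    by rewrite powR1; apply; rewrite nnegrE ?ltW.
  by apply: ler_pM => //; rewrite lerDl.
apply: le_trans (_ : w ^+ n.+1 <= _).
  rewrite -powR_mulrn ?(ltW w0)//; apply: ler_powR; first exact: ltW.
  by rewrite (le_trans (ltW pn))// ler_nat.
have := expR_ge1Dxn n (ltW (mulr_gt0 lam0 w0)); rewrite exprMn.
move: (n.+1`!%:R : R) f0 l0 => f f0 l0 H.
have H2 : lam ^+ n.+1 * w ^+ n.+1 / f <= expR (lam * w) by apply: le_trans H; rewrite lerDr.
rewrite mulrDl mul1r; apply: le_trans (_ : f / lam ^+ n.+1 * expR (lam * w) <= _).
  have -> : w ^+ n.+1 = f / lam ^+ n.+1 * (lam ^+ n.+1 * w ^+ n.+1 / f).
    by field; rewrite expf_neq0 ?gt_eqF//=.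
  by rewrite ler_wpM2l.
by rewrite lerDr expR_ge0.
Qed.

(** The kernel w_+^p of the Laplace transform. *)
Definition pospow p w : R := if 0 < w then w `^ p else 0.

Lemma pospow_ge0 p w : 0 <= pospow p w.
Proof. by rewrite /pospow; case: ifP => // _; exact: powR_ge0. Qed.

Lemma measurable_pospow p : measurable_fun [set: R] (pospow p).
Proof.
apply: measurable_fun_ifT; [|exact: measurable_powR|exact: measurable_cst].
by apply: measurable_fun_ltr; [exact: measurable_cst|exact: measurable_id].
Qed.

Lemma measurable_expRN lam : measurable_fun [set: R] (fun w => expR (- (lam * w))).
Proof.
apply: continuous_measurable_fun => w.
apply: (continuous_comp (f := fun w => - (lam * w))); last exact: continuous_expR.
by apply: cvgN; apply: cvgM; [exact: cvg_cst|exact: cvg_id].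
Qed.

Lemma pospow_decay p lam : 0 <= p -> 0 < lam ->
  exists2 C : R, 0 <= C & forall w, pospow p w * expR (- (lam * w)) <= C * lorentz w.
Proof.
move=> p0 lam0; have [C C0 HC] := powR_le_expR p0 lam0.
have [D D0 HD] := powR_le_expR (addr_ge0 p0 (ler0n R 2)) lam0.
exists (C + D); first exact: addr_ge0.
move=> w; rewrite /pospow; case: ifP => [w0|_]; last by rewrite mul0r mulr_ge0 ?lorentz_ge0 ?addr_ge0.
have e0 := expR_gt0 (lam * w).
rewrite expRN /lorentz ler_pdivlMr ?(lt_le_trans _ (oneDsqr_ge1 w))//.
rewrite mulrAC ler_pdivrMr// /oneDsqr mulrDr mulr1 mulrDl; apply: lerD; first exact: HC.
rewrite -powR_mulrn ?(ltW w0)// -powRD ?HD//.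
by apply/implyP => _; rewrite gt_eqF.
Qed.

(** The functions [F] whose Laplace transform of weight w_+^p converges absolutely on
    the upper half-plane; besides L^2 they include the constant 1, which gives the
    wavelet itself. *)
Definition laplace_admissible p F : Prop := cmeasurable F /\
  forall lam, 0 < lam -> integ (fun w => normc (F w) * (pospow p w * expR (- (lam * w)))).

Lemma measurable_pospow_expR p lam : measurable_fun [set: R] (fun w => pospow p w * expR (- (lam * w))).
Proof. by apply: measurable_funM; [exact: measurable_pospow|exact: measurable_expRN]. Qed.

Lemma pospow_expR_ge0 p lam w : 0 <= pospow p w * expR (- (lam * w)).
Proof. by rewrite mulr_ge0 ?pospow_ge0 ?expR_ge0. Qed.

Lemma integ_pospow p lam : 0 <= p -> 0 < lam -> integ (fun w => pospow p w * expR (- (lam * w))).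
Proof.
move=> p0 lam0; have [C C0 HC] := pospow_decay p0 lam0.
apply: integ_dom (integZ C integ_lorentz) _ => [|w]; first exact: measurable_pospow_expR.
by rewrite ger0_norm ?pospow_expR_ge0.
Qed.

Lemma Lfun2_pospow p lam : 0 <= p -> 0 < lam ->
  (fun w => pospow p w * expR (- (lam * w))) \in Lfun mu 2%:E.
Proof.
move=> p0 lam0; have [C C0 HC] := pospow_decay p0 lam0.
apply: (Lfun2_intro _ (integZ (C ^+ 2) integ_lorentz)); first exact: measurable_pospow_expR.
move=> w; apply: le_trans (_ : (C * lorentz w) ^+ 2 <= _).
  by apply: lerXn2r; rewrite ?nnegrE ?pospow_expR_ge0 ?mulr_ge0 ?lorentz_ge0.
by rewrite exprMn ler_wpM2l ?sqr_ge0// expr2 ler_piMl ?lorentz_ge0 ?lorentz_le1.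
Qed.

Lemma cLfun2_measurable F : cLfun 2%:E F -> cmeasurable F.
Proof. by move=> [F1 F2]; split; [exact: Lfun2_measurable F1|exact: Lfun2_measurable F2]. Qed.

Lemma cLfun2_normc F : cLfun 2%:E F -> (fun w => normc (F w)) \in Lfun mu 2%:E.
Proof.
move=> HF; have [F1 F2] := HF.
apply: (Lfun2_intro _ (integD (Lfun2_integrable_sqr F1) (Lfun2_integrable_sqr F2))).
  exact/measurable_normc/cLfun2_measurable.
by move=> w; rewrite sqr_normc_ReIm.
Qed.

Lemma laplace_admissible_L2 p F : 0 <= p -> cLfun 2%:E F -> laplace_admissible p F.
Proof.
move=> p0 HF; split; first exact: cLfun2_measurable.
by move=> lam lam0; apply: integ_mul; [exact: cLfun2_normc|exact: Lfun2_pospow].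
Qed.

Lemma laplace_admissible_cst p : 0 <= p -> laplace_admissible p (fun=> 1).
Proof.
move=> p0; split; first exact: cmeasurable_cst.
move=> lam lam0; apply: integ_ext (integ_pospow p0 lam0) => w.
by rewrite normc1 mul1r.
Qed.

(** For n = 0 the integrand of the Laplace transform; for n = 1, 2, up to powers of
    [i], those of its derivatives, and n = 3 bounds the remainder. *)
Definition kern F p (n : nat) z w : R[i] :=
  F w * (pospow p w * w ^+ n)%:C * cexp ('i * w%:C * z).

Definition laplace F p z : R[i] := cintegral (kern F p 0 z).

Lemma Re_iw z w : Re ('i * w%:C * z) = - (w * Im z).
Proof. by case: z => a b /=; ring. Qed.

Lemma Im_iw z w : Im ('i * w%:C * z) = w * Re z.
Proof. by case: z => a b /=; ring. Qed.

Lemma normc_kern F p n z w : normc (kern F p n z w) =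
  normc (F w) * (pospow p w * (w ^+ n * expR (- (w * Im z)))).
Proof.
rewrite normcM normc_cexp normcM Re_iw normcR normrM (ger0_norm (pospow_ge0 _ _)) normrX -mulrA -mulrA.
by rewrite /pospow; case: ifP => [w0|_]; rewrite ?mul0r// gtr0_norm.
Qed.

(** A power of [w] is absorbed by half of the exponential decay. *)
Lemma kern_dom p n y : 0 < y -> exists2 C : R, 0 <= C & forall F z w, y <= Im z ->
  normc (kern F p n z w) <= C * (normc (F w) * (pospow p w * expR (- (y / 2 * w)))).
Proof.
move=> y0; have y2 : 0 < y / 2 by rewrite divr_gt0.
have [C C0 HC] := powR_le_expR (ler0n R n) y2; exists C => // F z w yz.
rewrite normc_kern [leRHS]mulrCA ler_wpM2l ?normc_ge0// /pospow.
case: ifP => [w0|_]; last by rewrite !mul0r mulr0.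
rewrite [leRHS]mulrCA ler_wpM2l ?powR_ge0//.
apply: le_trans (_ : C * expR (y / 2 * w) * expR (- (w * y)) <= _).
  apply: ler_pM; rewrite ?expR_ge0 ?exprn_ge0 ?(ltW w0)//.
    by rewrite -powR_mulrn ?(ltW w0)// HC.
  by rewrite ler_expR lerN2 ler_pM2l.
rewrite -mulrA -expRD ler_wpM2l// ler_expR.
by rewrite le_eqVlt; apply/orP; left; apply/eqP; field.
Qed.

Lemma cmeasurable_kern F p n z : cmeasurable F -> cmeasurable (kern F p n z).
Proof.
move=> mF; apply: cmeasurableM; first apply: cmeasurableM => //.
  apply: cmeasurableR; apply: measurable_funM; first exact: measurable_pospow.
  by apply: measurable_funX; exact: measurable_id.
have -> : (fun w => cexp ('i * w%:C * z)) =
    (fun w => (expR (- (Im z * w)))%:C * cexpi (w * Re z)).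
  by apply/funext => w; rewrite /cexp Re_iw Im_iw [w * Im z]mulrC.
apply: cmeasurableM; first by apply: cmeasurableR; exact: measurable_expRN.
by apply: cmeasurable_cexpi; apply: measurable_funM.
Qed.

Lemma cintegrable_kern F p n z : laplace_admissible p F -> 0 < Im z -> cintegrable (kern F p n z).
Proof.
move=> [mF iF] z0; have [C C0 HC] := kern_dom p n z0.
have z2 : 0 < Im z / 2 by rewrite divr_gt0.
apply: cintegrable_dom (integZ C (iF _ z2)) _; first exact: cmeasurable_kern.
by move=> w; exact: HC.
Qed.

Lemma laplace_bounded F p y : laplace_admissible p F -> 0 < y ->
  exists C : R, forall z, y <= Im z -> normc (laplace F p z) <= C.
Proof.
move=> dF y0; have [C C0 HC] := kern_dom p 0 y0.
have y2 : 0 < y / 2 by rewrite divr_gt0.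
eexists => z yz; apply: (normc_cintegral_le _ (integZ C (dF.2 _ y2))).
  by apply: cintegrable_kern => //; exact: lt_le_trans yz.
by move=> w; exact: HC.
Qed.

(** Integrate the second order expansion of e^(i w v) in [v].  By [cexp_taylor] its
    remainder is bounded by |w v|^3 e^(w |v|), so it is dominated by [kern] with n = 3
    on the line lowered by |v|. *)
Lemma jet2_laplace F p z : laplace_admissible p F -> 0 < Im z -> jet2 (laplace F p) z.
Proof.
move=> dF z0.
pose y := Im z; have y2 : 0 < y / 2 by rewrite divr_gt0.
have [C C0 HC] := @cexp_taylor R.
have [D D0 HD] := kern_dom p 3 y2.
pose k w := normc (F w) * (pospow p w * expR (- (y / 2 / 2 * w))).
have ik : integ k by apply: dF.2; rewrite divr_gt0.
pose h : R[i] := ((2 : R)%:C)^-1.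
exists ('i * cintegral (kern F p 1 z)), ('i ^+ 2 * h * cintegral (kern F p 2 z)).
apply: (@bigO_intro _ _ _ (2 * (C * D * \int[mu]_x k x)) (y / 2)) => // v vy.
have yv : y / 2 <= Im (z + v).
  have := ler_Im_normc v; rewrite ler_norml raddfD /= -/y => /andP[v1 _].
  by rewrite /y in vy v1 *; lra.
have zv0 : 0 < Im (z + v) by exact: lt_le_trans yv.
have i0 := cintegrable_kern 0 dF z0; have i1 := cintegrable_kern 1 dF z0.
have i2 := cintegrable_kern 2 dF z0; have iv := cintegrable_kern 0 dF zv0.
have e1 := cintegrableZ ('i * v) i1; have e2 := cintegrableZ ('i ^+ 2 * h * v ^+ 2) i2.
have e0 := cintegrableB iv i0; have e01 := cintegrableB e0 e1.
have -> : laplace F p (z + v) - laplace F p z - 'i * cintegral (kern F p 1 z) * v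
   - 'i ^+ 2 * h * cintegral (kern F p 2 z) * v ^+ 2 =
   cintegral (fun w => kern F p 0 (z + v) w - kern F p 0 z w - 'i * v * kern F p 1 z w
      - 'i ^+ 2 * h * v ^+ 2 * kern F p 2 z w).
  rewrite (cintegralB e01 e2) (cintegralB e0 e1) (cintegralB iv i0) !cintegralZ//.
  by rewrite /laplace; ring.
have -> : 2 * (C * D * \int[mu]_x k x) * normc v ^+ 3 =
   2 * \int[mu]_x (C * D * normc v ^+ 3 * k x).
  by rewrite RintegralZl//; ring.
apply: normc_cintegral_le; [exact: cintegrableB|exact: integZ|].
move=> w.
pose u := 'i * w%:C * v.
have -> : kern F p 0 (z + v) w - kern F p 0 z w - 'i * v * kern F p 1 z w
      - 'i ^+ 2 * h * v ^+ 2 * kern F p 2 z w =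
   kern F p 0 z w * (cexp u - 1 - u - u ^+ 2 / (2 : R)%:C).
  rewrite /kern mulrDr cexpD -/u /u -/h !rmorphM /= !rmorphXn /=; ring.
rewrite normcM; apply: le_trans (ler_wpM2l (normc_ge0 _) (HC u)) _.
have nu : normc u = `|w| * normc v.
  by rewrite !normcM normcR /= expr0n /= add0r expr1n sqrtr1 mul1r.
(* The point [z] lowered by |v| <= Im z / 2. *)
pose z' := z - 'i * (normc v)%:C.
have z'E : Im z' = y - normc v by rewrite /z' /y; case: (z) => a b /=; ring.
have yv' : y / 2 <= y - normc v by rewrite /y in vy *; lra.
move: (HD F z' w); rewrite z'E => /(_ yv') {}HD.
move: HD; rewrite !normc_kern z'E expr0 mul1r nu exprMn -/k => H.
have [w0|w0] := leP w 0.
  have pw0 : pospow p w = 0 by rewrite /pospow ltNge w0.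
  rewrite pw0 !(mul0r, mulr0); apply: mulr_ge0; last first.
    by apply: mulr_ge0; [exact: normc_ge0|exact: pospow_expR_ge0].
  by apply: mulr_ge0; [exact: mulr_ge0|apply: exprn_ge0; exact: normc_ge0].
rewrite (gtr0_norm w0).
have E : expR (- (w * (y - normc v))) = expR (- (w * y)) * expR (w * normc v).
  by rewrite -expRD; congr expR; ring.
rewrite E in H.
have -> : normc (F w) * (pospow p w * expR (- (w * Im z))) *
    (C * (w ^+ 3 * normc v ^+ 3) * expR (w * normc v)) =
  C * normc v ^+ 3 * (normc (F w) * (pospow p w * (w ^+ 3 * (expR (- (w * y)) * expR (w * normc v))))).
  by rewrite /y; ring.
apply: le_trans (ler_wpM2l _ H) _; first by rewrite mulr_ge0// exprn_ge0 ?normc_ge0.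
by rewrite le_eqVlt; apply/orP; left; apply/eqP; rewrite /k; ring.
Qed.

End LaplaceTransform.

(** * Fubini and Hoelder for dominated integrands *)
Section Fubini.
Context {R : realType}.
Local Notation mu := (@lebesgue_measure R).
Local Notation integ f := (mu.-integrable [set: R] (EFin \o f)).

Lemma integral_EFin (f : R -> R) : integ f ->
  (\int[mu]_x (f x)%:E)%E = (\int[mu]_x f x)%:E.
Proof. by move=> fi; rewrite /Rintegral fineK//; exact: integrable_fin_num fi. Qed.

Lemma real_fubini (f : R * R -> R) (u v : R -> R) :
  measurable_fun [set: R * R] f -> integ u -> integ v ->
  (forall y w, `|f (y, w)| <= u y * v w) ->
  integ (fun w => \int[mu]_y f (y, w)) /\
  \int[mu]_y \int[mu]_w f (y, w) = \int[mu]_w \int[mu]_y f (y, w).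
Proof.
move=> mf iu iv fuv.
have mfE : measurable_fun [set: R * R] (EFin \o f) by exact/measurable_EFinP.
have s1 y : integ (fun w => f (y, w)).
  apply: integ_dom (integZ (u y) iv) _ => //.
  exact: (measurable_fun_pair2 y mf).
have s2 w : integ (fun y => f (y, w)).
  apply: integ_dom (integZ (v w) iu) _ => [|y]; last by rewrite mulrC.
  exact: (measurable_fun_pair1 w mf).
have iE : (mu \x mu)%E.-integrable [set: R * R] (EFin \o f).
  apply/integrable12ltyP => //.
  apply: (@le_lt_trans _ _ (\int[mu]_y (u y * \int[mu]_w v w)%:E)%E).
    apply: ge0_le_integral => //.
    - by move=> y _; exact: integral_ge0.
    - have mabs : measurable_fun [set: R * R] (fun x => `|(f x)%:E|%E).
        exact: measurableT_comp.
      exact: (@measurable_fun_fubini_tonelli_F _ _ _ _ R mu _ mabs (fun=> abse_ge0 _)).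
    - by apply/measurable_EFinP; apply: measurable_funM => //; exact: integ_measurable.
    move=> y _; apply: (@le_trans _ _ (\int[mu]_w (u y * v w)%:E)%E).
      apply: ge0_le_integral => //.
      - by apply/measurable_EFinP; apply: measurableT_comp => //; exact: integ_measurable.
      - by apply/measurable_EFinP; apply: measurable_funM => //; exact: integ_measurable.
      - by move=> w _ /=; rewrite lee_fin.
    by rewrite integral_EFin ?lee_fin ?RintegralZl//; exact: integZ.
  rewrite integral_EFin ?ltry//.
  by apply: integ_ext (integZ (\int[mu]_w v w) iu) => y; rewrite mulrC.
have i2 : integ (fun w => \int[mu]_y f (y, w)).
  apply: integ_dom (integZ (\int[mu]_y u y) iv) _ => [|w].
    have := measurable_fubini_G iE => H; apply/measurable_EFinP; move: H.
    by congr (measurable_fun _ _); apply/funext => w; rewrite /fubini_G /= integral_EFin.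
  apply: le_trans (le_normr_Rintegral measurableT (s2 w)) _.
  rewrite -RintegralZr//; apply: le_Rintegral => //; first exact: integrable_norm (s2 w).
  by apply: integ_ext (integZ (v w) iu) => y; rewrite mulrC.
have i1 : integ (fun y => \int[mu]_w f (y, w)).
  have := integrable_fubini_F iE; apply: eq_integrable => // y _.
  by rewrite /fubini_F /= integral_EFin.
split; first exact: i2.
apply: EFin_inj; rewrite -!integral_EFin//.
transitivity (\int[mu]_y \int[mu]_w (EFin \o f) (y, w))%E.
  by apply: eq_integral => y _ /=; rewrite integral_EFin.
rewrite Fubini//.
by apply: eq_integral => w _ /=; rewrite integral_EFin.
Qed.

Lemma complex_fubini (h : R * R -> R[i]) (u v : R -> R) :
  cmeasurable h -> integ u -> integ v ->
  (forall y w, normc (h (y, w)) <= u y * v w) ->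
  cintegrable (fun w => cintegral (fun y => h (y, w))) /\
  cintegral (fun y => cintegral (fun w => h (y, w))) =
  cintegral (fun w => cintegral (fun y => h (y, w))).
Proof.
move=> [m1 m2] iu iv huv.
have [i1 e1] := real_fubini m1 iu iv (fun y w => le_trans (ler_Re_normc _) (huv y w)).
have [i2 e2] := real_fubini m2 iu iv (fun y w => le_trans (ler_Im_normc _) (huv y w)).
split; first by split; [exact: i1|exact: i2].
by rewrite /cintegral; congr (_ +i* _); [exact: e1|exact: e2].
Qed.

Lemma l2_product_bound (u k : R -> R) (e K : R) :
  measurable_fun [set: R] u -> measurable_fun [set: R] k ->
  integ (fun x => u x * k x) -> (forall x, 0 <= u x) -> (forall x, 0 <= k x) ->
  ('N[mu]_2%:E[EFin \o u] <= e%:E)%E -> ('N[mu]_2%:E[EFin \o k] <= K%:E)%E ->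
  \int[mu]_x (u x * k x) <= e * K.
Proof.
move=> mm mk iuk u0 k0 ue kK.
rewrite -lee_fin -integral_EFin//.
have e2 : 2^-1 + 2^-1 = 1 :> R by rewrite [RHS]splitr !div1r.
have H := @hoelder _ _ _ mu u k 2 2 mm mk (ltr0n _ 2) (ltr0n _ 2) e2.
apply: (@le_trans _ _ ('N[mu]_1[EFin \o (u \* k)%R])%E).
  rewrite Lnorm1 le_eqVlt; apply/orP; left; apply/eqP; apply: eq_integral => x _ /=.
  by rewrite ger0_norm// mulr_ge0.
apply: le_trans H _.
by rewrite EFinM; apply: lee_pmul => //; exact: Lnorm_ge0.
Qed.

End Fubini.

(** * Decay of the Cauchy wavelet *)
Section WaveletDecay.
Context {R : realType}.
Local Notation mu := (@lebesgue_measure R).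
Local Notation integ f := (mu.-integrable [set: R] (EFin \o f)).
Variables (p A : R).
Hypotheses (p0 : 0 <= p) (A0 : 0 < A).

Let G (w : R) : R := pospow p w * expR (- (A * w)).

(** Up to a constant factor the Cauchy wavelet at scale [A]; in closed form
    it is Gamma(p + 1) (A - i x)^(- p - 1). *)
Definition gamma_kernel (x : R) : R[i] := laplace (fun=> 1) p (x +i* A).

Lemma kern_line (F : R -> R[i]) x w : kern F p 0 (x +i* A) w = F w * (G w)%:C * cexpi (w * x).
Proof.
rewrite /kern expr0 mulr1 /cexp Re_iw Im_iw /= /G [w * A]mulrC rmorphM.
by rewrite !mulrA.
Qed.

Lemma gamma_kernelE x : gamma_kernel x = cintegral (fun w => (G w)%:C * cexpi (w * x)).
Proof.
by rewrite /gamma_kernel /laplace; congr cintegral; apply/funext => w; rewrite kern_line mul1r.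
Qed.

Let G0 w : 0 <= G w. Proof. exact: pospow_expR_ge0. Qed.
Let iG : integ G. Proof. exact: integ_pospow. Qed.
Let mG : measurable_fun [set: R] G. Proof. exact: measurable_pospow_expR. Qed.

Let cG x : cintegrable (fun w => (G w)%:C * cexpi (w * x)).
Proof.
have := cintegrable_kern 0 (laplace_admissible_cst p0) (A0 : 0 < Im (x +i* A)).
by congr cintegrable; apply/funext => w; rewrite kern_line mul1r.
Qed.

(** w^p increases and e^(-A w) decreases by a factor of at least 1 - A h; this
    replaces an estimate of the derivative of G, which is unbounded near 0 for p < 1. *)
Let G_drop h w : 0 <= h -> G w - G (w + h) <= A * h * G w.
Proof.
move=> h0; rewrite /G /pospow; case: ifP => [w0|_]; last first.
  by rewrite !mul0r mulr0 sub0r oppr_le0 pospow_expR_ge0.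
rewrite (ltr_wpDr h0 w0).
have pw : w `^ p <= (w + h) `^ p.
  by apply: ge0_ler_powR; rewrite ?nnegrE ?(ltW w0)// ?addr_ge0 ?(ltW w0)// lerDl.
have e : expR (- (A * w)) * (1 - A * h) <= expR (- (A * (w + h))).
  rewrite [A * (w + h)]mulrDr opprD expRD ler_pM2l ?expR_gt0//.
  by have := expR_ge1Dx (- (A * h)).
have w0' := powR_ge0 w p; have e0 := expR_ge0 (- (A * (w + h))).
have h1 : w `^ p * expR (- (A * (w + h))) <= (w + h) `^ p * expR (- (A * (w + h))).
  by rewrite ler_wpM2r.
have h2 : w `^ p * (expR (- (A * w)) * (1 - A * h)) <= w `^ p * expR (- (A * (w + h))).
  by rewrite ler_wpM2l.
lra.
Qed.

(** A shift by h = pi / |x| changes the sign of e^(i w x), so twice the kernel is the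
    Fourier integral of G(w) - G(w + h).  By [G_drop] the positive part of this
    difference is at most A h G(w), and its integral is 0, so that its L^1 norm is
    O(h) = O(1 / |x|).  This makes the kernel square integrable. *)
Lemma gamma_kernel_decay : exists2 C : R, 0 <= C &
  forall x, normc (gamma_kernel x) ^+ 2 <= C * lorentz x.
Proof.
pose I := \int[mu]_w G w.
have I0 : 0 <= I by apply: Rintegral_ge0.
have bound x : normc (gamma_kernel x) <= 2 * I.
  rewrite gamma_kernelE; apply: normc_cintegral_le => //.
  by move=> w; rewrite normcM normc_cexpi normcR mulr1 ger0_norm.
have decay x : `|x| * normc (gamma_kernel x) <= 2 * A * pi * I.
  have [->|x0] := eqVneq x 0.
    by rewrite normr0 mul0r !mulr_ge0 ?pi_ge0// ltW.
  have nx : 0 < `|x| by rewrite normr_gt0.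
  pose h := pi / `|x|.
  have h0 : 0 <= h by rewrite divr_ge0 ?pi_ge0.
  have half w : cexpi ((w + h) * x) = - cexpi (w * x).
    rewrite mulrDl cexpiD (_ : cexpi (h * x) = -1) ?mulrN1// /h /cexpi.
    have [xp|xn] := leP 0 x.
      rewrite ger0_norm// divfK ?gt_eqF// ?cospi ?sinpi; last by rewrite lt_neqAle eq_sym x0.
      by apply/eqP; rewrite eq_complex /= oppr0 !eqxx.
    rewrite ltr0_norm// invrN mulrN mulNr divfK ?lt_eqF// cosN sinN cospi sinpi.
    by apply/eqP; rewrite eq_complex /= oppr0 !eqxx.
  have [iGh eGh] := integral_shift h iG.
  have [cs1 cs2] := cG x.
  have [i1 e1] := integral_shift h cs1; have [i2 e2] := integral_shift h cs2.
  have ci : cintegrable (fun w => (G (w + h))%:C * cexpi ((w + h) * x)) by [].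
  have shift : gamma_kernel x = cintegral (fun w => (G (w + h))%:C * cexpi ((w + h) * x)).
    by rewrite gamma_kernelE /cintegral e1 e2.
  have two : (2 : R)%:C * gamma_kernel x =
      cintegral (fun w => ((G w - G (w + h)))%:C * cexpi (w * x)).
    rewrite (_ : (2 : R)%:C * _ = gamma_kernel x + gamma_kernel x); last first.
      by rewrite -[(2 : R)]/(1 + 1) rmorphD rmorph1; ring.
    rewrite {1}gamma_kernelE shift -cintegralD//; congr cintegral.
    by apply/funext => w; rewrite half rmorphB; ring.
  pose k w := G (w + h) + (- 1) * G w + 2 * (A * h) * G w.
  have ik : integ k by do ![apply: integD]; rewrite ?iGh//; exact: integZ.
  have : normc ((2 : R)%:C * gamma_kernel x) <= 2 * \int[mu]_w k w.
    rewrite two; apply: normc_cintegral_le => //.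
      have := cintegrableD (cG x) ci; congr cintegrable.
      by apply/funext => w; rewrite half rmorphB; ring.
    move=> w; rewrite normcM normc_cexpi mulr1 normcR /k.
    have := G_drop w h0; have := G0 w; have := G0 (w + h).
    have Ah : 0 <= A * h by rewrite mulr_ge0// ltW.
    have := mulr_ge0 Ah (G0 w).
    by case: (ger0P (G w - G (w + h))); lra.
  have -> : \int[mu]_w k w = 2 * (A * h) * I.
    rewrite /k RintegralD//; [|apply: integD => //; exact: integZ|exact: integZ].
    rewrite RintegralD//; last exact: integZ.
    rewrite !RintegralZl// eGh /I; ring.
  rewrite normcM normcR ger0_norm// ler_pM2l// => H.
  apply: le_trans (ler_wpM2l (ltW nx) H) _.
  have -> : `|x| * (2 * (A * h) * I) = 2 * A * (`|x| * h) * I by ring.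
  by rewrite /h mulrC [`|x| * _]mulrC divfK ?gt_eqF// mulrC.
exists ((2 * I) ^+ 2 + (2 * A * pi * I) ^+ 2); first by rewrite addr_ge0 ?sqr_ge0.
move=> x; rewrite /lorentz ler_pdivlMr ?(lt_le_trans _ (oneDsqr_ge1 x))//.
rewrite /oneDsqr mulrDr mulr1; apply: lerD.
  by apply: lerXn2r; rewrite ?nnegrE ?normc_ge0 ?mulr_ge0.
have -> : normc (gamma_kernel x) ^+ 2 * x ^+ 2 = (`|x| * normc (gamma_kernel x)) ^+ 2.
  by rewrite exprMn real_normK ?num_real// mulrC.
apply: lerXn2r; rewrite ?nnegrE ?mulr_ge0 ?normc_ge0 ?pi_ge0//; exact: ltW.
Qed.

Lemma cmeasurable_gamma_kernel : cmeasurable gamma_kernel.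
Proof.
have J x : jet2 (laplace (fun=> 1) p) (x +i* A) by apply: jet2_laplace => //; exact: laplace_admissible_cst.
have cpair (x : R) : {for x, continuous (fun x : R => (x, A))}.
  by apply: (@cvg_pair _ _ _ (nbhs x) (nbhs x) (nbhs A)); [exact: cvg_id|exact: cvg_cst].
split; apply: continuous_measurable_fun => x.
  exact: (continuous_comp (cpair x) (jet2_continuous (p := (x, A)) (J x)).1).
exact: (continuous_comp (cpair x) (jet2_continuous (p := (x, A)) (J x)).2).
Qed.

End WaveletDecay.

(** * Convolution with the Cauchy wavelet *)
Section ConvolutionTheorem.
Context {R : realType}.
Local Notation mu := (@lebesgue_measure R).
Local Notation integ f := (mu.-integrable [set: R] (EFin \o f)).
Implicit Types (f g F : R -> R[i]).

Lemma cLfun1_cintegrable g : cLfun 1%:E g -> cintegrable g.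
Proof. by move=> [/Lfun1_integrable g1 /Lfun1_integrable g2]. Qed.

Lemma measurable_Mr (c : R) : measurable_fun [set: R] (fun w => w * c).
Proof. by apply: continuous_measurable_fun => w; apply: cvgM; [exact: cvg_id|exact: cvg_cst]. Qed.

Lemma measurable_NMl (c : R) : measurable_fun [set: R] (fun w => - (c * w)).
Proof.
apply: continuous_measurable_fun => w.
by apply: cvgN; apply: cvgM; [exact: cvg_cst|exact: cvg_id].
Qed.

Lemma measurable_reflect (c : R) : measurable_fun [set: R] (fun w => c - w).
Proof. by apply: continuous_measurable_fun => w; apply: cvgB; [exact: cvg_cst|exact: cvg_id]. Qed.

Lemma measurable_phase (x : R) : measurable_fun [set: R * R] (fun q : R * R => q.2 * (x - q.1)).
Proof.
apply: measurable_funM; first exact: measurable_snd.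
by apply: measurable_funB; [exact: measurable_cst|exact: measurable_fst].
Qed.

Lemma cmeasurable_comp_fst g : cmeasurable g -> cmeasurable (fun q : R * R => g q.1).
Proof.
move=> [g1 g2]; split.
  exact: (measurableT_comp g1 measurable_fst).
exact: (measurableT_comp g2 measurable_fst).
Qed.

(** Parseval for an integrable function: Fubini applied to
    g(y) k(w) e^(i w (x - y)). *)
Lemma fourier_weighted g (k : R -> R) x : cintegrable g -> integ k -> (forall w, 0 <= k w) ->
  cintegrable (fun w => (k w)%:C * cexpi (w * x) * fourier g w) /\
  cintegral (fun y => g y * cintegral (fun w => (k w)%:C * cexpi (w * (x - y)))) =
  cintegral (fun w => (k w)%:C * cexpi (w * x) * fourier g w).
Proof.
move=> ig ik k0.
pose h (q : R * R) := g q.1 * ((k q.2)%:C * cexpi (q.2 * (x - q.1))).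
have mk := integ_measurable ik.
have mg := cintegrable_measurable ig.
have mh : cmeasurable h.
  apply: cmeasurableM; first exact: cmeasurable_comp_fst.
  apply: cmeasurableM; last by apply: cmeasurable_cexpi; exact: measurable_phase.
  by apply: cmeasurableR; exact: (measurableT_comp mk measurable_snd).
have dh y w : normc (h (y, w)) <= normc (g y) * k w.
  by rewrite /h /= normcM normcM normc_cexpi mulr1 normcR ger0_norm.
have [i e] := complex_fubini mh (integ_normc ig) ik dh.
have inner w : cintegral (fun y => h (y, w)) = (k w)%:C * cexpi (w * x) * fourier g w.
  rewrite /fourier -cintegralZ.
    congr cintegral; apply/funext => y; rewrite /h /= mulrBr cexpiD; ring.
  apply: (cintegrable_dom _ (integ_normc ig)).
    apply: cmeasurableM; first exact: mg.
    by apply: cmeasurable_cexpi; exact: measurable_NMl.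
  by move=> y; rewrite normcM normc_cexpi mulr1.
have outer y : cintegral (fun w => h (y, w)) =
    g y * cintegral (fun w => (k w)%:C * cexpi (w * (x - y))).
  rewrite -cintegralZ; first by [].
  apply: (cintegrable_dom _ ik).
    apply: cmeasurableM; first exact: cmeasurableR.
    by apply: cmeasurable_cexpi; exact: measurable_Mr.
  by move=> w; rewrite normcM normc_cexpi mulr1 normcR ger0_norm.
split.
  by move: i; congr cintegrable; apply/funext => w; exact: inner.
rewrite -(_ : (fun y => cintegral (fun w => h (y, w))) =
  (fun y => g y * cintegral (fun w => (k w)%:C * cexpi (w * (x - y))))); last by apply/funext.
by rewrite e; congr cintegral; apply/funext => w; exact: inner.
Qed.

(** By [fourier_weighted] at x = 0 the product of the transform with an everywhere
    positive function is integrable, hence measurable. *)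
Lemma cmeasurable_fourier g : cintegrable g -> cmeasurable (fourier g).
Proof.
move=> ig; have [i _] := fourier_weighted 0 ig integ_lorentz lorentz_ge0.
have mo : measurable_fun [set: R] (@oneDsqr R).
  by apply: continuous_measurable_fun; exact: continuous_oneDsqr.
have := cmeasurableM (cmeasurableR mo) (cintegrable_measurable i).
congr cmeasurable; apply/funext => w.
by rewrite mulr0 /cexpi cos0 sin0 -/(1%:C) rmorph1 mulr1 mulrA -rmorphM /lorentz divff ?rmorph1 ?mul1r.
Qed.

Lemma Lfun2B (u v : R -> R) : u \in Lfun mu 2%:E -> v \in Lfun mu 2%:E ->
  (fun x => u x - v x) \in Lfun mu 2%:E.
Proof.
move=> Lu Lv.
have iu := integZ 2 (Lfun2_integrable_sqr Lu); have iv := integZ 2 (Lfun2_integrable_sqr Lv).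
apply: (Lfun2_intro _ (integD iu iv)) => [|x].
  by apply: measurable_funB; exact: Lfun2_measurable.
by have := sqr_ge0 (u x + v x); lra.
Qed.

Lemma cLfun2B f g : cLfun 2%:E f -> cLfun 2%:E g -> cLfun 2%:E (fun x => f x - g x).
Proof.
move=> [f1 f2] [g1 g2]; split.
  rewrite (_ : _ \o _ = fun x => Re (f x) - Re (g x)); first exact: Lfun2B.
  by apply/funext => x; rewrite /= raddfB.
rewrite (_ : _ \o _ = fun x => Im (f x) - Im (g x)); first exact: Lfun2B.
by apply/funext => x; rewrite /= raddfB.
Qed.

Lemma Lnorm2_fin (k : R -> R) : k \in Lfun mu 2%:E ->
  exists2 K : R, 0 <= K & ('N[mu]_2%:E[EFin \o k] <= K%:E)%E.
Proof.
rewrite inE => /andP[_]; rewrite inE /finite_norm => kfin.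
exists (fine 'N[mu]_2%:E[EFin \o k]); first by rewrite fine_ge0// Lnorm_ge0.
by rewrite fineK// ge0_fin_numE// Lnorm_ge0.
Qed.

Lemma L2_cvg_le (g : (R -> R[i])^nat) f (e : R) : L2_cvg g f -> 0 < e ->
  \forall n \near \oo, ('N[mu]_2%:E[EFin \o (fun x => normc (g n x - f x)%R)] <= e%:E)%E.
Proof.
move=> /fine_cvgP[fin /cvgrPdist_le cv] e0.
have := cv e e0; apply: filterS2 fin => n fn.
rewrite sub0r normrN /= => H; rewrite -[X in (X <= _)%E]fineK// lee_fin.
by apply: le_trans H; exact: ler_norm.
Qed.

(** For the approximating functions in L^1 this is [fourier_weighted].  Both sides are
    continuous for the L^2 norm, by Cauchy-Schwarz against the kernel on the left
    ([gamma_kernel_decay]) and against G on the right. *)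
Theorem convolution_gamma_kernel p A f F x : 0 <= p -> 0 < A -> is_L2_fourier f F ->
  cintegrable (fun y => f y * gamma_kernel p A (x - y)) /\
  convolution f (gamma_kernel p A) x = laplace F p (x +i* A).
Proof.
move=> p0 A0 [Lf LF [g [Lg gf gF]]].
pose G w := pospow p w * expR (- (A * w)).
have G0 w : 0 <= G w by exact: pospow_expR_ge0.
have iG : integ G by exact: integ_pospow.
have LG : G \in Lfun mu 2%:E by exact: Lfun2_pospow.
pose psi y := gamma_kernel p A (x - y).
have [C C0 HC] := gamma_kernel_decay p0 A0.
have mpsi : cmeasurable psi.
  have [m1 m2] := @cmeasurable_gamma_kernel R p A p0 A0.
  have ms := measurable_reflect x.
  by split; [exact: (measurableT_comp m1 ms)|exact: (measurableT_comp m2 ms)].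
have psi2 y : normc (psi y) ^+ 2 <= C * (2 * (1 + x ^+ 2)) * lorentz y.
  apply: le_trans (HC _) _; rewrite -mulrA ler_wpM2l// /lorentz.
  have o1 := lt_le_trans ltr01 (oneDsqr_ge1 (x - y)).
  have o2 := lt_le_trans ltr01 (oneDsqr_ge1 y).
  rewrite ler_pdivlMr// mulrC ler_pdivrMr// /oneDsqr.
  have := sqr_ge0 (2 * x - y); have := sqr_ge0 (x * (x - y)); have := sqr_ge0 x.
  have := sqr_ge0 (x - y); nra.
have Lpsi : (fun y => normc (psi y)) \in Lfun mu 2%:E.
  apply: (Lfun2_intro _ (integZ (C * (2 * (1 + x ^+ 2))) integ_lorentz)) => //.
  exact: measurable_normc.
have [Kp Kp0 HKp] := Lnorm2_fin Lpsi.
have [KG KG0 HKG] := Lnorm2_fin LG.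
pose e w := (G w)%:C * cexpi (w * x).
have ne w : normc (e w) = G w by rewrite /e normcM normc_cexpi mulr1 normcR ger0_norm.
have prod2 f' : cLfun 2%:E f' -> cintegrable (fun y => f' y * psi y).
  move=> Lf'; have := integ_mul (cLfun2_normc Lf') Lpsi => i.
  apply: (cintegrable_dom _ i); first by apply: cmeasurableM => //; exact: cLfun2_measurable.
  by move=> y; rewrite normcM.
have prodF : cintegrable (fun w => e w * F w).
  have := integ_mul (cLfun2_normc LF) LG => i.
  apply: (cintegrable_dom _ i).
    apply: cmeasurableM; last exact: cLfun2_measurable.
    apply: cmeasurableM; first by apply: cmeasurableR; exact: integ_measurable.
    by apply: cmeasurable_cexpi; exact: measurable_Mr.
  by move=> w; rewrite normcM ne mulrC.
have target : laplace F p (x +i* A) = cintegral (fun w => e w * F w).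
  by rewrite /laplace; congr cintegral; apply/funext => w; rewrite kern_line -mulrA mulrC.
have source : convolution f (gamma_kernel p A) x = cintegral (fun y => f y * psi y) by [].
split; first exact: prod2.
rewrite target source.
have key n : cintegral (fun y => g n y * psi y) = cintegral (fun w => e w * fourier (g n) w).
  have ig := cLfun1_cintegrable (Lg n).1.
  have [_ <-] := fourier_weighted x ig iG G0.
  by congr cintegral; apply/funext => y; rewrite /psi gamma_kernelE.
suff nD : normc (cintegral (fun y => f y * psi y) - cintegral (fun w => e w * F w)) <= 0.
  apply/eqP; rewrite -subr_eq0; apply/eqP/eq0_normc/eqP.
  by rewrite eq_le nD normc_ge0.
apply/ler_addgt0Pl => eta eta0; rewrite addr0.
pose ep := eta / (2 * Kp + 2 * KG + 1).
have den : 0 < 2 * Kp + 2 * KG + 1 by rewrite ltr_wpDl// addr_ge0// mulr_ge0.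
have ep0 : 0 < ep by rewrite divr_gt0.
near \oo => n.
have n1 : ('N[mu]_2%:E[EFin \o (fun x => normc (g n x - f x)%R)] <= ep%:E)%E.
  by near: n; exact: L2_cvg_le.
have n2 : ('N[mu]_2%:E[EFin \o (fun x => normc (fourier (g n) x - F x)%R)] <= ep%:E)%E.
  by near: n; exact: (@L2_cvg_le (fun n => fourier (g n))).
have ig := cLfun1_cintegrable (Lg n).1.
have [ie _] := fourier_weighted x ig iG G0.
have -> : cintegral (fun y => f y * psi y) - cintegral (fun w => e w * F w) =
   cintegral (fun w => e w * fourier (g n) w - e w * F w) -
   cintegral (fun y => g n y * psi y - f y * psi y).
  rewrite (cintegralB ie prodF) (cintegralB (prod2 _ (Lg n).2) (prod2 _ Lf)) key.
  by rewrite opprB [RHS]addrC addrA subrK.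
have b1 : normc (cintegral (fun y => g n y * psi y - f y * psi y)) <= 2 * (ep * Kp).
  have Lgf := cLfun2B (Lg n).2 Lf.
  have iu := integ_mul (cLfun2_normc Lgf) Lpsi.
  apply: (@le_trans _ _ (2 * \int[mu]_y (normc (g n y - f y) * normc (psi y)))).
    apply: normc_cintegral_le => //.
      exact: (cintegrableB (prod2 _ (Lg n).2) (prod2 _ Lf)).
    by move=> y; rewrite -mulrBl normcM.
  rewrite ler_pM2l//; apply: l2_product_bound => //.
  - exact/measurable_normc/cLfun2_measurable.
  - exact: measurable_normc.
  - by move=> y; exact: normc_ge0.
  - by move=> y; exact: normc_ge0.
have b2 : normc (cintegral (fun w => e w * fourier (g n) w - e w * F w)) <= 2 * (ep * KG).
  have ieF := cintegrableB ie prodF.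
  have iu : integ (fun w => normc (fourier (g n) w - F w) * G w).
    by apply: integ_ext (integ_normc ieF) => w; rewrite -mulrBr normcM ne mulrC.
  apply: (@le_trans _ _ (2 * \int[mu]_w (normc (fourier (g n) w - F w) * G w))).
    apply: normc_cintegral_le => //.
    by move=> w; rewrite -mulrBr normcM ne mulrC.
  rewrite ler_pM2l//; apply: l2_product_bound => //.
  - apply: measurable_normc; apply: cmeasurableB; first exact: cmeasurable_fourier.
    exact: cLfun2_measurable.
  - exact: integ_measurable.
  - by move=> w; exact: normc_ge0.
apply: le_trans (ler_normcB _ _) _; apply: le_trans (lerD b2 b1) _.
have -> : 2 * (ep * KG) + 2 * (ep * Kp) = ep * (2 * Kp + 2 * KG) by ring.
apply: le_trans (_ : ep * (2 * Kp + 2 * KG + 1) <= _).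
  by rewrite ler_pM2l// lerDl.
by rewrite /ep divfK// gt_eqF.
Unshelve. all: by end_near. Qed.

End ConvolutionTheorem.

(** * Wavelet transforms as analytic functions *)
Lemma int_range (j : int) (i K : nat) : (i < K)%N ->
  j + 1 <= j + K%:Z - i%:Z <= j + K%:Z.
Proof. by move=> iK; apply/andP; split; lia. Qed.

Section Bridge.
Context {R : realType}.
Implicit Types (a p l x : R) (f F : R -> R[i]) (T : R[i] -> R[i]).

(** The analytic function whose values on the line of height a^l are, up to the
    factor a^(l p), the wavelet transform at scale [l]. *)
Definition analytic_ext F p (z : R[i]) : R[i] := ((pi *+ 2)^-1 : R)%:C * laplace F p z.

(** The Cauchy wavelet at scale a^l is (a^l)^p / (2 pi) times [gamma_kernel]. *)
Lemma wavelet_transformE a p l f F x : 0 < a -> 0 <= p -> is_L2_fourier f F ->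
  wavelet_transform a p f l x = (a `^ (l * p))%:C * analytic_ext F p (x +i* a `^ l).
Proof.
move=> a0 p0 fF.
set A := a `^ l; have A0 : 0 < A by exact: powR_gt0.
have AE : a `^ (l * p) = A `^ p by rewrite powRrM.
have hatE w : cauchy_hat p (A * w) = A `^ p * (pospow p w * expR (- (A * w))).
  rewrite /cauchy_hat /pospow pmulr_rgt0//; case: ifP => [w0|_]; last by rewrite mul0r mulr0.
  by rewrite powRM ?(ltW A0) ?(ltW w0)// mulrA.
have psiE y : cauchy_wavelet a p l y =
    (((pi *+ 2)^-1)%:C * (A `^ p)%:C) * gamma_kernel p A y.
  rewrite /cauchy_wavelet /inverse_fourier gamma_kernelE// -mulrA -(cintegralZ (A `^ p)%:C).
    congr (_ * cintegral _); apply/funext => w.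
    by rewrite -/A hatE rmorphM mulrA.
  have := cintegrable_kern 0 (laplace_admissible_cst p0) (A0 : 0 < Im (y +i* A)).
  by congr cintegrable; apply/funext => w; rewrite kern_line mul1r.
have [ci cE] := @convolution_gamma_kernel R p A f F x p0 A0 fF.
rewrite /wavelet_transform /convolution.
rewrite (_ : (fun y => f y * cauchy_wavelet a p l (x - y)) =
   (fun y => (((pi *+ 2)^-1)%:C * (A `^ p)%:C) * (f y * gamma_kernel p A (x - y)))); last first.
  by apply/funext => y; rewrite psiE mulrCA.
rewrite cintegralZ// -/(convolution f (gamma_kernel p A) x) cE /analytic_ext AE.
by rewrite mulrA [(A `^ p)%:C * _]mulrC.
Qed.

Definition line_sup T1 T2 (y : R) : R :=
  sup (range (fun x : R => normc (T1 (x +i* y))) `|` range (fun x : R => normc (T2 (x +i* y)))).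

Lemma sup_rangeU (u1 u2 : R -> R) (C : R) :
  (forall x, u1 x <= C /\ u2 x <= C) ->
  (forall x, u1 x <= sup (range u1 `|` range u2) /\ u2 x <= sup (range u1 `|` range u2)) /\
  (forall B, (forall x, u1 x <= B /\ u2 x <= B) -> sup (range u1 `|` range u2) <= B).
Proof.
move=> HC.
have hu : has_ubound (range u1 `|` range u2).
  by exists C => _ [[x _ <-]|[x _ <-]]; have [] := HC x.
split.
  by move=> x; split; apply: ub_le_sup => //; [left|right]; exists x.
move=> B HB; apply: ge_sup; first by exists (u1 0); left; exists 0.
by move=> _ [[x _ <-]|[x _ <-]]; have [] := HB x.
Qed.

Lemma sup_rangeZ (u1 u2 : R -> R) (C c : R) : 0 < c ->
  (forall x, u1 x <= C /\ u2 x <= C) ->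
  sup (range (fun x => c * u1 x) `|` range (fun x => c * u2 x)) = c * sup (range u1 `|` range u2).
Proof.
move=> c0 HC.
have [ub lub] := sup_rangeU HC.
have HcC x : c * u1 x <= c * C /\ c * u2 x <= c * C by have [] := HC x; rewrite !ler_pM2l.
have [cub club] := sup_rangeU HcC.
apply/eqP; rewrite eq_le; apply/andP; split.
  by apply: club => x; have [] := ub x; rewrite !ler_pM2l.
rewrite -ler_pdivlMl//; apply: lub => x; rewrite !ler_pdivlMl//; exact: cub.
Qed.

Lemma analytic_ext_halfplane p F1 F2 : laplace_admissible p F1 -> laplace_admissible p F2 ->
  halfplane_sup (analytic_ext F1 p) (analytic_ext F2 p)
    (line_sup (analytic_ext F1 p) (analytic_ext F2 p)).
Proof.
move=> d1 d2.
have bd y : 0 < y -> exists C : R, forall z, y <= Im z ->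
    normc (analytic_ext F1 p z) <= C /\ normc (analytic_ext F2 p z) <= C.
  move=> y0; have [C1 H1] := laplace_bounded d1 y0; have [C2 H2] := laplace_bounded d2 y0.
  pose c := normc ((pi *+ 2)^-1 : R)%:C.
  have c0 : 0 <= c by exact: normc_ge0.
  exists (c * Num.max C1 C2) => z yz; rewrite /analytic_ext !normcM -/c.
  have b1 := H1 z yz; have b2 := H2 z yz.
  split; apply: (ler_wpM2l c0).
    by apply: (le_trans b1); rewrite le_max lexx.
  by apply: (le_trans b2); rewrite le_max lexx orbT.
have bl y : 0 < y -> exists C : R, forall x : R,
    normc (analytic_ext F1 p (x +i* y)) <= C /\ normc (analytic_ext F2 p (x +i* y)) <= C.
  by move=> y0; have [C HC] := bd y y0; exists C => x; exact: HC.
split => //.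
- by move=> z z0; split; apply: jet2M; [exact: jet2_cst|exact: jet2_laplace|exact: jet2_cst|exact: jet2_laplace].
- move=> z z0; have [C HC] := bl _ z0; have [ub _] := sup_rangeU HC.
  by have := ub (Re z); case: z {z0 HC ub}.
- by move=> y B y0 HB; have [C HC] := bl _ y0; have [_ lub] := sup_rangeU HC; exact: lub.
Qed.

Lemma wavelet_supE a p f1 f2 F1 F2 l : 0 < a -> 0 <= p ->
  is_L2_fourier f1 F1 -> is_L2_fourier f2 F2 ->
  wavelet_sup a p f1 f2 l =
  a `^ (l * p) * line_sup (analytic_ext F1 p) (analytic_ext F2 p) (a `^ l).
Proof.
move=> a0 p0 fF1 fF2.
have d1 : laplace_admissible p F1 by apply: laplace_admissible_L2 => //; case: fF1.
have d2 : laplace_admissible p F2 by apply: laplace_admissible_L2 => //; case: fF2.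
have [_ bd _ _] := analytic_ext_halfplane d1 d2.
have A0 : 0 < a `^ l by exact: powR_gt0.
have [C HC] := bd _ A0.
have c0 : 0 < a `^ (l * p) by exact: powR_gt0.
rewrite /line_sup -(sup_rangeZ c0 (fun x => HC (x +i* a `^ l) (lexx _))) /wavelet_sup.
have nE f F x : is_L2_fourier f F -> normc (wavelet_transform a p f l x) =
    a `^ (l * p) * normc (analytic_ext F p (x +i* a `^ l)).
  by move=> fF; rewrite (wavelet_transformE l x a0 p0 fF) normcM normcR gtr0_norm.
rewrite (_ : (fun x => normc (wavelet_transform a p f1 l x)) =
  (fun x => a `^ (l * p) * normc (analytic_ext F1 p (x +i* a `^ l)))); last first.
  by apply/funext => x; exact: nE.
rewrite (_ : (fun x => normc (wavelet_transform a p f2 l x)) =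
  (fun x => a `^ (l * p) * normc (analytic_ext F2 p (x +i* a `^ l)))) //.
by apply/funext => x; exact: nE.
Qed.

Lemma ler_powR_inv a x y : 1 < a -> a `^ x <= a `^ y -> x <= y.
Proof.
move=> a1; have a0 : 0 < a by exact: lt_trans a1.
rewrite -(@ler_ln _ (a `^ x)) ?posrE ?powR_gt0// !ln_powR ler_pM2r//.
exact: ln_gt0.
Qed.

Lemma modulus_gap_scale (c u v s e : R) : 0 < c ->
  (`|(c * u) ^+ 2 - (c * v) ^+ 2| <= e * (c * s) ^+ 2) = (`|u ^+ 2 - v ^+ 2| <= e * s ^+ 2).
Proof.
move=> c0; have c2 : 0 < c ^+ 2 by rewrite exprn_gt0.
have -> : (c * u) ^+ 2 - (c * v) ^+ 2 = c ^+ 2 * (u ^+ 2 - v ^+ 2) by ring.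
have -> : e * (c * s) ^+ 2 = c ^+ 2 * (e * s ^+ 2) by ring.
by rewrite normrM (gtr0_norm c2) ler_pM2l.
Qed.

Lemma modulus_low_scale (c u s e : R) : 0 < c ->
  (e * (c * s) ^+ 2 <= (c * u) ^+ 2) = (e * s ^+ 2 <= u ^+ 2).
Proof.
move=> c0; have c2 : 0 < c ^+ 2 by rewrite exprn_gt0.
have -> : e * (c * s) ^+ 2 = c ^+ 2 * (e * s ^+ 2) by ring.
by rewrite exprMn ler_pM2l.
Qed.

End Bridge.

(** * The stability bound *)
Theorem theorem5p2 (R : realType) (a p : R) (j : int) (K : nat)
    (eps kappa M : R) (k : nat) (J : R) :
  1 < a < 2 -> 0 < p -> (2 <= K)%N -> ~~ odd K ->
  0 < eps < 1 -> 0 < kappa < 1 -> 0 < M ->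
  (1 <= k)%N -> a ^- k < 2 - a ->
  a `^ J = 2 / (a + 1) * a ^ (j + K%:Z) + (a - 1) / (a + 1) * a ^ j ->
  [/\ j%:~R + K%:R - 1 <= J <= j%:~R + K%:R,
      0 < c_exponent a k < 1 &
      forall f1 f2 F1 F2 : R -> R[i],
      let mu := @lebesgue_measure R in
      let W1 := wavelet_transform a p f1 in
      let W2 := wavelet_transform a p f2 in
      let N := wavelet_sup a p f1 f2 in
      let c := c_exponent a k in
      let d := d_exponent a k K M in
      is_L2_fourier f1 F1 -> is_L2_fourier f2 F2 ->
      ~ {ae mu, forall x, f1 x = 0} -> ~ {ae mu, forall x, f2 x = 0} ->
      {ae mu, forall w : R, w < 0 -> F1 w = 0} ->
      {ae mu, forall w : R, w < 0 -> F2 w = 0} ->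
      eps `^ (2 * (1 - c)) <= kappa ->
      (forall (x : R) (l : int),
         - (M * a ^ (j + K%:Z)) <= x <= M * a ^ (j + K%:Z) ->
         j + 1 <= l <= j + K%:Z ->
         [/\ `|normc (W1 l%:~R x) ^+ 2 - normc (W2 l%:~R x) ^+ 2|
               <= eps * N l%:~R ^+ 2,
             kappa * N l%:~R ^+ 2 <= normc (W1 l%:~R x) ^+ 2 &
             kappa * N l%:~R ^+ 2 <= normc (W2 l%:~R x) ^+ 2]) ->
      d < 1 ->
      forall x : R,
        - (M * a ^ (j + K%:Z) / 2) <= x <= M * a ^ (j + K%:Z) / 2 ->
        1 / (N J * N j%:~R) *
          normc ((W1 J x)^* * W1 j%:~R x - (W2 J x)^* * W2 j%:~R x)
        <= C_constant a p f1 f2 j K k kappa / kappa `^ (K%:R / 4)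
           * eps `^ d].
Proof.
move=> /andP[a1 a2] p0 K2 oddK /andP[e0 e1] /andP[ka0 ka1] M0 k1 ak aJ.
have a0 : 0 < a by exact: lt_trans a1.
have p0' : 0 <= p by exact: ltW.
have ak0 : 0 < a ^- k by rewrite invr_gt0 exprn_gt0.
have KE : (K = 2 * K./2)%N by rewrite mul2n even_halfK.
set m := K./2 in KE.
have m1 : (1 <= m)%N by case: m KE => [|//] KE0; move: K2; rewrite KE0.
pose L : R := a ^ (j + K%:Z).
have L0 : 0 < L by exact: exprz_gt0.
have an0 : a != 0 by rewrite gt_eqF.
have powL (n : int) : a `^ (n%:~R) = a ^ n by rewrite powR_intmul// ltW.
have LY (i : nat) : L / a ^+ i = a `^ (j%:~R + K%:R - i%:R).
  rewrite /L; have -> : j%:~R + K%:R - i%:R = (j + K%:Z - i%:Z)%:~R :> R.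
    by rewrite rmorphB rmorphD.
  by rewrite powL [RHS]expfzDr// exprnN.
have LK : L / a ^+ K = a ^ j.
  by rewrite LY addrK powL.
have aJ' : a `^ J = 2 / (a + 1) * L + (a - 1) / (a + 1) * (L / a ^+ (2 * m)).
  by rewrite -KE LK.
split.
- have a10 : 0 < a + 1 by lra.
  have aK : 0 < a ^ j by exact: exprz_gt0.
  have hK : a ^ j <= L by rewrite -LK ler_pdivrMr ?exprn_gt0// ler_peMr ?(ltW L0)// exprn_ege1// ltW.
  have lo : a `^ (j%:~R + K%:R - 1) = L / a by have := LY 1%N; rewrite expr1.
  have up : a `^ (j%:~R + K%:R) = L by have := LY 0%N; rewrite expr0 divr1 subr0.
  have r0 : 0 <= (a - 1) / (a + 1) by rewrite divr_ge0//; lra.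
  apply/andP; split; apply: (ler_powR_inv a1); rewrite ?lo ?up aJ -/L.
    apply: le_trans (_ : 2 / (a + 1) * L <= _); last by rewrite lerDl mulr_ge0// ltW.
    rewrite [leRHS]mulrC ler_pM2l// ler_pdivlMr// mulrC ler_pdivrMr//; lra.
  have E : 2 / (a + 1) * L + (a - 1) / (a + 1) * L = L by field; rewrite gt_eqF.
  by rewrite -[leRHS]E lerD2l ler_wpM2l.
- exact: c_exponent_itv.
move=> f1 f2 F1 F2 mu W1 W2 N c d fF1 fF2 _ _ _ _ kapc hyp d1 x xM.
pose T1 := analytic_ext F1 p; pose T2 := analytic_ext F2 p.
pose S := line_sup T1 T2.
have HS : halfplane_sup T1 T2 S.
  by apply: analytic_ext_halfplane; apply: laplace_admissible_L2 => //; [case: fF1|case: fF2].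
have W1E l y : W1 l y = (a `^ (l * p))%:C * T1 (y +i* a `^ l) by exact: wavelet_transformE.
have W2E l y : W2 l y = (a `^ (l * p))%:C * T2 (y +i* a `^ l) by exact: wavelet_transformE.
have NE l : N l = a `^ (l * p) * S (a `^ l) by exact: wavelet_supE.
have c0 l : 0 < a `^ (l * p) by exact: powR_gt0.
have Hdiff y (i : nat) : - (M * L) <= y <= M * L -> (i < 2 * m)%N ->
  [/\ `|normc (T1 (y +i* (L / a ^+ i))) ^+ 2 - normc (T2 (y +i* (L / a ^+ i))) ^+ 2|
        <= eps * S (L / a ^+ i) ^+ 2,
      kappa * S (L / a ^+ i) ^+ 2 <= normc (T1 (y +i* (L / a ^+ i))) ^+ 2 &
      kappa * S (L / a ^+ i) ^+ 2 <= normc (T2 (y +i* (L / a ^+ i))) ^+ 2].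
  move=> yM im; rewrite -KE in im.
  have il := int_range j im.
  have := hyp y _ yM il.
  have -> : (j + K%:Z - i%:Z)%:~R = j%:~R + K%:R - i%:R :> R by rewrite rmorphB rmorphD.
  rewrite W1E W2E NE -LY !normcM normcR (gtr0_norm (c0 _)).
  by rewrite modulus_gap_scale// !modulus_low_scale.
have := chain_bound HS a1 a2 L0 M0 ka0 ka1 e0 e1 m1 k1 ak kapc Hdiff xM.
rewrite -aJ' -KE LK; set D := cross_diff _ _ _ _ _; move=> HD.
have DE : (W1 J x)^* * W1 j%:~R x - (W2 J x)^* * W2 j%:~R x =
    (a `^ (J * p) * a `^ (j%:~R * p))%:C * D.
  have cj (r : R) (z : R[i]) : ((r%:C * z)^*)%R = r%:C * (z^*)%R.
    by case: z => z1 z2; apply/eqP; rewrite eq_complex /=; apply/andP; split; apply/eqP; ring.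
  by rewrite /D /cross_diff !W1E !W2E !cj powL [in RHS]rmorphM; ring.
(* The powers of a in the constant are those which turn the suprema of the wavelet
   transforms into suprema of the analytic functions. *)
have CE : C_constant a p f1 f2 j K k kappa / kappa `^ (K%:R / 4) =
    6 / (1 - Num.sqrt kappa) *
     \prod_(i < m) (S (L / a ^+ (2 * i + 1 + k)) / S (L / a ^+ (2 * i + 2))) / Num.sqrt kappa ^+ m.
  rewrite /C_constant; congr (_ * _ / _).
    apply: eq_bigr => i _; rewrite -/N !NE.
    have -> : j%:~R + K%:R - 2 * i%:R - 1 - k%:R = j%:~R + K%:R - (2 * i + 1 + k)%:R :> R.
      by rewrite natrD natrD natrM; ring.
    have -> : j%:~R + K%:R - 2 * i%:R - 2 = j%:~R + K%:R - (2 * i + 2)%:R :> R.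
      by rewrite natrD natrM; ring.
    have E : a `^ (p * (k%:R - 1)) * a `^ ((j%:~R + K%:R - (2 * i + 1 + k)%:R) * p) =
        a `^ ((j%:~R + K%:R - (2 * i + 2)%:R) * p).
      rewrite -powRD; last by rewrite an0 implybT.
      by congr (_ `^ _); rewrite natrD natrD natrD natrM; ring.
    rewrite -!LY -E invfM; set u := S _; set v := S _.
    set c1 := a `^ _; set c2 := a `^ _; set v' := v^-1.
    have c10 : c1 != 0 by rewrite gt_eqF// powR_gt0.
    have c20 : c2 != 0 by rewrite gt_eqF// powR_gt0.
    by field; rewrite c10 c20.
  rewrite KE natrM; have -> : 2 * m%:R / 4 = 2^-1 * m%:R :> R by field.
  by rewrite powRrM powR12_sqrt ?(ltW ka0)// powR_mulrn// sqrtr_ge0.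
have S0 y : 0 < y -> 0 <= S y by exact: (sup_ge0 HS).
(* If N_J N_j = 0, the left side is 0 because x / 0 = 0. *)
have [SJ|SJ] := eqVneq (S (a `^ J) * S (a ^ j)) 0.
  have -> : N J * N j%:~R = 0 by rewrite !NE powL mulrACA SJ mulr0.
  rewrite invr0 mulr0 mul0r CE; apply: mulr_ge0; last exact: powR_ge0.
  apply: divr_ge0; last by rewrite exprn_ge0 ?sqrtr_ge0.
  apply: mulr_ge0; last first.
    by apply: prodr_ge0 => i _; apply: divr_ge0; apply: S0; rewrite LY powR_gt0.
  apply: divr_ge0 => //; rewrite subr_ge0 -[leRHS]sqrtr1 ler_wsqrtr//; exact: ltW.
have aj0 : 0 < a ^ j by exact: exprz_gt0.
have SJ0 : 0 < S (a `^ J) * S (a ^ j).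
  by rewrite lt_neqAle eq_sym SJ mulr_ge0 ?S0 ?powR_gt0.
rewrite CE DE normcM normcR ger0_norm; last by rewrite mulr_ge0 ?powR_ge0.
rewrite !NE powL.
have -> : 1 / (a `^ (J * p) * S (a `^ J) * (a `^ (j%:~R * p) * S (a ^ j))) *
    (a `^ (J * p) * a `^ (j%:~R * p) * normc D) = normc D / (S (a `^ J) * S (a ^ j)).
  move: SJ; rewrite mulf_eq0 negb_or => /andP[s1 s2].
  have c1 := lt0r_neq0 (c0 J); have c2 := lt0r_neq0 (c0 j%:~R).
  move: (S (a `^ J)) (S (a ^ j)) (a `^ (J * p)) (a `^ (j%:~R * p)) s1 s2 c1 c2 => u1 u2 u3 u4 h1 h2 h3 h4.
  by field; rewrite h1 h2 h3 h4.
rewrite ler_pdivrMr//; apply: le_trans HD _.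
by rewrite [leLHS]mulrAC.
Qed.
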